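(* Let $n\geqslant 3$ and let $k$ be an integer with $1\leqslant k\leqslant n$. There exist $\delta_0\in(0,1)$ and $K_0>0$, depending only on $n$ and $k$, such that the following holds for every $\delta\in(0,\delta_0]$. Let $m$ be an integer with $0\leqslant m<k$, let $a=(a_1,\dots,a_m)\in\mathbb{R}^m$ be such that the polynomial $P(t)=t^m+\sum_{r=1}^m(-1)^ra_rt^{m-r}$ has $m$ real roots $y_1,\dots,y_m$ (counted with multiplicity), put $y=(y_1,\dots,y_m)$, $y_{\min}=\min_i y_i$, $K_1=\delta^{-1}y_{\min}$, and $$F(\lambda)=\sigma_k^{(n)}(\lambda)+\sum_{r=1}^m a_r\sigma_{k-r}^{(n)}(\lambda).$$ Suppose $\lambda=(\lambda_1,\dots,\lambda_n)\in\mathbb{R}^n$ satisfies $(\lambda,y)\in\Gamma_k^{n+m}$, $\lambda_1\geqslant\lambda_2\geqslant\cdots\geqslant\lambda_n\geqslant-\delta\lambda_1$, $y_m\geqslant-\delta\lambda_1$, and $\lambda_1>\max\{K_0F(\lambda)^{1/k},-K_1\}$. Then, with $\gamma=1/(1+16k)$, for every $\xi=(\xi_1,\dots,\xi_n)\in\mathbb{R}^n$, $$-\sum_{p\neq q}\frac{F_{pq}\xi_p\xi_q}{F}+2\frac{\left(\sum_{i=1}^nF_i\xi_i\right)^2}{F^2}+2\sum_{i>1}\frac{F_i\xi_i^2}{(1+2\delta)\lambda_1F}\geqslant(1+\gamma)\frac{F_1\xi_1^2}{\lambda_1F},$$ where $F$, $F_i$, $F_{pq}$ are evaluated at $\lam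bda$.
   Context: $\sigma_j^{(N)}$ denotes the $j$-th elementary symmetric function on $\mathbb{R}^N$, with $\sigma_0^{(N)}=1$ and $\sigma_j^{(N)}=0$ for $j<0$ or $j>N$. The G{\aa}rding cone is $\Gamma_j^{N}=\{\mu\in\mathbb{R}^{N}:\sigma_i^{(N)}(\mu)>0,\ i=1,\dots,j\}$. $(\lambda,y)\in\mathbb{R}^{n+m}$ is the concatenation of $\lambda$ and $y$. $F_i=\partial F/\partial\lambda_i$ and $F_{pq}=\partial^2F/\partial\lambda_p\partial\lambda_q$. The sum over $p\neq q$ runs over all ordered pairs of distinct indices in $\{1,\dots,n\}$. When $m=0$, $F=\sigma_k^{(n)}$ and all conditions involving $y$ and $K_1$ are vacuous. *)

(* Defs.v *)
From mathcomp Require Import all_boot all_order all_algebra.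
From mathcomp Require Import all_classical all_reals all_analysis.
From mathcomp Require mpoly.

Set Implicit Arguments.
Unset Strict Implicit.
Unset Printing Implicit Defensive.

Import Order.TTheory GRing.Theory Num.Theory.
Import numFieldNormedType.Exports.

Local Open Scope ring_scope.
Local Open Scope classical_set_scope.

Definition sigma (R : realType) (N j : nat) (x : 'rV[R]_N) : R :=
  mpoly.meval (fun i => x 0 i) (mpoly.mesym N R j).

Definition garding (R : realType) (N j : nat) : set 'rV[R]_N :=
  [set mu | forall i : nat, (1 <= i <= j)%N -> 0 < sigma i mu].

(* Vectors are indexed from 0: [a 0 r] is the coefficient a_{r+1}. *)
Definition Ppoly (R : realType) (m : nat) (a : 'rV[R]_m) : {poly R} :=
  'X^m + \sum_(r < m) ((-1) ^+ r.+1 * a 0 r) *: 'X^(m - r.+1).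

(* The truncated subtraction is harmless when m <= k. *)
Definition Ffun (R : realType) (n k m : nat) (a : 'rV[R]_m)
    (lambda : 'rV[R]_n) : R :=
  sigma k lambda + \sum_(r < m) a 0 r * sigma (k - r.+1) lambda.

Definition partial (R : realType) (n : nat) (i : 'I_n) (f : 'rV[R]_n -> R) :
    'rV[R]_n -> R :=
  fun x => 'D_(delta_mx 0 i) f x.

(* The minimum over an empty index set is +oo, so that for m = 0 the bound
   lambda_1 > - K_1 is vacuous. *)
Definition ymin (R : realType) (m : nat) (y : 'rV[R]_m) : \bar R :=
  \big[Order.min/+oo%E]_(i < m) (y 0 i)%:E.

(* Main.v *)
(* Idea.  By homogeneity normalise lambda_1 = 1 and put mu = (lambda, y), so
   that F is the k-th elementary symmetric function of mu; the entries of mu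
   are >= - delta and the direction xi vanishes on the entries y.  Along a
   decreasing chain of thresholds T_0 = 1 > T_1 > ... of length exceeding n + m,
   the pigeonhole principle gives a gap: every |mu_i| is either >= T_j (the set B,
   which contains the index 1) or <= T_(j+1), negligible compared to T_j (the
   set S).  If B had at least k elements, F would be bounded below, against
   lambda_1 > K_0 F^(1/k).
   Otherwise let r = k - |B| >= 1, write a_j for sigma_(r+j) of the entries in S
   and x_b = 1/mu_b.  Then F = (prod_B mu_b) * sum_j sigma_j(x) a_j, and every
   term with j >= 2 is negligible.  Differentiating a_0 + (sum_b x_b) a_1 in the
   S-directions uses the concavity of a_0^(1/r) and of a_1/a_0, the latter with
   an explicit sum of squares.  What remains is a quadratic form in
   tau_b = xi_b/mu_b, bounded below by (1 + 1/(10 k)) F_1 tau_1^2 with Jensen's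
   and Cauchy's inequalities; a reserve in this bound absorbs the errors. *)

From mathcomp Require Import all_boot all_order all_algebra.
From mathcomp Require Import ring lra zify.

Set Implicit Arguments.
Unset Strict Implicit.
Unset Printing Implicit Defensive.

Import Order.TTheory GRing.Theory Num.Theory.

Local Open Scope ring_scope.

(** * Elementary symmetric functions and Newton's inequalities *)

(** The obstacle is the set S. Its entries may be negative, and [a_0], its derivatives [d_i] in the
    entries of S and its second derivatives need not have comparable sizes. So all estimates on S
    are relative: the direction is measured by [sum_i d_i w_i^2 = a_0 dq^2], and the sign
    information comes from the Garding cone, through Newton's inequalities and through
    [sum_i v_i^2 d_i >= 0], which is a positive multiple of [- a_1] up to a negligible term. The
    ratio [- a_1 / a_0] may still be as small as 0, yet one has to divide by it. It is therefore
    replaced by a number [s >= h^2], where [eta = h^4] bounds the entries of S; direction entries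
    then have size [h^2] and the final error has size [h].

    The part of the form weighted by [s] gains [1/(5k)] over the coefficient 1. Half of the gain
    becomes the reserve, and the remaining [1/(10k)] exceeds [gamma].

    [elsym] takes values in any commutative ring because every identity for it is read a second time
    in [{poly R}], along a line, where its coefficients are identities between derivatives. *)

Definition elsym (R : comNzRingType) (I : finType) (A : {set I}) (j : nat)
    (v : I -> R) : R :=
  (\prod_(i in A) (1 + v i *: 'X))`_j.

Section Esym.
Variables (R : comNzRingType) (I : finType).
Implicit Types (A B : {set I}) (v : I -> R) (j : nat).

Lemma elsym0 A v : elsym A 0 v = 1.
Proof.
rewrite /elsym -horner_coef0 horner_prod big1 // => i _.
by rewrite hornerD hornerZ hornerX mulr0 addr0 hornerC.
Qed.

Lemma elsymS A i j v : i \in A ->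
  elsym A j.+1 v = v i * elsym (A :\ i) j v + elsym (A :\ i) j.+1 v.
Proof.
move=> iA; rewrite /elsym (big_setD1 i) //= mulrDl mul1r coefD addrC.
by rewrite -scalerAl coefZ coefXM.
Qed.

Lemma elsym_set0 j v : elsym set0 j.+1 v = 0.
Proof. by rewrite /elsym big_set0 coef1. Qed.

Lemma eq_elsym A j v w : {in A, v =1 w} -> elsym A j v = elsym A j w.
Proof.
move=> vw; rewrite /elsym (eq_bigr (fun i => 1 + w i *: 'X)) // => i iA.
by rewrite vw.
Qed.

Lemma set_ind (P : {set I} -> Prop) :
  (forall A, (forall i, i \in A -> P (A :\ i)) -> P A) -> forall A, P A.
Proof.
move=> PI A; have [n] := ubnP #|A|; elim: n => // n IHn in A * => An.
apply: PI => i iA; apply: IHn; move: An; rewrite (cardsD1 i A) iA; lia.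
Qed.

Lemma setD1C A i k : A :\ i :\ k = A :\ k :\ i.
Proof. by rewrite setDDl setUC -setDDl. Qed.

Lemma elsym_gt A j v : (#|A| < j)%N -> elsym A j v = 0.
Proof.
elim/set_ind: A j => A IH [//|j] Aj.
have [->|[i iA]] := set_0Vmem A; first exact: elsym_set0.
have e : #|A| = #|A :\ i|.+1 by rewrite (cardsD1 i A) iA.
by rewrite (elsymS _ _ iA) !(IH i iA) ?mulr0 ?addr0 //; lia.
Qed.

(** Euler's identity for a form of degree [j.+1]: deleting [i] is differentiating in the entry [i].
    In the induction one entry [k] is expanded in every summand, and both resulting sums are
    instances for [A :\ k]. *)
Lemma elsym_euler A j v :
  \sum_(i in A) v i * elsym (A :\ i) j v = j.+1%:R * elsym A j.+1 v.
Proof.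
elim/set_ind: A j => A IH j.
have [->|[k kA]] := set_0Vmem A; first by rewrite big_set0 elsym_set0 mulr0.
rewrite (big_setD1 k) //= (elsymS _ _ kA).
case: j => [|j].
  have -> : \sum_(i in A :\ k) v i * elsym (A :\ i) 0 v
          = \sum_(i in A :\ k) v i * elsym (A :\ k :\ i) 0 v.
    by apply: eq_bigr => i _; rewrite !elsym0.
  by rewrite IH // !mul1r.
have -> : \sum_(i in A :\ k) v i * elsym (A :\ i) j.+1 v
    = v k * \sum_(i in A :\ k) v i * elsym (A :\ k :\ i) j v
      + \sum_(i in A :\ k) v i * elsym (A :\ k :\ i) j.+1 v.
  rewrite mulr_sumr -big_split; apply: eq_bigr => i; rewrite !inE => /andP[ik iA].
  rewrite (@elsymS (A :\ i) k) ?inE 1?eq_sym ?ik // setD1C /=; ring.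
rewrite !IH // -[j.+2%:R]natr1; ring.
Qed.

Lemma elsym1 A v : elsym A 1 v = \sum_(i in A) v i.
Proof.
rewrite -[LHS]mul1r -(elsym_euler A 0); apply: eq_bigr => i _.
by rewrite elsym0 mulr1.
Qed.

(** Multiply the expansion of sigma_(j+1) at [i] by [v i], sum, and use Euler's identity. On the
    cone the left side is nonnegative, which is the source of the estimates for small entries. *)
Lemma elsym_sumsq A j v :
  \sum_(i in A) v i ^+ 2 * elsym (A :\ i) j v
  = elsym A 1 v * elsym A j.+1 v - j.+2%:R * elsym A j.+2 v.
Proof.
rewrite elsym1 mulr_suml -elsym_euler -sumrB; apply: eq_bigr => i iA.
rewrite (elsymS j v iA); ring.
Qed.

Definition ndiff A j v := elsym A j.+1 v ^+ 2 - elsym A j v * elsym A j.+2 v.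

(** The defect in Newton's inequality is a combination, with nonnegative weights [v i ^+ 2], of
    defects one level lower after a deletion. Newton's inequalities follow by induction for entries
    of any sign, without any appeal to real-rootedness. *)
Lemma newton_sum A j v :
  j.+1%:R * elsym A j.+1 v ^+ 2 - j.+2%:R * (elsym A j v * elsym A j.+2 v)
  = if j is j'.+1 then \sum_(i in A) v i ^+ 2 * ndiff (A :\ i) j' v
    else \sum_(i in A) v i ^+ 2.
Proof.
have -> : j.+1%:R * elsym A j.+1 v ^+ 2 - j.+2%:R * (elsym A j v * elsym A j.+2 v)
   = \sum_(i in A) v i * (elsym (A :\ i) j v * elsym A j.+1 v
       - elsym (A :\ i) j.+1 v * elsym A j v).
  transitivity (elsym A j.+1 v * (j.+1%:R * elsym A j.+1 v)
                - elsym A j v * (j.+2%:R * elsym A j.+2 v)); first by ring.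
  rewrite -!elsym_euler !mulr_sumr -sumrB; apply: eq_bigr => i _; ring.
case: j => [|j]; apply: eq_bigr => i iA.
  by rewrite !elsym0 (elsymS 0 v iA) elsym0; ring.
rewrite /ndiff (elsymS j.+1 v iA) (elsymS j v iA); ring.
Qed.

End Esym.

Lemma raddf_elsym (R S : comNzRingType) (f : {rmorphism R -> S}) (I : finType)
  (A : {set I}) j (v : I -> R) : f (elsym A j v) = elsym A j (f \o v).
Proof.
rewrite /elsym -coef_map rmorph_prod (eq_bigr (fun i => 1 + f (v i) *: 'X)) //.
by move=> i _; rewrite rmorphD rmorph1 /= map_polyZ map_polyX.
Qed.

Definition gard (R : realFieldType) (I : finType) (A : {set I}) (j : nat)
  (v : I -> R) : Prop := forall m, (m <= j)%N -> 0 < elsym A m v.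

Section Cone.
Variables (R : realFieldType) (I : finType).
Implicit Types (A B : {set I}) (v : I -> R) (j : nat).

(** The form without factors is the one that [newton_sum] takes as input. Its output carries the
    factors [j.+1] and [j.+2], which may be dropped again when the product of the outer terms is
    positive. *)
Lemma ndiff_ge0 A j v : 0 <= ndiff A j v.
Proof.
elim: j A => [|j IH] A; rewrite /ndiff subr_ge0.
  have : 0 <= \sum_(i in A) v i ^+ 2 by apply: sumr_ge0 => i _; apply: sqr_ge0.
  rewrite -(newton_sum A 0).
  have := sqr_ge0 (elsym A 1 v); lra.
have : 0 <= \sum_(i in A) v i ^+ 2 * ndiff (A :\ i) j v.
  by apply: sumr_ge0 => i _; rewrite mulr_ge0 ?sqr_ge0.
rewrite -(newton_sum A j.+1) -(natr1 j.+2) => h.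
have j0 : 0 < j.+2%:R :> R by rewrite ltr0n.
have [le0|gt0] := leP (elsym A j.+1 v * elsym A j.+3 v) 0.
  exact: le_trans le0 (sqr_ge0 _).
rewrite -(ler_pM2l j0); lra.
Qed.

Lemma newton A j v :
  j.+2%:R * (elsym A j v * elsym A j.+2 v) <= j.+1%:R * elsym A j.+1 v ^+ 2.
Proof.
rewrite -subr_ge0 newton_sum; case: j => [|j]; apply: sumr_ge0 => i _.
  exact: sqr_ge0.
by rewrite mulr_ge0 ?sqr_ge0 ?ndiff_ge0.
Qed.

Lemma gardS A j v : gard A j.+1 v -> gard A j v.
Proof. by move=> g m mj; apply: g; apply: leqW. Qed.

(* If sigma_m were nonpositive after deleting i, positivity of sigma_m and
   sigma_(m+1) with i present would contradict Newton's inequality. *)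
Lemma gardD1 A j v i : i \in A -> gard A j.+1 v -> gard (A :\ i) j v.
Proof.
move=> iA g; elim=> [|m IH] mj; first by rewrite elsym0.
have {IH} h0 := IH (ltnW mj).
rewrite ltNge; apply/negP => h1.
have := g m.+1 (leqW mj); have := g m.+2 mj.
rewrite !(elsymS _ v iA) => g2 g1.
have := ndiff_ge0 (A :\ i) m v; rewrite /ndiff.
set a := elsym _ m v in h0 g1 *; set b := elsym _ m.+1 v in h1 g1 g2 *.
set c := elsym _ m.+2 v in g2 *; nra.
Qed.

Lemma gardD A B j v : B \subset A -> gard A (#|B| + j) v -> gard (A :\: B) j v.
Proof.
elim/set_ind: B A => B IH A BA.
have [->|[i iB]] := set_0Vmem B; first by rewrite cards0 setD0.
rewrite (cardsD1 i B) iB add1n addSn => g.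
have iA := subsetP BA i iB.
have -> : A :\: B = (A :\ i) :\: (B :\ i).
  by apply/setP => l; rewrite !inE; case: eqVneq => [->|]; rewrite ?iB ?andbF.
apply: IH => //; first by apply: setSD.
exact: gardD1.
Qed.

End Cone.

(** * Second-order expansions and concavity *)

(* Coefficients 0, 1, 2 of sigma_j (v + t w): the value, the first derivative
   and half of the second derivative along w. *)
Definition line (R : comNzRingType) (I : finType) (v w : I -> R) (i : I) :
  {poly R} := (v i)%:P + w i *: 'X.
Definition jet (R : comNzRingType) (I : finType) (v w : I -> R) (m : nat)
  (A : {set I}) (j : nat) : R := (elsym A j (line v w))`_m.

Section Jet.
Variables (R : comNzRingType) (I : finType) (v w : I -> R).
Implicit Types (A B : {set I}) (j : nat).
Local Notation jet := (jet v w).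

Lemma jet0E A j : jet 0 A j = elsym A j v.
Proof.
rewrite /jet -horner_coef0 -[LHS]/(horner_eval 0 _) raddf_elsym.
apply: eq_elsym => i _ /=.
by rewrite /horner_eval /line hornerD hornerC hornerZ hornerX mulr0 addr0.
Qed.

Lemma coefM1 (p q : {poly R}) : (p * q)`_1 = p`_0 * q`_1 + p`_1 * q`_0.
Proof. by rewrite coefM !big_ord_recl big_ord0 addr0. Qed.

Lemma coefM2 (p q : {poly R}) :
  (p * q)`_2 = p`_0 * q`_2 + p`_1 * q`_1 + p`_2 * q`_0.
Proof. by rewrite coefM !big_ord_recl big_ord0 addr0 addrA. Qed.

Lemma line0 i : (line v w i)`_0 = v i.
Proof. by rewrite /line coefD coefC coefZ coefX mulr0 addr0. Qed.
Lemma line1 i : (line v w i)`_1 = w i.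
Proof. by rewrite /line coefD coefC coefZ coefX mulr1 add0r. Qed.
Lemma line2 i : (line v w i)`_2 = 0.
Proof. by rewrite /line coefD coefC coefZ coefX mulr0 addr0. Qed.
Definition lineE := (line0, line1, line2).

Lemma jet_elsym0 m A : jet m.+1 A 0 = 0.
Proof. by rewrite /jet elsym0 coef1. Qed.

Lemma jet1_rec A j i : i \in A ->
  jet 1 A j.+1 = v i * jet 1 (A :\ i) j + w i * elsym (A :\ i) j v
                 + jet 1 (A :\ i) j.+1.
Proof.
by move=> iA; rewrite /jet (elsymS _ _ iA) coefD coefM1 !lineE -!/(jet 0 _ _) jet0E.
Qed.

Lemma jet2_rec A j i : i \in A ->
  jet 2 A j.+1 = v i * jet 2 (A :\ i) j + w i * jet 1 (A :\ i) j
                 + jet 2 (A :\ i) j.+1.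
Proof.
by move=> iA; rewrite /jet (elsymS _ _ iA) coefD coefM2 !lineE mul0r addr0.
Qed.

Lemma deriv_line i : (line v w i)^`() = (w i)%:P.
Proof. by rewrite /line derivD derivC derivZ derivX add0r alg_polyC. Qed.

Lemma deriv_elsym A j : (elsym A j.+1 (line v w))^`()
  = \sum_(i in A) (w i)%:P * elsym (A :\ i) j (line v w).
Proof.
elim/set_ind: A j => A IH j.
have [->|[k kA]] := set_0Vmem A; first by rewrite big_set0 elsym_set0 linear0.
rewrite (big_setD1 k) //= (elsymS _ _ kA) derivD derivM deriv_line !IH //.
case: j => [|j].
  have d1 : (1 : {poly R})^`() = 0 by rewrite -polyC1 derivC.
  rewrite !elsym0 d1 mulr0 addr0; congr (_ + _).
  by apply: eq_bigr => i _; rewrite !elsym0.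
rewrite IH // -addrA mulr_sumr -big_split /=; congr (_ + _).
apply: eq_bigr => i; rewrite !inE => /andP[ik iA].
rewrite (@elsymS _ _ (A :\ i) k) ?inE 1?eq_sym ?ik // setD1C; ring.
Qed.

Lemma jet1E A j : jet 1 A j.+1 = \sum_(i in A) w i * elsym (A :\ i) j v.
Proof.
rewrite /jet -[LHS]mulr1n -(coef_deriv _ 0) deriv_elsym coef_sum.
by apply: eq_bigr => i _; rewrite coefCM -/(jet 0 _ _) jet0E.
Qed.

Lemma jet2E A j : jet 2 A j.+1 *+ 2 = \sum_(i in A) w i * jet 1 (A :\ i) j.
Proof.
rewrite /jet -(coef_deriv _ 1) deriv_elsym coef_sum.
by apply: eq_bigr => i _; rewrite coefCM.
Qed.

(** This lemma and the next two are coefficients of [elsym_euler] and [elsym_sumsq] read along the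
    line [v + t w]. *)
Lemma jet1_euler A j :
  \sum_(i in A) (w i * elsym (A :\ i) j v + v i * jet 1 (A :\ i) j)
  = j.+1%:R * jet 1 A j.+1.
Proof.
have := congr1 (fun p : {poly R} => p`_1) (elsym_euler A j (line v w)).
rewrite coef_sum mulr_natl coefMn [j.+1%:R * _]mulr_natl => <-; apply: eq_bigr => i _.
by rewrite coefM1 !lineE -/(jet 0 _ _) jet0E addrC.
Qed.

Lemma jet2_euler A j :
  \sum_(i in A) (w i * jet 1 (A :\ i) j + v i * jet 2 (A :\ i) j)
  = j.+1%:R * jet 2 A j.+1.
Proof.
have := congr1 (fun p : {poly R} => p`_2) (elsym_euler A j (line v w)).
rewrite coef_sum mulr_natl coefMn [j.+1%:R * _]mulr_natl => <-; apply: eq_bigr => i _.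
by rewrite coefM2 !lineE mul0r addr0 addrC.
Qed.

Lemma jet1_sumsq A j :
  \sum_(i in A) (2 * v i * w i * elsym (A :\ i) j v + v i ^+ 2 * jet 1 (A :\ i) j)
  = elsym A 1 v * jet 1 A j.+1 + jet 1 A 1 * elsym A j.+1 v
    - j.+2%:R * jet 1 A j.+2.
Proof.
have := congr1 (fun p : {poly R} => p`_1) (elsym_sumsq A j (line v w)).
rewrite coef_sum coefB coefM1 mulr_natl coefMn [j.+2%:R * _]mulr_natl.
rewrite -!/(jet _ _ _) !jet0E => <-; apply: eq_bigr => i _.
rewrite expr2 coefM1 coefM1 coefM !big_ord_recl big_ord0 !lineE /=.
rewrite -?/(jet _ _ _) ?jet0E; ring.
Qed.

End Jet.

Section Concave.
Variables (R : realFieldType) (I : finType) (v w : I -> R).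
Implicit Types (A B : {set I}) (j : nat).
Local Notation jet := (jet v w).
Local Notation E A j := (elsym A j v).

(* The 2-jet of H / G, as a function of the 2-jets of H and G. *)
Definition quo0 (G H : nat -> R) := H 0 / G 0.
Definition quo1 (G H : nat -> R) := (H 1 - quo0 G H * G 1) / G 0.
Definition quo2 (G H : nat -> R) :=
  (H 2 - quo1 G H * G 1 - quo0 G H * G 2) / G 0.

(** Half the second derivative along [w] of sigma_(j+1) / sigma_j, a quotient that is concave on the
    Garding cone. *)
Definition qjet2 A j := quo2 (jet ^~ A ^~ j) (jet ^~ A ^~ j.+1).

(* With c = a + q the function phi(a, q) = a q / (a + q) is a - a^2 / c. *)
Lemma quo2_phi (a b : R) (G H : nat -> R) :
  let K m := if m is m'.+1 then a * G m + b * G m' + H m else a * G 0 + H 0 in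
  let T m := if m is m'.+1 then a * H m + b * H m' else a * H 0 in
  0 < G 0 -> 0 < K 0 ->
  - quo2 K T = G 0 / K 0 * (b - a * (K 1 / K 0 - G 1 / G 0)) ^+ 2
               - (a * G 0 / K 0) ^+ 2 * quo2 G H.
Proof.
move=> K T; rewrite /K /T /quo2 /quo1 /quo0 /= => g0 k0.
by field; rewrite !gt_eqF.
Qed.

(** By Euler's identity, (j+2) sigma_(j+2) / sigma_(j+1) is the sum over i of phi(v_i, q_i), with
    q_i = sigma_(j+1) / sigma_j taken without the entry i. By [quo2_phi] each summand contributes an
    explicit square and a multiple of the second derivative of q_i, of known sign by induction. The
    squares are kept, since bare concavity would be too weak later. *)
Lemma qjet2_strong A j :
  (forall i, i \in A -> qjet2 (A :\ i) j <= 0) -> gard A j.+1 v ->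
  \sum_(i in A) E (A :\ i) j / E A j.+1
     * (w i - v i * (jet 1 A j.+1 / E A j.+1
                     - jet 1 (A :\ i) j / E (A :\ i) j)) ^+ 2
  <= - (j.+2%:R * qjet2 A j.+1).
Proof.
move=> IH g.
pose T i m := if m is m'.+1 then v i * jet m (A :\ i) j.+1 + w i * jet m' (A :\ i) j.+1
   else v i * jet 0 (A :\ i) j.+1.
have -> : - (j.+2%:R * qjet2 A j.+1)
    = \sum_(i in A) - quo2 (jet ^~ A ^~ j.+1) (T i).
  have T0 : j.+2%:R * jet 0 A j.+2 = \sum_(i in A) T i 0.
    by rewrite jet0E -elsym_euler; apply: eq_bigr => i _; rewrite /T jet0E.
  have T1 : j.+2%:R * jet 1 A j.+2 = \sum_(i in A) T i 1.
    by rewrite -jet1_euler; apply: eq_bigr => i _; rewrite /T /= jet0E addrC.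
  have T2 : j.+2%:R * jet 2 A j.+2 = \sum_(i in A) T i 2.
    by rewrite -jet2_euler; apply: eq_bigr => i _; rewrite /T /= addrC.
  rewrite sumrN /qjet2 /quo2 /quo1 /quo0; congr (- _).
  rewrite -mulr_suml !sumrB -!mulr_suml -T2 sumrB -!mulr_suml -T1 -T0.
  by rewrite !mulrA !mulrBr !mulrA; ring.
apply: ler_sum => i iA.
have g0 : 0 < jet 0 (A :\ i) j by rewrite jet0E; apply: (gardD1 iA g).
have k0 : 0 < jet 0 A j.+1 by rewrite jet0E; apply: g.
have K0 : jet 0 A j.+1 = v i * jet 0 (A :\ i) j + jet 0 (A :\ i) j.+1.
  by rewrite !jet0E (elsymS _ _ iA).
have K1 : jet 1 A j.+1 = v i * jet 1 (A :\ i) j + w i * jet 0 (A :\ i) j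
     + jet 1 (A :\ i) j.+1 by rewrite !jet0E (jet1_rec _ _ _ iA).
have K2 : jet 2 A j.+1 = v i * jet 2 (A :\ i) j + w i * jet 1 (A :\ i) j
     + jet 2 (A :\ i) j.+1 by rewrite (jet2_rec _ _ _ iA).
have := @quo2_phi (v i) (w i) (jet ^~ (A :\ i) ^~ j) (jet ^~ (A :\ i) ^~ j.+1).
rewrite /= -K0 => /(_ g0 k0); rewrite -K1 -!(jet0E v w).
have -> : quo2 (fun m => if m is m'.+1 then v i * jet m (A :\ i) j
      + w i * jet m' (A :\ i) j + jet m (A :\ i) j.+1 else
      jet 0 A j.+1) (fun m => if m is m'.+1 then v i * jet m (A :\ i) j.+1
      + w i * jet m' (A :\ i) j.+1 else v i * jet 0 (A :\ i) j.+1)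
   = quo2 (jet ^~ A ^~ j.+1) (T i).
  by rewrite /quo2 /quo1 /quo0 /= -K1 -K2.
move=> ->.
have := IH i iA; rewrite /qjet2 => le0.
by rewrite lerDl oppr_ge0 mulr_ge0_le0 // sqr_ge0.
Qed.

Lemma qjet2_le0 A j : gard A j v -> qjet2 A j <= 0.
Proof.
elim: j A => [|j IH] A g.
  have z : jet 2 A 1 = 0.
    have := jet2E v w A 0; rewrite big1 => [/eqP|i _].
      by rewrite mulrn_eq0 => /eqP.
    by rewrite jet_elsym0 mulr0.
  by rewrite /qjet2 /quo2 z !jet_elsym0 !mulr0 !subr0 mul0r.
have h : \sum_(i in A) E (A :\ i) j / E A j.+1
     * (w i - v i * (jet 1 A j.+1 / E A j.+1
                     - jet 1 (A :\ i) j / E (A :\ i) j)) ^+ 2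
  <= - (j.+2%:R * qjet2 A j.+1).
  by apply: qjet2_strong => // i iA; apply: IH; apply: gardD1 g.
rewrite -oppr_ge0 -(pmulr_rge0 _ (_ : 0 < j.+2%:R)) ?ltr0n // mulrN.
apply: le_trans h; apply: sumr_ge0 => i iA.
rewrite mulr_ge0 ?sqr_ge0 // divr_ge0 // ltW //; last exact: g.
exact: (gardD1 iA g).
Qed.

Lemma qjet2_sum A j : gard A j.+1 v ->
  \sum_(i in A) E (A :\ i) j
     * (w i - v i * (jet 1 A j.+1 / E A j.+1
                     - jet 1 (A :\ i) j / E (A :\ i) j)) ^+ 2
  <= - (j.+2%:R * E A j.+1 * qjet2 A j.+1).
Proof.
move=> g; have e0 : 0 < E A j.+1 by apply: g.
have h := @qjet2_strong A j
  (fun i iA => qjet2_le0 (gardD1 iA g)) g.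
rewrite -(ler_pM2l e0) in h; apply: le_trans (_ : _ <= _) _; last first.
  by apply: le_trans h _; rewrite mulrN mulrCA mulrA.
rewrite mulr_sumr; apply: ler_sum => i iA.
by rewrite !mulrA [_ * E (A :\ i) j]mulrC -!mulrA mulVKf ?gt_eqF // mulrA.
Qed.

Lemma qjet2_lin A j : gard A j.+1 v ->
  \sum_(i in A) E (A :\ i) j * v i
     * (w i - v i * (jet 1 A j.+1 / E A j.+1
                     - jet 1 (A :\ i) j / E (A :\ i) j))
  = j.+2%:R * (E A j.+2 / E A j.+1) * jet 1 A j.+1 - j.+1%:R * jet 1 A j.+2.
Proof.
move=> g; have e0 : 0 < E A j.+1 by apply: g.
pose Y := \sum_(i in A) v i * w i * E (A :\ i) j.
have s1 := jet1_sumsq v w A j; rewrite big_split /= in s1.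
have s2 := elsym_sumsq A j v.
have s3 : jet 1 A j.+2 = jet 1 A 1 * E A j.+1 - Y.
  rewrite !jet1E mulr_suml /Y -sumrB; apply: eq_bigr => i iA.
  by rewrite elsym0 (elsymS _ _ iA); ring.
have -> : \sum_(i in A) E (A :\ i) j * v i
     * (w i - v i * (jet 1 A j.+1 / E A j.+1
                     - jet 1 (A :\ i) j / E (A :\ i) j))
  = Y - (\sum_(i in A) v i ^+ 2 * E (A :\ i) j) * (jet 1 A j.+1 / E A j.+1)
    + \sum_(i in A) v i ^+ 2 * jet 1 (A :\ i) j.
  rewrite mulr_suml -sumrB -big_split; apply: eq_bigr => i iA /=.
  have d0 : 0 < E (A :\ i) j by apply: (gardD1 iA g).
  by field; rewrite !gt_eqF.
have {}s1 : \sum_(i in A) v i ^+ 2 * jet 1 (A :\ i) j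
   = E A 1 * jet 1 A j.+1 + jet 1 A 1 * E A j.+1 - j.+2%:R * jet 1 A j.+2 - 2 * Y.
  rewrite -s1 /Y mulr_sumr [X in X - _]addrC -addrA -sumrB.
  by rewrite [X in _ = _ + X]big1 ?addr0 // => i _; ring.
rewrite s1 s2 -[j.+2%:R]natr1 s3; field; rewrite gt_eqF //.
Qed.

(* Concavity of sigma_(j+1) ^ (1/(j+1)) on the Garding cone. *)
Lemma elsym_jet2_le A j : gard A j.+1 v ->
  2 * j.+1%:R * E A j.+1 * jet 2 A j.+1 <= j%:R * jet 1 A j.+1 ^+ 2.
Proof.
elim: j => [|j IH] g.
  have z : jet 2 A 1 = 0.
    have := jet2E v w A 0; rewrite big1 => [/eqP|i _].
      by rewrite mulrn_eq0 => /eqP.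
    by rewrite jet_elsym0 mulr0.
  by rewrite z mul0r mulr0.
have e0 : 0 < E A j.+1 by apply: g.
have h0 : 0 < E A j.+2 by apply: g.
have {}IH := IH (gardS g).
have := qjet2_le0 (gardS g); rewrite /qjet2 /quo2 /quo1 /quo0 !jet0E.
set a := E A j.+1 in e0 IH *; set b := E A j.+2 in h0 *.
set a1 := jet 1 A j.+1 in IH *; set b1 := jet 1 A j.+2.
set a2 := jet 2 A j.+1 in IH *; set b2 := jet 2 A j.+2 => q2.
have {}q2 : b2 * a ^+ 2 <= (b1 * a - b * a1) * a1 + b * a * a2.
  rewrite -subr_le0; have <- : ((b2 - (b1 - b / a * a1) / a * a1 - b / a * a2) / a)
     * a ^+ 3 = b2 * a ^+ 2 - ((b1 * a - b * a1) * a1 + b * a * a2).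
    by field; rewrite gt_eqF.
  by rewrite pmulr_lle0 // exprn_gt0.
have j0 : 0 < j.+1%:R :> R by rewrite ltr0n.
rewrite -[j.+2%:R]natr1; set n := j.+1%:R in IH j0 *.
have nj : j%:R = n - 1 by rewrite /n -natr1 addrK.
rewrite nj in IH.
have a20 : 0 < a ^+ 2 by rewrite exprn_gt0.
rewrite -(ler_pM2l a20) -(ler_pM2l j0).
apply: le_trans (_ : _ <= n * (2 * (n + 1) * b
   * ((b1 * a - b * a1) * a1 + b * a * a2))) _.
  rewrite ler_pM2l // mulrCA ler_pM2l; last by rewrite !mulr_gt0 ?ltr_wpDl // ltW.
  by rewrite mulrC.
have t : 2 * n * a * a2 * ((n + 1) * b ^+ 2) <= (n - 1) * a1 ^+ 2 * ((n + 1) * b ^+ 2).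
  by rewrite ler_wpM2r // mulr_ge0 ?sqr_ge0 // ltW // ltr_wpDl // ltW.
(* After the bounds [q2] for [b2] and [t] for [a2] are inserted, the difference of the two sides is
   exactly this square. *)
have := sqr_ge0 (n * b1 * a - (n + 1) * b * a1); nra.
Qed.

End Concave.

(** * Estimates for small entries *)

Section Small.
Variables (R : realFieldType) (I : finType).
Implicit Types (A S : {set I}) (v w : I -> R) (j : nat).

Lemma elsym1_le A v (eta : R) (N : nat) : (#|A| <= N)%N ->
  (forall i, i \in A -> `|v i| <= eta) -> 0 <= eta ->
  `|elsym A 1 v| <= N%:R * eta.
Proof.
move=> AN vb eta0; rewrite elsym1; apply: le_trans (ler_norm_sum _ _ _) _.
apply: le_trans (_ : \sum_(i in A) eta <= _); first exact: ler_sum.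
by rewrite sumr_const -[_ *+ #|_|]mulr_natl ler_wpM2r // ler_nat.
Qed.

(** The nonnegative left side of [elsym_sumsq] gives (j+2) sigma_(j+2) <= sigma_1 sigma_(j+1). This
    is a bound from above only; the bound from below for [a 1] uses the positivity of F, see
    [a1le]. *)
Lemma elsymS_le A j v (eta : R) (N : nat) : (#|A| <= N)%N ->
  (forall i, i \in A -> `|v i| <= eta) -> 0 <= eta -> gard A j v ->
  elsym A j.+1 v <= N%:R * eta * elsym A j v.
Proof.
move=> AN vb eta0; have e1 := elsym1_le AN vb eta0; case: j => [|j] g.
  by rewrite elsym0 mulr1; apply: le_trans (ler_norm _) e1.
have ej : 0 < elsym A j.+1 v by apply: g.
have s : 0 <= \sum_(i in A) v i ^+ 2 * elsym (A :\ i) j v.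
  apply: sumr_ge0 => i iA; rewrite mulr_ge0 ?sqr_ge0 // ltW //.
  exact: (gardD1 iA g).
have [le0|gt0] := leP (elsym A j.+2 v) 0.
  by apply: le_trans le0 _; rewrite !mulr_ge0 // ltW.
have h : elsym A 1 v * elsym A j.+1 v <= N%:R * eta * elsym A j.+1 v.
  by rewrite ler_wpM2r ?(ltW ej) // (le_trans (ler_norm _) e1).
rewrite elsym_sumsq -natr1 in s; have := ler0n R j.+1; nra.
Qed.

Lemma addn_4n2 (n : nat) : (n + (n + (2 * n + 1)) + 1 = 4 * n + 2)%N.
Proof. by lia. Qed.

Lemma four_n_add_2_ge2 (n : nat) : 2 <= (4 * n + 2)%:R :> R.
Proof. by rewrite ler_nat; lia. Qed.

Section Fix.
Variables (S : {set I}) (v w : I -> R) (r N : nat) (eta : R).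
Hypotheses (SN : (#|S| <= N)%N) (g : gard S r.+1 v).
Hypotheses (eta0 : 0 <= eta) (eta1 : eta <= 1 / 2).
Hypothesis vb : forall i, i \in S -> `|v i| <= eta.
Local Notation a p := (elsym S (r + p).+1 v).
Local Notation d i := (elsym (S :\ i) r v).
Local Notation b p i := (elsym (S :\ i) (r + p).+1 v).

(** The cone gives positivity on S only up to degree [r.+1]. For [p > 0] the number [a p] may have
    any sign, so its size has to be found from identities. *)
Lemma a0_gt0 : 0 < a 0. Proof. by rewrite addn0; apply: g. Qed.

Lemma d_gt0 i : i \in S -> 0 < d i.
Proof. by move=> iS; apply: (gardD1 iS g). Qed.

Lemma cardD1_le i : (#|S :\ i| <= N)%N.
Proof. by apply: leq_trans SN; rewrite subset_leq_card // subsetDl. Qed.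

Lemma r_ltN : (r < N)%N.
Proof.
rewrite ltnNge; apply/negP => Nr; have := a0_gt0.
by rewrite elsym_gt ?ltxx // addn0 ltnS (leq_trans SN).
Qed.

Lemma b_rec p i : i \in S -> b p.+1 i = a p.+1 - v i * b p i.
Proof. by move=> iS; rewrite (elsymS _ v iS) addrC addnS addKr. Qed.

Lemma b0E i : i \in S -> b 0 i = a 0 - v i * d i.
Proof. by move=> iS; rewrite addn0 (elsymS _ v iS) addrC addKr. Qed.

(** The derivative [d i] exceeds [a 0] by a factor of order [1 / eta], so errors proportional to
    [a 0] are small when compared with it. *)
Lemma a0_le i : i \in S -> a 0 <= N.+1%:R * eta * d i.
Proof.
move=> iS; rewrite addn0 (elsymS _ v iS) -natr1 mulrDl mul1r mulrDl.
have d0 := d_gt0 iS; rewrite addrC lerD //.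
  apply: elsymS_le => //; first exact: cardD1_le.
    by move=> k; rewrite inE => /andP[_]; apply: vb.
  exact: (gardD1 iS g).
by rewrite ler_wpM2r ?(ltW d0) // (le_trans (ler_norm _)) // vb.
Qed.

(** By [QsE] this nonnegative number is [- r.+2%:R * a 1] up to a term of order [eta * a 0]; this is
    what makes [- a 1 / a 0] almost nonnegative. *)
Definition Qs := \sum_(i in S) v i ^+ 2 * d i.

Lemma QsE : Qs = elsym S 1 v * a 0 - r.+2%:R * a 1.
Proof. by rewrite /Qs elsym_sumsq addn0 addn1. Qed.

Lemma Qs_ge0 : 0 <= Qs.
Proof.
by apply: sumr_ge0 => i iS; rewrite mulr_ge0 ?sqr_ge0 // ltW // d_gt0.
Qed.

Section Bound.
Variable A0 : R.
Hypotheses (A00 : a 0 <= A0) (A01 : `|a 1| <= A0).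
Let M : R := (4 * N + 2)%:R.

Lemma A0_ge0 : 0 <= A0. Proof. exact: le_trans (normr_ge0 _) A01. Qed.

Lemma Qs_le : Qs <= (2 * N + 1)%:R * A0.
Proof.
rewrite QsE; have e0 := a0_gt0; have E1 := elsym1_le SN vb eta0.
have r2 : r.+2%:R <= (N + 1)%:R :> R by rewrite ler_nat addn1 ltnS r_ltN.
apply: le_trans (_ : N%:R * A0 + (N + 1)%:R * A0 <= _); last first.
  by rewrite -mulrDl -natrD addnA addnn mul2n.
have A0p := A0_ge0; have N0 : 0 <= N%:R :> R by [].
have h1 : elsym S 1 v * a 0 <= N%:R * A0.
  apply: le_trans (ler_norm _) _; rewrite normrM ler_pM // ?(gtr0_norm e0) //.
  by apply: le_trans E1 _; rewrite ler_piMr //; move: eta1; lra.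
have h2 : - (r.+2%:R * a 1) <= (N + 1)%:R * A0.
  apply: le_trans (ler_norm _) _; rewrite normrN normrM ler_pM //.
  by rewrite ger0_norm.
by rewrite lerD.
Qed.

(** [elsym_sumsq] expresses [a p.+2] through sigma_1 times [a p.+1] and through the sum of
    [v i ^+ 2 * b p i]; the part [|v i| * d i] of the bound for [b p i] then sums to at most
    [eta * Qs]. The scale [A0] dominates both [a 0] and [|a 1|], because their comparison [a1le] is
    itself derived from [a_bound]. *)
Lemma a_step p :
  (forall i, i \in S -> `|b p i| <= M ^+ p.+1 * (A0 + `|v i| * d i)) ->
  `|a p.+1| <= M ^+ p.+1 * A0 -> `|a p.+2| <= eta * (M ^+ p.+2 * A0).
Proof.
move=> IHb IHa; have A0p := A0_ge0; have M2 := four_n_add_2_ge2 N; have e0 := a0_gt0.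
have Mp : 0 < M ^+ p.+1 by rewrite exprn_gt0 //; move: M2; lra.
have h1 : (r + p).+3%:R * a p.+2
   = elsym S 1 v * a p.+1 - \sum_(i in S) v i ^+ 2 * b p i.
  by rewrite elsym_sumsq !addnS; ring.
have h2 : `|a p.+2| <= `|(r + p).+3%:R * a p.+2|.
  by rewrite normrM ler_peMl // normr_nat ler1n.
apply: le_trans h2 _; rewrite h1; apply: le_trans (ler_normB _ _) _.
have h3 : `|elsym S 1 v * a p.+1| <= N%:R * eta * (M ^+ p.+1 * A0).
  by rewrite normrM ler_pM //; apply: (elsym1_le SN vb eta0).
have h4 : `|\sum_(i in S) v i ^+ 2 * b p i|
    <= eta * (M ^+ p.+1 * (N%:R * A0 + Qs)).
  apply: le_trans (ler_norm_sum _ _ _) _.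
  apply: le_trans (_ : \sum_(i in S) eta * (M ^+ p.+1 * (A0 + v i ^+ 2 * d i)) <= _).
    apply: ler_sum => i iS; rewrite normrM normrX.
    have v1 : `|v i| <= 1 by apply: le_trans (vb iS) _; move: eta1; lra.
    apply: le_trans (_ : `|v i| ^+ 2 * (M ^+ p.+1 * (A0 + `|v i| * d i)) <= _).
      by rewrite ler_wpM2l ?sqr_ge0 // IHb.
    rewrite mulrCA [leRHS]mulrCA ler_pM2l // !mulrDr lerD //.
      rewrite ler_wpM2r // expr2; apply: le_trans (vb iS).
      by rewrite ler_piMl.
    rewrite -[v i ^+ 2]real_normK ?num_real // mulrCA ler_wpM2r //.
      by rewrite mulr_ge0 ?sqr_ge0 // ltW // d_gt0.
    exact: vb.
  rewrite -mulr_sumr -mulr_sumr big_split /= ler_wpM2l // ler_pM2l // lerD2r.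
  by rewrite sumr_const -[_ *+ #|_|]mulr_natl ler_wpM2r // ler_nat.
have h5 := Qs_le.
(* The growth factor collects [N] from sigma_1, [N] from the terms [A0] summed over S, [2 * N + 1]
   from [Qs_le], and 1 to spare. *)
have h6 : M = N%:R + (N%:R + (2 * N + 1)%:R) + 1.
  have -> : M = (N + (N + (2 * N + 1)) + 1)%:R.
    by rewrite /M -addn_4n2.
  by rewrite natrD [(N + (N + _))%:R]natrD [(N + (2 * N + 1))%:R]natrD.
rewrite [M ^+ p.+2]exprS.
have h7 : eta * (M ^+ p.+1 * Qs) <= eta * (M ^+ p.+1 * ((2 * N + 1)%:R * A0)).
  by rewrite ler_wpM2l // ler_pM2l.
have h8 : 0 <= eta * (M ^+ p.+1 * A0) by rewrite !mulr_ge0 // ltW.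
move: h3 h4 h7 h8; set X := M ^+ p.+1 => h3 h4 h7 h8.
apply: le_trans (lerD h3 h4) _; rewrite h6; lra.
Qed.

Lemma ab_bound p :
  (forall i, i \in S -> `|b p i| <= M ^+ p.+1 * (A0 + `|v i| * d i))
  /\ `|a p.+1| <= M ^+ p.+1 * A0.
Proof.
have A0p := A0_ge0; have M2 := four_n_add_2_ge2 N; have e0 := a0_gt0.
elim: p => [|p [IHb IHa]].
  split=> [i iS|]; last first.
    by apply: le_trans A01 _; rewrite expr1 ler_peMl //; move: M2; lra.
  have d0 := d_gt0 iS.
  have le1 : `|b 0 i| <= A0 + `|v i| * d i.
    rewrite b0E //; apply: le_trans (ler_normB _ _) _.
    by rewrite normrM (gtr0_norm e0) (gtr0_norm d0) lerD2r.
  apply: le_trans le1 _; rewrite expr1 ler_peMl //; last by move: M2; lra.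
  by rewrite addr_ge0 // mulr_ge0 // ltW.
have Mp : 0 < M ^+ p.+1 by rewrite exprn_gt0 //; move: M2; lra.
split=> [i iS|].
  have d0 := d_gt0 iS; have vd0 : 0 <= `|v i| * d i by rewrite mulr_ge0 // ltW.
  rewrite b_rec //; apply: le_trans (ler_normB _ _) _.
  have h : `|v i * b p i| <= M ^+ p.+1 * (A0 + `|v i| * d i).
    rewrite normrM; apply: le_trans (IHb i iS).
    by rewrite ler_piMl //; apply: le_trans (vb iS) _; move: eta1; lra.
  have h' : M ^+ p.+1 * A0 <= M ^+ p.+1 * (A0 + `|v i| * d i).
    by rewrite ler_pM2l // lerDl.
  rewrite [M ^+ p.+2]exprS -mulrA.
  apply: le_trans (_ : 2 * (M ^+ p.+1 * (A0 + `|v i| * d i)) <= _); first lra.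
  by rewrite ler_wpM2r // mulr_ge0 // ?(ltW Mp) // addr_ge0.
apply: le_trans (a_step IHb IHa) _.
have M0 : 0 <= M by move: M2; lra.
apply: ler_piMl; last by move: eta1; lra.
by apply: mulr_ge0 => //; apply: exprn_ge0.
Qed.

Lemma a_bound p : `|a p.+2| <= eta * (M ^+ p.+2 * A0).
Proof. by have [IHb IHa] := ab_bound p; apply: a_step. Qed.

End Bound.

Section JetBound.
Variables u dq : R.
Hypotheses (u0 : 0 <= u) (etaE : eta = u ^+ 2) (dq0 : 0 <= dq).
Hypothesis dqE : \sum_(i in S) d i * w i ^+ 2 = a 0 * dq ^+ 2.
Hypothesis a1le : `|a 1| <= 3 * a 0.
Let M : R := (4 * N + 2)%:R.
Variable K : R.
Hypothesis MleK : forall p, (p <= N + 5)%N -> 3 * M ^+ p <= K.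
Local Notation jet := (jet v w).
Definition Ys := \sum_(i in S) d i * v i * w i.

Lemma a0_le3 : a 0 <= 3 * a 0. Proof. have := a0_gt0; lra. Qed.

Lemma K_ge1 : 1 <= K.
Proof. by have := MleK (leq0n _); rewrite expr0; lra. Qed.

Lemma K_ge0 : 0 <= K. Proof. exact: le_trans ler01 K_ge1. Qed.

Lemma a_est p : (p <= N + 2)%N -> `|a p.+2| <= K * eta * a 0.
Proof.
move=> pN; apply: le_trans (a_bound a0_le3 a1le p) _.
have /MleK : (p.+2 <= N + 5)%N by clear -pN; lia.
have e0 := a0_gt0; rewrite -/M; set X := M ^+ p.+2 => h.
have := ler_wpM2r (ltW e0) (ler_wpM2l eta0 h); lra.
Qed.

Lemma b_est p i : (p <= N + 2)%N -> i \in S -> `|b p i| <= K * eta * d i.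
Proof.
move=> pN iS; have d0 := d_gt0 iS; have e0 := a0_gt0.
have [/(_ i iS) h _] := ab_bound a0_le3 a1le p; apply: le_trans h _.
have /MleK : (p.+2 <= N + 5)%N by clear -pN; lia.
rewrite -/M => h.
have M2 : 2 <= M := four_n_add_2_ge2 N.
have Mp : 0 < M ^+ p.+1 by rewrite exprn_gt0 //; move: M2; lra.
apply: le_trans (_ : M ^+ p.+1 * (3 * M * (eta * d i)) <= _); last first.
  rewrite exprS in h; move: h; set X := M ^+ p.+1 => h.
  have := ler_wpM2r (ltW d0) (ler_wpM2l eta0 h); lra.
rewrite ler_pM2l //; have := a0_le iS; have := vb iS.
have ed : 0 <= eta * d i by rewrite mulr_ge0 // ltW.
have : N.+1%:R * (eta * d i) <= (M - 1) * (eta * d i).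
  rewrite ler_wpM2r // lerBrDr natr1 ler_nat.
  by have := r_ltN; clear; lia.
have M3 : 6 <= M by rewrite ler_nat; have := r_ltN; clear; lia.
move=> h1 h2; rewrite -mulrA => h3.
have : `|v i| * d i <= eta * d i by rewrite ler_wpM2r // ltW.
lra.
Qed.

(** From [d i * w i ^+ 2 <= a 0 * dq ^+ 2] and [a0_le]. The square root of [eta] enters the
    estimates here. *)
Lemma w_est i : i \in S -> `|w i| <= N.+1%:R * u * dq.
Proof.
move=> iS; have d0 := d_gt0 iS; have e0 := a0_gt0; have ed := a0_le iS.
have r0 : 0 <= N.+1%:R * u * dq by rewrite !mulr_ge0.
rewrite -(ler_pXn2r (ltn0Sn 1)) ?nnegrE // real_normK ?num_real //.
have dw : d i * w i ^+ 2 <= a 0 * dq ^+ 2.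
  rewrite -dqE (bigD1 i) //= lerDl; apply: sumr_ge0 => k /andP[kS _].
  by rewrite mulr_ge0 ?sqr_ge0 // ltW // d_gt0.
have h : a 0 * w i ^+ 2 <= N.+1%:R * eta * (a 0 * dq ^+ 2).
  apply: le_trans (_ : N.+1%:R * eta * (d i * w i ^+ 2) <= _).
    by rewrite [leRHS]mulrA ler_wpM2r ?sqr_ge0.
  by rewrite ler_wpM2l // mulr_ge0.
have {h} : w i ^+ 2 <= N.+1%:R * eta * dq ^+ 2.
  by rewrite -(ler_pM2l e0) [leRHS]mulrCA.
move/le_trans; apply; rewrite etaE.
have -> : (N.+1%:R * u * dq) ^+ 2 = N.+1%:R * (N.+1%:R * u ^+ 2 * dq ^+ 2) by ring.
by rewrite ler_peMl ?ler1n // !mulr_ge0 ?sqr_ge0.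
Qed.

Lemma Qs_le3 : Qs <= (2 * N + 1)%:R * (3 * a 0).
Proof. exact: Qs_le a0_le3 a1le. Qed.

(** Although [d i] is not bounded by [a 0], the square of the left side is the product of
    [v i ^+ 2 * d i], bounded through [Qs], and [d i * w i ^+ 2], bounded through [dq]. *)
Lemma dvw_est i : i \in S -> `|v i| * d i * `|w i| <= (6 * N + 3)%:R * (a 0 * dq).
Proof.
move=> iS; have d0 := d_gt0 iS; have e0 := a0_gt0.
have r0 : 0 <= (6 * N + 3)%:R * (a 0 * dq) by rewrite !mulr_ge0 // ltW.
rewrite -(ler_pXn2r (ltn0Sn 1)) ?nnegrE ?mulr_ge0 ?(ltW d0) ?(ltW e0) //.
have dw : d i * w i ^+ 2 <= a 0 * dq ^+ 2.
  rewrite -dqE (bigD1 i) //= lerDl; apply: sumr_ge0 => k /andP[kS _].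
  by rewrite mulr_ge0 ?sqr_ge0 // ltW // d_gt0.
have dv : v i ^+ 2 * d i <= (2 * N + 1)%:R * (3 * a 0).
  apply: le_trans Qs_le3; rewrite /Qs (bigD1 i) //= lerDl.
  apply: sumr_ge0 => k /andP[kS _].
  by rewrite mulr_ge0 ?sqr_ge0 // ltW // d_gt0.
rewrite !exprMn !real_normK ?num_real //.
have -> : v i ^+ 2 * d i ^+ 2 * w i ^+ 2 = (v i ^+ 2 * d i) * (d i * w i ^+ 2) by ring.
apply: le_trans (_ : ((2 * N + 1)%:R * (3 * a 0)) * (a 0 * dq ^+ 2) <= _).
  by apply: ler_pM => //; apply: mulr_ge0; rewrite ?sqr_ge0 // ltW.
have -> : (2 * N + 1)%:R * (3 * a 0) * (a 0 * dq ^+ 2)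
   = (6 * N + 3)%:R * (a 0 ^+ 2 * dq ^+ 2).
  have -> : (6 * N + 3 = (2 * N + 1) * 3)%N by clear; lia.
  rewrite natrM; ring.
apply: ler_wpM2r; first by apply: mulr_ge0; apply: sqr_ge0.
by rewrite expr2 ler_peMl // ler1n addn3.
Qed.

Lemma u_le1 : u <= 1.
Proof.
rewrite -(ler_pXn2r (ltn0Sn 1)) ?nnegrE // -etaE expr1n.
by move: eta1; lra.
Qed.

Lemma sum_const_le (F : I -> R) (c : R) : 0 <= c ->
  (forall i, i \in S -> `|F i| <= c) -> `|\sum_(i in S) F i| <= N%:R * c.
Proof.
move=> c0 Fc; apply: le_trans (ler_norm_sum _ _ _) _.
apply: le_trans (_ : \sum_(i in S) c <= _); first exact: ler_sum.
by rewrite sumr_const -[_ *+ #|_|]mulr_natl ler_wpM2r // ler_nat.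
Qed.

Lemma jet1_est p : (p <= N + 2)%N ->
  `|jet 1 S (r + p).+3| <= N%:R * (K * ((12 * N + 9)%:R * (u * (a 0 * dq)))).
Proof.
move=> pN; have e0 := a0_gt0; have u1 := u_le1; rewrite jet1E.
have M2 : 2 <= M := four_n_add_2_ge2 N.
have Mp : 0 < M ^+ p.+1 by rewrite exprn_gt0 //; move: M2; lra.
apply: sum_const_le => [|i iS].
  by apply: (mulr_ge0 K_ge0); rewrite !mulr_ge0 // ltW.
have d0 := d_gt0 iS.
have [/(_ i iS) hb ha] := ab_bound a0_le3 a1le p.
have vd0 : 0 <= `|v i| * d i by rewrite mulr_ge0 // ltW.
have h : `|b p.+1 i| <= M ^+ p.+1 * (6 * a 0 + eta * (`|v i| * d i)).
  rewrite b_rec //; apply: le_trans (ler_normB _ _) _.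
  have h1 : `|v i * b p i| <= eta * (M ^+ p.+1 * (3 * a 0 + `|v i| * d i)).
    by rewrite normrM ler_pM // vb.
  have h2 : eta * (M ^+ p.+1 * a 0) <= M ^+ p.+1 * a 0.
    by apply: ler_piMl; [rewrite mulr_ge0 // ltW | move: eta1; lra].
  rewrite -/M in ha; lra.
have -> : elsym (S :\ i) (r + p).+2 v = b p.+1 i by rewrite addnS.
rewrite normrM; apply: le_trans (_ : `|w i| * (M ^+ p.+1 * (6 * a 0 + eta * (`|v i| * d i))) <= _).
  by rewrite ler_wpM2l.
have -> : `|w i| * (M ^+ p.+1 * (6 * a 0 + eta * (`|v i| * d i)))
  = M ^+ p.+1 * (6 * a 0 * `|w i| + eta * (`|v i| * d i * `|w i|)) by ring.
apply: ler_pM; rewrite ?(ltW Mp) //.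
- by rewrite addr_ge0 // !mulr_ge0 // ltW.
- have /MleK : (p.+1 <= N + 5)%N by clear -pN; lia.
  by move: Mp; lra.
- have h1 := w_est iS; have h2 := dvw_est iS.
  have h3 : 6 * a 0 * `|w i| <= 6 * a 0 * (N.+1%:R * u * dq).
    by rewrite ler_wpM2l // mulr_ge0 // ltW.
  have h4 : eta * (`|v i| * d i * `|w i|) <= u * ((6 * N + 3)%:R * (a 0 * dq)).
    apply: ler_pM => //; first by rewrite mulr_ge0.
    by rewrite etaE expr2 ler_piMl.
  apply: le_trans (lerD h3 h4) _.
  have -> : (12 * N + 9 = 6 * N.+1 + (6 * N + 3))%N by clear; lia.
  rewrite natrD natrM; lra.
Qed.

(** Without the entry i, sigma_(r+1) equals [a 0 - v i * d i]; the parts [a 0] are negligible by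
    [w_est], and the others add up to [- Ys]. *)
Lemma jet1_1_est : `|jet 1 S r.+2 + Ys| <= N%:R * N.+1%:R * u * (a 0 * dq).
Proof.
have e0 := a0_gt0; rewrite jet1E /Ys -big_split -!mulrA /=.
apply: sum_const_le => [|i iS]; first by rewrite !mulr_ge0 // ltW.
have -> : elsym (S :\ i) r.+1 v = b 0 i by rewrite addn0.
rewrite b0E // (_ : w i * _ + _ = w i * a 0); last by ring.
rewrite normrM (gtr0_norm e0) mulrC; have := w_est iS => h.
have := ler_wpM2l (ltW e0) h; lra.
Qed.

(** Cauchy's inequality between [Ys] and [Qs], with a free parameter so that one never divides by
    [Qs], which may vanish. *)
Lemma Ys_sq (t : R) : 2 * t * Ys - t ^+ 2 * Qs <= a 0 * dq ^+ 2.
Proof.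
rewrite -dqE -subr_ge0 /Ys /Qs !mulr_sumr -!sumrB; apply: sumr_ge0 => i iS.
have -> : d i * w i ^+ 2 - (2 * t * (d i * v i * w i) - t ^+ 2 * (v i ^+ 2 * d i))
  = d i * (w i - t * v i) ^+ 2 by ring.
by rewrite mulr_ge0 ?sqr_ge0 // ltW // d_gt0.
Qed.

(** Let p, q1, q2 be sigma_(r-1), sigma_r, sigma_(r+1) without the entries i and k. Then [d i * d k]
    equals p times [a 0], plus q1^2 - p q2, and Newton's inequality bounds p q2 by q1^2 r/(r+1).
    Mixed second derivatives are thus controlled by the diagonal weights. *)
Lemma entry0 i k : i \in S -> k \in S :\ i ->
  elsym (S :\ i :\ k) r v ^+ 2 <= r.+1%:R * (d i * d k).
Proof.
move=> iS kS'; have := kS'; rewrite !inE => /andP[ki kS].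
have iS' : i \in S :\ k by rewrite !inE eq_sym ki.
have e0 : 0 < elsym S r.+1 v by apply: g.
case: (r) g e0 => [|m] gm e0; first by rewrite !elsym0 !mulr1 expr1n.
rewrite (elsymS _ v kS') (elsymS _ v iS') (setD1C S k i).
rewrite (elsymS _ v iS) !(elsymS _ v kS') in e0.
have p0 : 0 < elsym (S :\ i :\ k) m v.
  exact: (gardD1 kS' (gardD1 iS gm)).
have nw := newton (S :\ i :\ k) m v.
set p := elsym _ m v in e0 p0 nw *; set q1 := elsym _ m.+1 v in e0 nw *.
set q2 := elsym _ m.+2 v in e0 nw.
have {}e0 := ltW (mulr_gt0 p0 e0).
have := ler_wpM2l (ler0n R m.+2) e0; rewrite mulr0 -[m.+2%:R]natr1.
rewrite -[m.+2%:R]natr1 in nw; set n := m.+1%:R in nw *; lra.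
Qed.

Lemma entryS p i k : (p <= N + 2)%N -> i \in S -> k \in S :\ i ->
  elsym (S :\ i :\ k) (r + p) v ^+ 2 <= (K ^+ 2 + N%:R) * (d i * d k) /\
  elsym (S :\ i :\ k) (r + p).+1 v ^+ 2
    <= 4 * (K ^+ 2 + N%:R) * eta ^+ 2 * (d i * d k).
Proof.
move=> pN iS kS'; have := kS'; rewrite !inE => /andP[ki kS].
have iS' : i \in S :\ k by rewrite !inE eq_sym ki.
have d0 := d_gt0 iS; have d'0 := d_gt0 kS.
have dd0 : 0 <= d i * d k by rewrite mulr_ge0 // ltW.
have bmin q : (q <= N + 2)%N ->
    exists2 x, x ^+ 2 <= K ^+ 2 * eta ^+ 2 * (d i * d k)
      & exists2 y, elsym (S :\ i :\ k) (r + q).+1 v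
               = x - y * elsym (S :\ i :\ k) (r + q) v & y ^+ 2 <= eta ^+ 2.
  move=> qN; have sq (y : R) : `|y| <= eta -> y ^+ 2 <= eta ^+ 2.
    by move=> h; rewrite -real_normK ?num_real // ler_pXn2r ?nnegrE.
  have Ke : 0 <= K * eta by apply: mulr_ge0 => //; exact: K_ge0.
  (* The index with the smaller [d] is deleted first, so that the square of the bound [b_est] stays
     below a multiple of [d i * d k]. *)
  have [dle|/ltW dle] := leP (d i) (d k).
    exists (b q i); last first.
      exists (v k); last exact/sq/vb.
      by rewrite (elsymS _ v kS'); ring.
    rewrite -real_normK ?num_real //.
    apply: le_trans (_ : (K * eta * d i) ^+ 2 <= _).
      by rewrite ler_pXn2r ?nnegrE ?(mulr_ge0 Ke (ltW d0)) ?b_est.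
    rewrite !exprMn; apply: ler_wpM2l; first by apply: mulr_ge0; apply: sqr_ge0.
    by rewrite expr2 ler_pM2l.
  exists (b q k); last first.
    exists (v i); last exact/sq/vb.
    by rewrite (setD1C S i k) (elsymS _ v iS'); ring.
  rewrite -real_normK ?num_real //.
  apply: le_trans (_ : (K * eta * d k) ^+ 2 <= _).
    by rewrite ler_pXn2r ?nnegrE ?(mulr_ge0 Ke (ltW d'0)) ?b_est.
  rewrite !exprMn; apply: ler_wpM2l; first by apply: mulr_ge0; apply: sqr_ge0.
  by rewrite expr2 ler_pM2r.
have step q : (q <= N + 2)%N ->
   elsym (S :\ i :\ k) (r + q) v ^+ 2 <= (K ^+ 2 + N%:R) * (d i * d k) ->
   elsym (S :\ i :\ k) (r + q).+1 v ^+ 2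
    <= 4 * (K ^+ 2 + N%:R) * eta ^+ 2 * (d i * d k).
  move=> qN h; have [x hx [y -> hy]] := bmin q qN.
  have Nd : 0 <= N%:R * (d i * d k) * eta ^+ 2.
    by apply: mulr_ge0 (sqr_ge0 _); apply: mulr_ge0.
  have Kd : 0 <= K ^+ 2 * (d i * d k) * eta ^+ 2.
    by apply: mulr_ge0 (sqr_ge0 _); apply: mulr_ge0 => //; apply: sqr_ge0.
  set z := elsym _ _ _ in h *.
  have hz : y ^+ 2 * z ^+ 2 <= eta ^+ 2 * ((K ^+ 2 + N%:R) * (d i * d k)).
    by apply: ler_pM => //; apply: sqr_ge0.
  have := sqr_ge0 (x + y * z); lra.
suff h : elsym (S :\ i :\ k) (r + p) v ^+ 2 <= (K ^+ 2 + N%:R) * (d i * d k).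
  by split=> //; apply: step.
elim: p pN => [|p IH] pN.
  rewrite addn0; apply: le_trans (entry0 iS kS') _; rewrite ler_wpM2r //.
  have : r.+1%:R <= N%:R :> R by rewrite ler_nat r_ltN.
  have := sqr_ge0 K; lra.
rewrite addnS; apply: le_trans (step p (ltnW pN) (IH (ltnW pN))) _.
rewrite ler_wpM2r // mulrAC ler_piMl //; first by rewrite addr_ge0 ?sqr_ge0.
have : eta ^+ 2 <= (1 / 2) ^+ 2 by rewrite ler_pXn2r ?nnegrE //; lra.
rewrite !expr2; lra.
Qed.

Lemma dw_le i : i \in S -> d i * w i ^+ 2 <= a 0 * dq ^+ 2.
Proof.
move=> iS; rewrite -dqE (bigD1 i) //= lerDl; apply: sumr_ge0 => k /andP[kS _].
by rewrite mulr_ge0 ?sqr_ge0 // ltW // d_gt0.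
Qed.

Lemma jet2_bound p (G : R) : 0 <= G ->
  (forall i k, i \in S -> k \in S :\ i ->
    elsym (S :\ i :\ k) (r + p) v ^+ 2 <= G ^+ 2 * (d i * d k)) ->
  `|2 * jet 2 S (r + p).+2| <= N%:R * (N%:R * (G * (a 0 * dq ^+ 2))).
Proof.
move=> G0 hG; have e0 := a0_gt0.
have c0 : 0 <= G * (a 0 * dq ^+ 2) by rewrite !mulr_ge0 ?sqr_ge0 // ltW.
rewrite mulr_natl jet2E; apply: sum_const_le => [|i iS]; first by rewrite mulr_ge0.
rewrite jet1E mulr_sumr; apply: le_trans (ler_norm_sum _ _ _) _.
apply: le_trans (_ : \sum_(k in S :\ i) G * (a 0 * dq ^+ 2) <= _); last first.
  by rewrite sumr_const -[_ *+ #|_|]mulr_natl ler_wpM2r // ler_nat cardD1_le.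
apply: ler_sum => k kS'; have := kS'; rewrite !inE => /andP[ki kS].
rewrite -(ler_pXn2r (ltn0Sn 1)) ?nnegrE // real_normK ?num_real //.
have -> : (w i * (w k * elsym (S :\ i :\ k) (r + p) v)) ^+ 2
  = elsym (S :\ i :\ k) (r + p) v ^+ 2 * (w i ^+ 2 * w k ^+ 2) by ring.
apply: le_trans (_ : G ^+ 2 * (d i * d k) * (w i ^+ 2 * w k ^+ 2) <= _).
  by rewrite ler_wpM2r ?hG // mulr_ge0 ?sqr_ge0.
have -> : G ^+ 2 * (d i * d k) * (w i ^+ 2 * w k ^+ 2)
  = G ^+ 2 * ((d i * w i ^+ 2) * (d k * w k ^+ 2)) by ring.
rewrite exprMn ler_wpM2l ?sqr_ge0 // [leRHS]expr2.
by apply: ler_pM; rewrite ?dw_le //; apply: mulr_ge0; rewrite ?sqr_ge0 // ltW // d_gt0.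
Qed.

Lemma jet2_1_est :
  `|2 * jet 2 S r.+2| <= N%:R * (N%:R * ((K + N%:R) * (a 0 * dq ^+ 2))).
Proof.
have K1 := K_ge1.
have G0 : 0 <= K + N%:R by rewrite addr_ge0 ?K_ge0 //.
have := @jet2_bound 0 (K + N%:R) G0; rewrite addn0; apply=> i k iS kS.
have [h _] := entryS (leq0n _) iS kS; rewrite addn0 in h.
apply: le_trans h _; have := kS; rewrite !inE => /andP[_ kS'].
rewrite ler_wpM2r ?mulr_ge0 ?(ltW (d_gt0 _)) //.
have : N%:R <= N%:R * K by rewrite ler_peMr.
have : 0 <= N%:R * N%:R :> R by rewrite mulr_ge0.
rewrite !expr2; have : 0 <= N%:R :> R by []; nra.
Qed.

Lemma jet2_est p : (p <= N + 2)%N ->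
  `|2 * jet 2 S (r + p).+3|
    <= N%:R * (N%:R * (2 * (K + N%:R) * eta * (a 0 * dq ^+ 2))).
Proof.
move=> pN; have K1 := K_ge1.
have G0 : 0 <= 2 * (K + N%:R) * eta by rewrite !mulr_ge0 // addr_ge0 // K_ge0.
have := @jet2_bound p.+1 _ G0; rewrite addnS; apply=> i k iS kS.
have [_ h] := entryS pN iS kS.
apply: le_trans h _; have := kS; rewrite !inE => /andP[_ kS'].
rewrite ler_wpM2r ?mulr_ge0 ?(ltW (d_gt0 _)) // !exprMn ler_wpM2r ?sqr_ge0 //.
have : N%:R <= N%:R * K by rewrite ler_peMr.
have : 0 <= N%:R * N%:R :> R by rewrite mulr_ge0.
rewrite !expr2; have : 0 <= N%:R :> R by []; nra.
Qed.

End JetBound.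
End Fix.
End Small.

(** * The quadratic form *)

Section MainAlg.
Variables (R : realFieldType) (T : finType) (B : {set T}) (o : T).
Variables (x t : T -> R) (rho : R) (N : nat) (L : R).
Hypotheses (oB : o \in B) (xo : x o = 1) (x0 : forall b, b \in B -> 0 < x b).
Hypotheses (xL : forall b, b \in B -> x b <= L) (L1 : 1 <= L).
Hypotheses (rho1 : 1 <= rho) (BN : #|B|%:R + rho <= N%:R).
Let Z := \sum_(b in B) t b.
Let U := \sum_(b in B) x b * t b.
Let W := \sum_(b in B) t b ^+ 2.
Let X := \sum_(b in B) x b * t b ^+ 2.
Let be := \sum_(b in B) x b.

Lemma weighted_sq (c : R) : 0 <= X + 2 * c * U + be * c ^+ 2.
Proof.
have -> : X + 2 * c * U + be * c ^+ 2 = \sum_(b in B) x b * (t b + c) ^+ 2.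
  rewrite /X /U /be mulr_sumr mulr_suml -!big_split /=.
  by apply: eq_bigr => b _; ring.
by apply: sumr_ge0 => b bB; rewrite mulr_ge0 ?sqr_ge0 // ltW // x0.
Qed.

Lemma be_ge1 : 1 <= be.
Proof.
rewrite /be (bigD1 o) //= xo lerDl; apply: sumr_ge0 => b /andP[bB _].
by rewrite ltW // x0.
Qed.

Lemma be_leNL : be <= N%:R * L.
Proof.
apply: le_trans (_ : \sum_(b in B) L <= _); first exact: ler_sum.
rewrite sumr_const -[_ *+ #|_|]mulr_natl ler_wpM2r //; first by move: L1; lra.
by move: BN rho1; lra.
Qed.

(* Jensen's inequality for the square, with weights f and s * x b. *)
Lemma jensen_sq (f s sg y : R) : 0 < f -> 0 < s ->
  (f * (sg - Z) - s * U - s * be * y) ^+ 2 <= (f + be * s)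
    * (f * (sg - Z) ^+ 2 + s * (X + 2 * y * U + be * y ^+ 2)).
Proof.
move=> f0 s0; have b1 := be_ge1.
set A := sg - Z; pose U' := U + be * y; pose Y := X + 2 * y * U + be * y ^+ 2.
have h1 : 0 <= Y + 2 * A * U' + be * A ^+ 2.
  have -> : Y + 2 * A * U' + be * A ^+ 2 = X + 2 * (y + A) * U + be * (y + A) ^+ 2.
    by rewrite /Y /U'; ring.
  exact: weighted_sq.
have h2 : U' ^+ 2 <= be * Y.
  have h : 0 <= X + 2 * (- (U / be)) * U + be * (- (U / be)) ^+ 2 := weighted_sq _.
  have {h} h : 0 <= be * X - U ^+ 2.
    have -> : be * X - U ^+ 2
       = be * (X + 2 * (- (U / be)) * U + be * (- (U / be)) ^+ 2).
      by field; rewrite gt_eqF // (lt_le_trans ltr01).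
    by rewrite mulr_ge0 // (le_trans ler01).
  rewrite /U' /Y; lra.
have -> : f * A - s * U - s * be * y = f * A - s * U' by rewrite /U'; ring.
rewrite -/Y -subr_ge0.
have -> : (f + be * s) * (f * A ^+ 2 + s * Y) - (f * A - s * U') ^+ 2
  = f * s * (Y + 2 * A * U' + be * A ^+ 2) + s ^+ 2 * (be * Y - U' ^+ 2) by ring.
by rewrite addr_ge0 // !mulr_ge0 // ?sqr_ge0 ?subr_ge0 // ltW.
Qed.

Let k : R := #|B|%:R + rho.
Let c0 : R := (10 * N%:R * L)^-1.

Lemma cardB_ge1 : 1 <= #|B|%:R :> R.
Proof. by rewrite ler1n; apply/card_gt0P; exists o. Qed.

(* Cauchy-Schwarz for tau_o = (Z - sigma) + sigma - sum of the other tau. *)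
Lemma f_part (sg : R) :
  t o ^+ 2 <= k * ((Z - sg) ^+ 2 / rho + sg ^+ 2 + \sum_(b in B :\ o) t b ^+ 2).
Proof.
have B1 := cardB_ge1.
set V := \sum_(b in B :\ o) t b ^+ 2.
have k0 : 0 < k by rewrite /k; move: rho1; lra.
have r0 : 0 < rho by move: rho1; lra.
pose c := t o / k.
have h : 0 <= \sum_(b in B :\ o) (t b + c) ^+ 2.
  by apply: sumr_ge0 => b _; apply: sqr_ge0.
have zE : Z = t o + \sum_(b in B :\ o) t b by rewrite /Z (big_setD1 o).
have {}h : 0 <= V + 2 * c * (Z - t o) + (#|B|%:R - 1) * c ^+ 2.
  apply: le_trans h _; rewrite le_eqVlt; apply/orP; left; apply/eqP.
  have -> : (#|B|%:R - 1) * c ^+ 2 = \sum_(b in B :\ o) c ^+ 2.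
    rewrite sumr_const -[RHS]mulr_natl; congr (_ * _).
    by rewrite (cardsD1 o B) oB natrD addrC addKr.
  have -> : Z - t o = \sum_(b in B :\ o) t b by rewrite zE addrC addKr.
  rewrite mulr_sumr /V -!big_split /=.
  by apply: eq_bigr => b _; ring.
have h2 := sqr_ge0 (sg - c).
have h3 : 0 <= ((Z - sg) - rho * c) ^+ 2 / rho by rewrite divr_ge0 ?sqr_ge0 // ltW.
have e : t o = k * c by rewrite /c mulrC divfK // gt_eqF.
have e3 : ((Z - sg) - rho * c) ^+ 2 / rho
  = (Z - sg) ^+ 2 / rho - 2 * (Z - sg) * c + rho * c ^+ 2.
  by field; rewrite gt_eqF.
rewrite e3 in h3.
have {h h2 h3} : 0 <= (Z - sg) ^+ 2 / rho + sg ^+ 2 + V - k * c ^+ 2.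
  rewrite e in h; rewrite /k in h *; lra.
move=> h; rewrite {1}e expr2 -mulrA ler_pM2l // mulrCA.
rewrite expr2 in h *; lra.
Qed.

(** The bracket is the sum of x_b ((rho + 1) tau_b + y)^2. Of the term with 3/2, the share 5/4 is
    spent on the index [o] and 1/4 on all the others. *)
Lemma s_part (y : R) :
  (1 + (10 * k)^-1) * t o ^+ 2 + c0 * X <=
  (rho * (rho + 1))^-1 * ((rho + 1) ^+ 2 * X + 2 * (rho + 1) * y * U + be * y ^+ 2)
  + 3 / 2 / (rho + 1) * y ^+ 2.
Proof.
have B1 := cardB_ge1; have r0 : 0 < rho by move: rho1; lra.
have N2 : 2 <= N%:R :> R by move: BN rho1; lra.
have NL0 : 0 < 10 * N%:R * L by rewrite !mulr_gt0 //; move: L1 N2; lra.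
have NL10 : 10 * N%:R <= 10 * N%:R * L by rewrite ler_peMr //; move: N2; lra.
have R0 : 0 < rho + 1 by lra.
have rR0 : 0 < rho * (rho + 1) by rewrite mulr_gt0.
have k0 : 0 < k by rewrite /k; lra.
have kN : k <= N%:R by [].
have -> : (rho * (rho + 1))^-1
   * ((rho + 1) ^+ 2 * X + 2 * (rho + 1) * y * U + be * y ^+ 2)
  = \sum_(b in B) x b / (rho * (rho + 1)) * ((rho + 1) * t b + y) ^+ 2.
  rewrite /X /U /be !mulr_sumr mulr_suml -!big_split mulr_sumr /=.
  by apply: eq_bigr => b _; ring.
rewrite (big_setD1 o) //= {1}/X (big_setD1 o) //= xo !mul1r.
set S1 := \sum_(b in B :\ o) x b * t b ^+ 2.
set S2 := \sum_(b in B :\ o) _.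
(* For the other indices only the reserve is wanted. Its cost in [y ^+ 2] adds up to the share 1/4
   because [be <= N%:R * L]. *)
have hS : c0 * S1 <= S2 + 1 / 4 / (rho + 1) * y ^+ 2.
  apply: le_trans (_ : S2 + \sum_(b in B :\ o) x b / (4 * (rho + 1) * N%:R * L) * y ^+ 2 <= _).
    rewrite /S2 -big_split mulr_sumr /=; apply: ler_sum => b; rewrite !inE => /andP[_ bB].
    have xb := x0 bB; rewrite mulrCA.
    have -> : x b / (rho * (rho + 1)) * ((rho + 1) * t b + y) ^+ 2
        + x b / (4 * (rho + 1) * N%:R * L) * y ^+ 2
      = x b * ((rho * (rho + 1))^-1 * ((rho + 1) * t b + y) ^+ 2
               + (4 * (rho + 1) * N%:R * L)^-1 * y ^+ 2) by ring.
    rewrite ler_pM2l //.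
    have h1 : (rho + 1) ^+ 2 * t b ^+ 2
        <= 2 * ((rho + 1) * t b + y) ^+ 2 + 2 * y ^+ 2.
      have := sqr_ge0 ((rho + 1) * t b + 2 * y); lra.
    have q0 : 0 < 4 * (rho + 1) ^+ 2 * N%:R * L.
      by rewrite !mulr_gt0 ?exprn_gt0 //; move: L1 N2; lra.
    apply: le_trans (_ : (4 * (rho + 1) ^+ 2 * N%:R * L)^-1
        * (((rho + 1) * t b + y) ^+ 2 + y ^+ 2) <= _).
      rewrite -(ler_pM2l q0) mulrA [X in _ <= X]mulrA divff ?gt_eqF // mul1r.
      have -> : 4 * (rho + 1) ^+ 2 * N%:R * L * c0 = 4 / 10 * (rho + 1) ^+ 2.
        by rewrite /c0; field; rewrite !gt_eqF //; move: L1 N2; lra.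
      have := sqr_ge0 ((rho + 1) * t b + y); have := sqr_ge0 y; lra.
    rewrite mulrDr lerD //.
      rewrite ler_wpM2r ?sqr_ge0 // lef_pV2 ?posrE //.
      apply: le_trans (_ : (rho + 1) ^+ 2 * 1 <= _).
        by rewrite mulr1 expr2 ler_pM2r //; lra.
      have -> : 4 * (rho + 1) ^+ 2 * N%:R * L = (rho + 1) ^+ 2 * (4 * N%:R * L) by ring.
      rewrite ler_pM2l ?exprn_gt0 //; move: L1 NL10 N2; lra.
    have q1 : 0 < 4 * (rho + 1) * N%:R * L.
      by rewrite !mulr_gt0 //; move: L1 N2; lra.
    rewrite ler_wpM2r ?sqr_ge0 // lef_pV2 ?posrE //.
    have -> : 4 * (rho + 1) ^+ 2 * N%:R * L = (rho + 1) * (4 * (rho + 1) * N%:R * L).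
      by ring.
    by rewrite ler_peMl ?(ltW q1) //; lra.
  rewrite lerD2l -mulr_suml ler_wpM2r ?sqr_ge0 // -mulr_suml.
  have q0 : 0 < 4 * (rho + 1) * N%:R * L.
    by rewrite !mulr_gt0 //; move: L1 N2; lra.
  rewrite ler_pdivrMr //.
  have -> : 1 / 4 / (rho + 1) * (4 * (rho + 1) * N%:R * L) = N%:R * L.
    by field; rewrite gt_eqF.
  apply: le_trans be_leNL; rewrite /be [leRHS](big_setD1 o) //= xo; lra.
(* Minimising the right side over [y] gives exactly the factor 1 + 1/(5 rho + 4), and 5 rho + 4 <= 5
   k since B is not empty. *)
have hO : (1 + (5 * k)^-1) * t o ^+ 2
   <= (rho * (rho + 1))^-1 * ((rho + 1) * t o + y) ^+ 2 + 5 / 4 / (rho + 1) * y ^+ 2.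
  have q0 : 0 < 5 * rho + 4 by lra.
  apply: le_trans (_ : (1 + (5 * rho + 4)^-1) * t o ^+ 2 <= _).
    by rewrite ler_wpM2r ?sqr_ge0 // lerD2l lef_pV2 ?posrE ?mulr_gt0 // /k; lra.
  rewrite -subr_ge0.
  have -> : (rho * (rho + 1))^-1 * ((rho + 1) * t o + y) ^+ 2
    + 5 / 4 / (rho + 1) * y ^+ 2 - (1 + (5 * rho + 4)^-1) * t o ^+ 2
    = (4 * (rho + 1) * t o + (5 * rho + 4) * y) ^+ 2
       / (4 * rho * (rho + 1) * (5 * rho + 4)).
    by field; rewrite !gt_eqF.
  by rewrite divr_ge0 ?sqr_ge0 // !mulr_ge0 // ltW.
have hc : c0 * t o ^+ 2 + (1 + (10 * k)^-1) * t o ^+ 2 <= (1 + (5 * k)^-1) * t o ^+ 2.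
  rewrite -mulrDl ler_wpM2r ?sqr_ge0 //.
  have -> : (5 * k)^-1 = (10 * k)^-1 + (10 * k)^-1 by field; rewrite gt_eqF.
  have : c0 <= (10 * k)^-1.
    rewrite /c0 lef_pV2 ?posrE //; last by rewrite mulr_gt0.
    by apply: le_trans NL10; rewrite ler_pM2l.
  lra.
have hy : 3 / 2 / (rho + 1) * y ^+ 2 = 5 / 4 / (rho + 1) * y ^+ 2 + 1 / 4 / (rho + 1) * y ^+ 2.
  by field; rewrite gt_eqF.
rewrite hy; lra.
Qed.

(** With [y = V / s], subtracting [(rho - 1) / rho] times [jensen_sq] leaves [(Z - sg) ^+ 2 / rho]
    in the part weighted by [f], as [f_part] requires. In the part weighted by [s], the coefficients
    of [X], [y * U] and [be * y ^+ 2] become those of the complete squares of [s_part]. *)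
Lemma reduced_quadratic_le (f s sg V : R) : 0 < f -> 0 < s ->
  (1 + (10 * k)^-1) * (f + s) * t o ^+ 2 + c0 * (f * sg ^+ 2 + f * W + s * X) <=
  f * ((Z - sg) ^+ 2 + sg ^+ 2 + W) + 2 * s * X + 2 * U * V
  + (rho * be + 3 / 2) / (rho + 1) * (V ^+ 2 / s)
  - (rho - 1) / rho * ((f * (sg - Z) - s * U - be * V) ^+ 2 / (f + be * s)).
Proof.
move=> f0 s0; pose y := V / s; have Vy : V = s * y by rewrite /y mulrC divfK ?gt_eqF.
have b1 := be_ge1; have B1 := cardB_ge1; have r0 : 0 < rho by move: rho1; lra.
have fs0 : 0 < f + be * s by rewrite addr_gt0 // mulr_gt0 // (lt_le_trans ltr01).
have hJ := jensen_sq sg y f0 s0.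
have {}hJ : (f * (sg - Z) - s * U - be * V) ^+ 2 / (f + be * s)
   <= f * (sg - Z) ^+ 2 + s * (X + 2 * y * U + be * y ^+ 2).
  have -> : f * (sg - Z) - s * U - be * V = f * (sg - Z) - s * U - s * be * y.
    by rewrite Vy; ring.
  by rewrite ler_pdivrMr // [leRHS]mulrC.
have c1 : 0 <= (rho - 1) / rho by rewrite divr_ge0 ?(ltW r0) // subr_ge0.
have {}hJ := ler_wpM2l c1 hJ.
apply: le_trans (_ : f * ((Z - sg) ^+ 2 / rho + sg ^+ 2 + W)
   + s * ((rho * (rho + 1))^-1
     * ((rho + 1) ^+ 2 * X + 2 * (rho + 1) * y * U + be * y ^+ 2)
  + 3 / 2 / (rho + 1) * y ^+ 2) <= _); last first.
  have -> : V ^+ 2 / s = s * y ^+ 2 by rewrite Vy; field; rewrite gt_eqF.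
  rewrite -subr_ge0; rewrite -subr_ge0 in hJ; apply: le_trans hJ _.
  rewrite le_eqVlt; apply/orP; left; apply/eqP; rewrite Vy.
  by field; rewrite !gt_eqF //; lra.
have N2 : 2 <= N%:R :> R by move: BN rho1; lra.
have NL0 : 0 < 10 * N%:R * L by rewrite !mulr_gt0 //; move: L1 N2; lra.
have NL10 : 10 * N%:R <= 10 * N%:R * L by rewrite ler_peMr //; move: N2; lra.
have k0 : 0 < k by rewrite /k; lra.
have kN : k <= N%:R by [].
have hs := ler_wpM2l (ltW s0) (s_part y).
have hf : (1 + (10 * k)^-1) * t o ^+ 2 + c0 * (sg ^+ 2 + W)
  <= (Z - sg) ^+ 2 / rho + sg ^+ 2 + W.
  have := f_part sg; rewrite /W (big_setD1 o oB) /=.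
  set V' := \sum_(b in B :\ o) _; set A := (Z - sg) ^+ 2 / rho => h.
  have A0 : 0 <= A by rewrite divr_ge0 ?sqr_ge0 ?ltW.
  have V0 : 0 <= V' by apply: sumr_ge0 => b _; apply: sqr_ge0.
  have s20 := sqr_ge0 sg; have t20 := sqr_ge0 (t o).
  have c0le : c0 <= (10 * k)^-1.
    rewrite /c0 lef_pV2 ?posrE //; last by rewrite mulr_gt0.
    by apply: le_trans NL10; rewrite ler_pM2l.
  have k10 : (10 * k)^-1 <= 1 / 10.
    by rewrite div1r lef_pV2 ?posrE ?mulr_gt0 // ler_pMr // /k; lra.
  have {}h : t o ^+ 2 * (10 * k)^-1 <= (A + sg ^+ 2 + V') / 10.
    rewrite ler_pdivrMr ?mulr_gt0 //.
    have -> : (A + sg ^+ 2 + V') / 10 * (10 * k) = k * (A + sg ^+ 2 + V').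
      by field.
    by [].
  have h1 : c0 * (t o ^+ 2) <= (10 * k)^-1 * t o ^+ 2 by rewrite ler_wpM2r.
  have h2 : c0 * (sg ^+ 2 + V') <= 1 / 10 * (sg ^+ 2 + V').
    by rewrite ler_wpM2r ?addr_ge0 // (le_trans c0le).
  lra.
have {}hf := ler_wpM2l (ltW f0) hf; lra.
Qed.

End MainAlg.

(** * Error terms in the quadratic form *)

Section Norms.
Variable R : realFieldType.
Implicit Types a b c d x y z : R.

Lemma normM_le x y a b : `|x| <= a -> `|y| <= b -> `|x * y| <= a * b.
Proof. by move=> xa yb; rewrite normrM ler_pM. Qed.

Lemma normD_le x y a b : `|x| <= a -> `|y| <= b -> `|x + y| <= a + b.
Proof. by move=> xa yb; apply: le_trans (ler_normD _ _) _; apply: lerD. Qed.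

Lemma normB_le x y a b : `|x| <= a -> `|y| <= b -> `|x - y| <= a + b.
Proof. by move=> xa yb; apply: le_trans (ler_normB _ _) _; apply: lerD. Qed.

Lemma norm_sq_le x a : 0 <= a -> x ^+ 2 <= a ^+ 2 -> `|x| <= a.
Proof. by move=> a0 h; rewrite -(ler_pXn2r (ltn0Sn 1)) ?nnegrE // real_normK ?num_real. Qed.

Lemma sq_norm_le x a : `|x| <= a -> x ^+ 2 <= a ^+ 2.
Proof.
by move=> h; rewrite -real_normK ?num_real // ler_pXn2r ?nnegrE // (le_trans _ h).
Qed.

Lemma norm_sum_le (T : finType) (A : {set T}) (F : T -> R) (n c : R) :
  #|A|%:R <= n -> 0 <= c -> (forall i, i \in A -> `|F i| <= c) ->
  `|\sum_(i in A) F i| <= n * c.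
Proof.
move=> An c0 Fc; apply: le_trans (ler_norm_sum _ _ _) _.
apply: le_trans (_ : \sum_(i in A) c <= _); first exact: ler_sum.
by rewrite sumr_const -[_ *+ #|_|]mulr_natl ler_wpM2r.
Qed.

End Norms.

Section PartTwo.
Variable R : realFieldType.
Variables (K h s s0 be bh V V1 om dq bb P2 rho : R).
Let r1 := rho + 1.
Let c := (rho - 1) / rho.
Hypotheses (K1 : 1 <= K) (h0 : 0 < h) (h1 : h <= 1) (hs : h ^+ 2 <= s) (s2 : s <= 2).
Hypotheses (rho1 : 1 <= rho) (rK : r1 <= K) (be0 : 0 <= be) (beK : be <= K).
Hypotheses (bb0 : 0 <= bb) (dqb : dq ^+ 2 <= bb ^+ 2).
Hypotheses (VK : `|V| <= K * bb) (omK : `|om| <= K * bb) (Vs : V ^+ 2 <= r1 * s * dq ^+ 2).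
Hypotheses (dbe : `|bh - be| <= K * h ^+ 2) (ds : `|s0 - s| <= K * h ^+ 2).
Hypothesis (dV : `|V1 - V| <= K * h ^+ 2 * bb).
Hypothesis P2le : forall t, P2 <= (1 - bh * s0) * c * om ^+ 2
  + 2 * bh * (V1 + s0 * om) * om
  - 2 * bh / r1 * (2 * t * (rho * V1 + r1 * s0 * om) - t ^+ 2 * (r1 * s))
  + K * h ^+ 2 * bb ^+ 2.

(** If [s0], [V1], [bh] were [s], [V], [be], the best [t] would turn the bound [P2le] into the main
    terms minus a square [be * c * s * (om + rho / r1 * (V / s)) ^+ 2], which is dropped. The worst
    error comes from [t] itself: it has size [bb / h] since [s >= h^2], and it multiplies a
    discrepancy of size [h^2 * bb], which leaves one power of [h]. *)
Lemma second_jet_error_le :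
  P2 <= c * om ^+ 2 - rho / r1 * be * (V ^+ 2 / s) + 60 * K ^+ 6 * h * bb ^+ 2.
Proof.
have s0' : 0 < s by apply: lt_le_trans hs; rewrite exprn_gt0.
have r0 : 0 < rho by move: rho1; lra.
have r10 : 0 < r1 by rewrite /r1; lra.
have r12 : 2 <= r1 by rewrite /r1; move: rho1; lra.
have c0 : 0 <= c by rewrite /c divr_ge0 ?(ltW r0) // subr_ge0.
have c1 : c <= 1 by rewrite /c ler_pdivrMr //; lra.
have K0 : 0 <= K by move: K1; lra.
have hh0 : 0 <= h ^+ 2 by apply: sqr_ge0.
have hh1 : h ^+ 2 <= 1 by rewrite expr_le1 // ltW.
have hh : h ^+ 2 <= h by rewrite expr2 ler_piMl // ltW.
have Khh : K * h ^+ 2 <= K by rewrite ler_piMr.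
(* The maximiser of the concave quadratic in [P2le], for the unperturbed values. *)
pose t := (rho * V + r1 * s * om) / (r1 * s).
have rs0 : 0 < r1 * s by rewrite mulr_gt0.
pose al := bh - be; pose sg := s0 - s; pose nu := V1 - V.
have dal : `|al| <= K * h ^+ 2 := dbe; have dsg : `|sg| <= K * h ^+ 2 := ds.
have dnu : `|nu| <= K * h ^+ 2 * bb := dV.
have bhE : bh = be + al by rewrite /al; ring.
have s0E : s0 = s + sg by rewrite /sg; ring.
have V1E : V1 = V + nu by rewrite /nu; ring.
have tE : t * (r1 * s) = rho * V + r1 * s * om by rewrite /t divfK // gt_eqF.
pose dA := rho * nu + r1 * sg * om.
pose mn := (1 - be * s) * c * om ^+ 2 + 2 * be * (V + s * om) * om
   - 2 * be / r1 * (t ^+ 2 * (r1 * s)).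
have key : mn = c * om ^+ 2 - rho / r1 * be * (V ^+ 2 / s)
    - be * c * s * (om + rho / r1 * (V / s)) ^+ 2.
  rewrite /mn /t /c /r1; field.
  by rewrite !gt_eqF.
pose e1 := - (al * s0 + be * sg) * (c * om ^+ 2).
pose e2 := 2 * al * (V1 + s0 * om) * om.
pose e3 := 2 * be * (nu + sg * om) * om.
pose e4 := 2 / r1 * (al * (t ^+ 2 * (r1 * s)) + 2 * bh * (t * dA)).
have bnd : P2 <= mn + e1 + e2 + e3 - e4 + K * h ^+ 2 * bb ^+ 2.
  apply: le_trans (P2le t) _; rewrite le_eqVlt; apply/orP; left; apply/eqP.
  have -> : rho * V1 + r1 * s0 * om = t * (r1 * s) + dA.
    by rewrite tE /dA V1E s0E; ring.
  rewrite /mn /e1 /e2 /e3 /e4 bhE V1E s0E; ring.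
have bb2 : 0 <= bb ^+ 2 by apply: sqr_ge0.
have om2 : `|om ^+ 2| <= K ^+ 2 * bb ^+ 2.
  by rewrite normrX -exprMn ler_pXn2r ?nnegrE // mulr_ge0.
have s0K : `|s0| <= 3 * K.
  have -> : 3 * K = 2 * K + K by ring.
  rewrite s0E; apply: normD_le; last by apply: le_trans dsg _.
  by rewrite gtr0_norm //; move: s2 K1; lra.
have beN : `|be| <= K by rewrite ger0_norm.
have bhK : `|bh| <= 2 * K.
  have -> : 2 * K = K + K by ring.
  by rewrite bhE; apply: normD_le => //; apply: le_trans dal _.
have V1K : `|V1| <= 2 * K * bb.
  have -> : 2 * K * bb = K * bb + K * bb by ring.
  rewrite V1E; apply: normD_le => //; apply: le_trans dnu _.
  by rewrite ler_wpM2r.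
have K2 : K <= K ^+ 2 by rewrite expr2 ler_peMr.
have K26 : K ^+ 4 <= K ^+ 6 by rewrite ler_weXn2l.
have K16 : K <= K ^+ 6 by rewrite ler_eXnr.
pose X := h ^+ 2 * bb ^+ 2.
have X0 : 0 <= X by rewrite mulr_ge0.
have Xh : X <= h * bb ^+ 2 by rewrite ler_wpM2r.
have b1 : `|e1| <= 4 * K ^+ 4 * X.
  have comb : `|c * om ^+ 2| <= K ^+ 2 * bb ^+ 2.
    rewrite normrM; apply: le_trans om2; rewrite ler_piMl // ger0_norm //.
  have := normM_le (normD_le (normM_le dal s0K) (normM_le beN dsg)) comb.
  rewrite /e1 mulNr normrN => /le_trans; apply.
  by rewrite le_eqVlt; apply/orP; left; apply/eqP; rewrite /X; ring.
have b2 : `|e2| <= 10 * K ^+ 4 * X.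
  have two : `|2 : R| <= 2 by rewrite ger0_norm.
  have := normM_le (normM_le (normM_le two dal)
     (normD_le V1K (normM_le s0K omK))) omK.
  move/le_trans; apply.
  have -> : 2 * (K * h ^+ 2) * (2 * K * bb + 3 * K * (K * bb)) * (K * bb)
    = (4 * (K ^+ 2 * K) + 6 * K ^+ 4) * X by rewrite /X; ring.
  have -> : 10 * K ^+ 4 = 4 * (K ^+ 2 * K ^+ 2) + 6 * K ^+ 4 by ring.
  by rewrite ler_wpM2r // lerD2r ler_pM2l // ler_wpM2l ?sqr_ge0.
have b3 : `|e3| <= 4 * K ^+ 4 * X.
  have two : `|2 : R| <= 2 by rewrite ger0_norm.
  have := normM_le (normM_le (normM_le two beN)
     (normD_le dnu (normM_le dsg omK))) omK.
  move/le_trans; apply.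
  have -> : 2 * K * (K * h ^+ 2 * bb + K * h ^+ 2 * (K * bb)) * (K * bb)
    = (2 * (K ^+ 2 * K) + 2 * K ^+ 4) * X by rewrite /X; ring.
  have -> : 4 * K ^+ 4 = 2 * (K ^+ 2 * K ^+ 2) + 2 * K ^+ 4 by ring.
  by rewrite ler_wpM2r // lerD2r ler_pM2l // ler_wpM2l ?sqr_ge0.
have tt : t ^+ 2 * (r1 * s) <= 6 * K ^+ 3 * bb ^+ 2.
  have -> : t ^+ 2 * (r1 * s) = (rho * V + r1 * s * om) ^+ 2 / (r1 * s).
    by rewrite /t; field; rewrite !gt_eqF.
  rewrite ler_pdivrMr //.
  have q1 : rho ^+ 2 * V ^+ 2 <= K ^+ 2 * (r1 * s * bb ^+ 2).
    apply: ler_pM; rewrite ?sqr_ge0 //.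
      by rewrite ler_pXn2r ?nnegrE ?(ltW r0) //; move: rK; rewrite /r1; lra.
    by apply: le_trans Vs _; rewrite ler_pM2l.
  have q2 : (r1 * s) * om ^+ 2 <= K * 2 * (K ^+ 2 * bb ^+ 2).
    apply: ler_pM; rewrite ?sqr_ge0 ?(ltW rs0) //.
      by apply: ler_pM => //; apply: ltW.
    by apply: le_trans om2; rewrite ler_norm.
  have q3 := ler_wpM2l (ltW rs0) q2.
  have q4 : K ^+ 2 * (r1 * s * bb ^+ 2) <= K ^+ 3 * (r1 * s * bb ^+ 2).
    rewrite ler_wpM2r //; first by rewrite mulr_ge0 // ltW.
    by rewrite ler_weXn2l.
  have := sqr_ge0 (rho * V - r1 * s * om); lra.
have tb : `|t| <= 3 * K ^+ 2 * bb / h.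
  apply: norm_sq_le; first by rewrite !mulr_ge0 ?sqr_ge0 // invr_ge0 ltW.
  have -> : (3 * K ^+ 2 * bb / h) ^+ 2 = 9 * K ^+ 4 * bb ^+ 2 / h ^+ 2.
    by field; rewrite gt_eqF.
  rewrite ler_pdivlMr ?exprn_gt0 //.
  apply: le_trans (_ : t ^+ 2 * (r1 * s) <= _).
    rewrite ler_wpM2l ?sqr_ge0 //; apply: le_trans hs _.
    by rewrite ler_peMl ?(ltW s0') //; lra.
  apply: le_trans tt _; rewrite ler_wpM2r //.
  have : K ^+ 3 <= K ^+ 4 by rewrite ler_weXn2l.
  have : 0 <= K ^+ 4 by rewrite exprn_ge0.
  lra.
have dAb : `|dA| <= 2 * K ^+ 3 * h ^+ 2 * bb.
  have rhoK : `|rho| <= K by rewrite gtr0_norm //; move: rK; rewrite /r1; lra.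
  have r1K : `|r1| <= K by rewrite gtr0_norm.
  have := normD_le (normM_le rhoK dnu) (normM_le (normM_le r1K dsg) omK).
  move/le_trans; apply.
  have -> : K * (K * h ^+ 2 * bb) + K * (K * h ^+ 2) * (K * bb)
    = (K ^+ 2 + K ^+ 3) * (h ^+ 2 * bb) by ring.
  have -> : 2 * K ^+ 3 * h ^+ 2 * bb = (K ^+ 3 + K ^+ 3) * (h ^+ 2 * bb) by ring.
  have hb0 : 0 <= h ^+ 2 * bb by apply: mulr_ge0.
  by rewrite ler_wpM2r // lerD2r ler_weXn2l.
have b4 : `|e4| <= 6 * K ^+ 4 * X + 24 * K ^+ 6 * (h * bb ^+ 2).
  have two : `|2 / r1| <= 1.
    by rewrite gtr0_norm ?divr_gt0 // ler_pdivrMr // mul1r.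
  have two' : `|2 : R| <= 2 by rewrite ger0_norm.
  have tt' : `|t ^+ 2 * (r1 * s)| <= 6 * K ^+ 3 * bb ^+ 2.
    by rewrite ger0_norm // mulr_ge0 ?sqr_ge0 // ltW.
  have := normM_le two (normD_le (normM_le dal tt')
      (normM_le (normM_le two' bhK) (normM_le tb dAb))).
  move/le_trans; apply; rewrite le_eqVlt; apply/orP; left; apply/eqP.
  by rewrite /X; field; rewrite gt_eqF.
have KX4 : K ^+ 4 * X <= K ^+ 6 * (h * bb ^+ 2).
  by apply: ler_pM => //; rewrite exprn_ge0.
have KX1 : K * X <= K ^+ 6 * (h * bb ^+ 2) by apply: ler_pM.
have sqb : 0 <= be * c * s * (om + rho / r1 * (V / s)) ^+ 2.
  by apply: mulr_ge0 (sqr_ge0 _); apply: mulr_ge0 (ltW s0'); apply: mulr_ge0.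
have n1 := ler_norm e1; have n2 := ler_norm e2; have n3 := ler_norm e3.
have n4 := ler_norm (- e4); rewrite normrN in n4.
rewrite key in bnd; apply: le_trans bnd _.
have -> : K * h ^+ 2 * bb ^+ 2 = K * X by rewrite /X mulrA.
(* The errors add up to 4 + 10 + 4 + 6 + 24 + 1 = 49 units; 60 leaves room. *)
have -> : 60 * K ^+ 6 * h * bb ^+ 2 = 60 * (K ^+ 6 * (h * bb ^+ 2)) by ring.
have X6 : 0 <= K ^+ 6 * (h * bb ^+ 2).
  by apply: mulr_ge0; [rewrite exprn_ge0 | rewrite mulr_ge0 // ltW].
rewrite -mulrA in b1; rewrite -mulrA in b2; rewrite -mulrA in b3.
rewrite -[6 * K ^+ 4 * X]mulrA -[24 * K ^+ 6 * _]mulrA in b4.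
move: KX4 KX1 X6 b1 b2 b3 b4 n1 n2 n3 n4 sqb.
set Y4 := K ^+ 4 * X; set Y6 := K ^+ 6 * (h * bb ^+ 2); set Y1 := K * X.
set z1 := c * om ^+ 2 - _; set z2 := be * c * s * _.
clearbody e1 e2 e3 e4; lra.
Qed.

End PartTwo.

(* In the application, with Phi_A = sum_j sigma_j(x on A) a_j: f, Pb b and
   Pbc b c are Phi_A / a_0 for A = B, B minus b and B minus b, c; P1, P1b and P2
   are the corresponding first and (full) second derivatives along the direction
   restricted to S; om and V1 are the derivatives of a_0 and a_1 divided by a_0;
   s0 = - a_1 / a_0; sg is the logarithmic derivative of F along xi; dq^2 is the
   diagonal term of S; bb^2 collects the reserve. *)
Section Core.
Variables (R : realFieldType) (T : finType) (B : {set T}) (o : T).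
Variables (x t : T -> R) (rho : R) (N : nat) (L G h : R).
Hypotheses (oB : o \in B) (xo : x o = 1) (x0 : forall b, b \in B -> 0 < x b).
Hypotheses (xL : forall b, b \in B -> x b <= L) (L1 : 1 <= L).
Hypotheses (rho1 : 1 <= rho) (BN : #|B|%:R + rho <= N%:R).
(** After normalisation an entry above 1 can only come from [y], where the direction vanishes. This
    yields [W <= X] below. *)
Hypothesis tx : forall b, b \in B -> t b = 0 \/ 1 <= x b.
Hypotheses (NG : N%:R <= G) (LG : L <= G) (G1 : 1 <= G).
Hypotheses (h0 : 0 < h) (h1 : h <= 1) (Gh : G * h ^+ 2 <= 1 / 2).
Let Z := \sum_(b in B) t b.
Let U := \sum_(b in B) x b * t b.
Let W := \sum_(b in B) t b ^+ 2.
Let X := \sum_(b in B) x b * t b ^+ 2.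
Let be := \sum_(b in B) x b.
Let k : R := #|B|%:R + rho.
Let c0 : R := (10 * N%:R * L)^-1.
Let r1 := rho + 1.
Let c := (rho - 1) / rho.

Variables (f s s0 bh sg V V1 om dq bb P1 P2 ga : R) (Pb P1b : T -> R) (Pbc : T -> T -> R).
Hypotheses (f0 : 0 < f) (hs : h ^+ 2 <= s) (bb0 : 0 <= bb) (dq0 : 0 <= dq).
Hypothesis bbE : bb ^+ 2 = f * sg ^+ 2 + W + dq ^+ 2.
Hypothesis hf : `|f - (1 - be * s)| <= G * h ^+ 2.
Hypothesis hPb : forall b, b \in B -> `|Pb b - (f + x b * s)| <= G * h ^+ 2.
Hypothesis hPbc : forall b b', b \in B -> b' \in B :\ b ->
  `|Pbc b b' - (f + (x b + x b') * s)| <= G * h ^+ 2.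
Hypothesis hP1 : `|P1 - (om + be * V1)| <= G * h ^+ 2 * dq.
Hypothesis hP1b : forall b, b \in B -> `|P1b b - (P1 - x b * V1)| <= G * h ^+ 2 * dq.
Hypothesis hV : `|V1 - V| <= G * h ^+ 2 * dq.
Hypothesis Vs : V ^+ 2 <= r1 * s * dq ^+ 2.
Hypothesis hsg : f * sg = \sum_(b in B) t b * Pb b + P1.
Hypotheses (hs0 : `|s0 - s| <= G * h ^+ 2) (hbh : `|bh - be| <= G * h ^+ 2).
Hypothesis P2le : forall u, P2 <= (1 - bh * s0) * c * om ^+ 2
  + 2 * bh * (V1 + s0 * om) * om
  - 2 * bh / r1 * (2 * u * (rho * V1 + r1 * s0 * om) - u ^+ 2 * (r1 * s))
  + G * h ^+ 2 * dq ^+ 2.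
Hypotheses (ga0 : 0 <= ga) (ga1 : ga <= 1) (gak : ga <= (10 * k)^-1).

Let be1 : 1 <= be. Proof. exact: (be_ge1 oB). Qed.
Let beG : be <= G ^+ 2.
Proof.
apply: le_trans (be_leNL xL L1 rho1 BN) _; rewrite expr2.
by apply: ler_pM => //; move: L1; lra.
Qed.
Let sp : 0 < s. Proof. by apply: lt_le_trans hs; rewrite exprn_gt0. Qed.
Let BG : #|B|%:R <= G. Proof. by apply: le_trans NG; move: BN rho1; lra. Qed.
Let G0 : 0 <= G. Proof. by move: G1; lra. Qed.

Let bes : s <= be * s. Proof. by rewrite ler_peMl // ltW. Qed.
(** Since [f] is close to [1 - be * s], with [f] and [s] positive and [be >= 1], both are at most
    3/2 and [f + be * s] is close to 1. Either of the two may be small, but not both. *)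
Let s32 : s <= 3 / 2.
Proof.
have := ler_norm (f - (1 - be * s)).
by move: hf Gh f0 bes; lra.
Qed.
Let f32 : f <= 3 / 2.
Proof.
have := ler_norm (f - (1 - be * s)).
by move: hf Gh sp bes; lra.
Qed.
Let fbs : 1 / 2 <= f + be * s.
Proof.
have := ler_norm (- (f - (1 - be * s))); rewrite normrN.
by move: hf Gh; lra.
Qed.
Let fbs1 : f + be * s <= 1 + G * h ^+ 2.
Proof.
have := ler_norm (f - (1 - be * s)).
by move: hf; lra.
Qed.

Let W0 : 0 <= W. Proof. by apply: sumr_ge0 => b _; apply: sqr_ge0. Qed.
Let fsg0 : 0 <= f * sg ^+ 2. Proof. by rewrite mulr_ge0 ?sqr_ge0 // ltW. Qed.
Let dq2 : dq ^+ 2 <= bb ^+ 2. Proof. by move: bbE W0 fsg0; lra. Qed.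
Let dqb : dq <= bb. Proof. by rewrite -(ler_pXn2r (ltn0Sn 1)) ?nnegrE. Qed.

Let tb b : b \in B -> `|t b| <= bb.
Proof.
move=> bB; apply: norm_sq_le => //.
have : t b ^+ 2 <= W.
  rewrite /W (bigD1 b) //= lerDl; apply: sumr_ge0 => ? _; apply: sqr_ge0.
by move: bbE fsg0; have := sqr_ge0 dq; lra.
Qed.

Let xb b : b \in B -> `|x b| <= G.
Proof. by move=> bB; rewrite gtr0_norm ?x0 // (le_trans (xL bB)). Qed.

Let Zb : `|Z| <= G * bb. Proof. by apply: norm_sum_le. Qed.

Let Ub : `|U| <= G ^+ 2 * bb.
Proof.
rewrite expr2 -mulrA; apply: norm_sum_le => //; first by rewrite mulr_ge0.
by move=> b bB; apply: normM_le; rewrite ?xb ?tb.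
Qed.

Let hG : 0 <= G * h ^+ 2. Proof. by rewrite mulr_ge0 ?sqr_ge0. Qed.

Let dPs (e : R) (d : T -> R) : (forall b, b \in B -> `|d b| <= e) ->
  `|\sum_(b in B) t b * d b| <= G * (bb * e).
Proof.
move=> de; have e0 : 0 <= e by apply: le_trans (de o oB).
apply: norm_sum_le => //; first by rewrite mulr_ge0.
by move=> b bB; apply: normM_le; rewrite ?tb ?de.
Qed.

(** [om] is not an independent variable: [hsg] determines [P1], hence [om], from [sg], the tau_b and
    [V] up to small errors. [P1s] and [oms] below are the leading parts. *)
Let P1s := f * sg - f * Z - s * U.

Let dP1 : `|P1 - P1s| <= G ^+ 2 * h ^+ 2 * bb.
Proof.
have -> : P1 - P1s = - \sum_(b in B) t b * (Pb b - (f + x b * s)).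
  have -> : P1 = f * sg - \sum_(b in B) t b * Pb b by rewrite hsg; ring.
  under [in RHS]eq_bigr do rewrite mulrBr.
  rewrite sumrB.
  have -> : \sum_(b in B) t b * (f + x b * s) = f * Z + s * U.
    rewrite /Z /U !mulr_sumr -big_split; apply: eq_bigr => b _ /=; ring.
  rewrite /P1s; ring.
rewrite normrN; apply: le_trans (dPs hPb) _.
by rewrite le_eqVlt; apply/orP; left; apply/eqP; ring.
Qed.

Let fsgb : `|f * sg| <= 2 * bb.
Proof.
apply: norm_sq_le; first by rewrite mulr_ge0.
have -> : (f * sg) ^+ 2 = f * (f * sg ^+ 2) by ring.
have h2 : f * (f * sg ^+ 2) <= 3 / 2 * bb ^+ 2.
  apply: ler_pM => //; first exact: ltW.
  by move: bbE W0; have := sqr_ge0 dq; lra.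
by have := sqr_ge0 bb; lra.
Qed.

Let GG2 : G <= G ^+ 2. Proof. by rewrite expr2 ler_peMr. Qed.
Let G12 : 1 <= G ^+ 2. Proof. by move: GG2 G1; lra. Qed.

Let P1sb : `|P1s| <= 6 * G ^+ 2 * bb.
Proof.
have sN : `|s| <= 3 / 2 by rewrite gtr0_norm.
have fN : `|f| <= 3 / 2 by rewrite gtr0_norm.
apply: le_trans (normB_le (normB_le fsgb (normM_le fN Zb)) (normM_le sN Ub)) _.
rewrite !mulrA -!mulrDl ler_wpM2r //; move: GG2 G12; lra.
Qed.

Let hh1 : h ^+ 2 <= 1. Proof. by rewrite expr_le1 // ltW. Qed.
Let hh : h ^+ 2 <= h. Proof. by rewrite expr2 ler_piMl // ltW. Qed.

Let r1G : r1 <= G.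
Proof. by apply: le_trans NG; have := cardB_ge1 R oB; move: BN; rewrite /r1; lra. Qed.

Let Vb : `|V| <= 2 * G * bb.
Proof.
apply: norm_sq_le; first by rewrite !mulr_ge0.
apply: le_trans Vs _.
have r10 : 0 < r1 by rewrite /r1; move: rho1; lra.
apply: le_trans (_ : (G * 2) * bb ^+ 2 <= _).
  apply: ler_pM; rewrite ?sqr_ge0 //; first by rewrite mulr_ge0 // ltW.
  by apply: ler_pM; rewrite ?(ltW r10) ?(ltW sp) // (le_trans s32) //; lra.
rewrite !exprMn; have := ler_wpM2r (sqr_ge0 bb) GG2; have := sqr_ge0 bb.
by have := mulr_ge0 (sqr_ge0 G) (sqr_ge0 bb); lra.
Qed.

Let hVb : `|V1 - V| <= G * h ^+ 2 * bb.
Proof. by apply: le_trans hV _; rewrite ler_wpM2l. Qed.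

Let beN : `|be| <= G ^+ 2. Proof. by rewrite ger0_norm //; move: be1; lra. Qed.

Let oms := P1s - be * V.

Let domb : `|om - oms| <= 3 * G ^+ 3 * h ^+ 2 * bb.
Proof.
have -> : om - oms = (P1 - P1s) - (P1 - (om + be * V1)) - be * (V1 - V).
  by rewrite /oms; ring.
have hP1' : `|P1 - (om + be * V1)| <= G * h ^+ 2 * bb.
  by apply: le_trans hP1 _; rewrite ler_wpM2l.
apply: le_trans (normB_le (normB_le dP1 hP1') (normM_le beN hVb)) _.
have -> : G ^+ 2 * h ^+ 2 * bb + G * h ^+ 2 * bb + G ^+ 2 * (G * h ^+ 2 * bb)
  = (G ^+ 2 + G + G ^+ 3) * h ^+ 2 * bb by ring.
rewrite !ler_wpM2r ?sqr_ge0 //.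
have : G ^+ 2 <= G ^+ 3 by rewrite ler_weXn2l.
by move: GG2; lra.
Qed.

Let omsb : `|oms| <= 8 * G ^+ 3 * bb.
Proof.
apply: le_trans (normB_le P1sb (normM_le beN Vb)) _.
have -> : 6 * G ^+ 2 * bb + G ^+ 2 * (2 * G * bb) = (6 * G ^+ 2 + 2 * G ^+ 3) * bb by ring.
rewrite ler_wpM2r //; have : G ^+ 2 <= G ^+ 3 by rewrite ler_weXn2l.
lra.
Qed.

Let G30 : 0 <= G ^+ 3. Proof. by rewrite exprn_ge0. Qed.

Let omb : `|om| <= 11 * G ^+ 3 * bb.
Proof.
have -> : om = oms + (om - oms) by ring.
apply: le_trans (normD_le omsb domb) _; rewrite -mulrDl ler_wpM2r //.
have : G ^+ 3 * h ^+ 2 <= G ^+ 3 by rewrite ler_piMr.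
lra.
Qed.

Let K := 11 * G ^+ 3.
Let GK : G <= K.
Proof.
have : G <= G ^+ 3 by rewrite ler_eXnr.
by rewrite /K; move: G30; lra.
Qed.
Let P2b : P2 <= c * om ^+ 2 - rho / r1 * be * (V ^+ 2 / s) + 60 * K ^+ 6 * h * bb ^+ 2.
Proof.
have G23 : G ^+ 2 <= G ^+ 3 by rewrite ler_weXn2l.
have GhK1 : G * h ^+ 2 <= K * h ^+ 2 by rewrite ler_wpM2r ?sqr_ge0.
apply: (@second_jet_error_le R K h s s0 be bh V V1 om dq bb P2 rho) => //.
- by move: GK G1; lra.
- by move: s32; lra.
- exact: le_trans r1G GK.
- by move: be1; lra.
- by apply: le_trans beG _; rewrite /K; move: G23 G30; lra.
- by apply: le_trans Vb _; rewrite ler_wpM2r // /K; move: GG2 G23 G12; lra.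
- exact: le_trans hbh GhK1.
- exact: le_trans hs0 GhK1.
- by apply: le_trans hVb _; rewrite ler_wpM2r.
- move=> u; apply: le_trans (P2le u) _; rewrite lerD2l.
  apply: ler_pM => //; exact: sqr_ge0.
Qed.

(** [jensen_sq] controls the square of [oms] only after division by [f + be * s]; as this number is
    at most [1 + G * h ^+ 2], the division costs an error of order [h ^+ 2]. *)
Let om2b : c * om ^+ 2 <= c * (oms ^+ 2 / (f + be * s)) + 200 * G ^+ 7 * h ^+ 2 * bb ^+ 2.
Proof.
have r0 : 0 < rho by move: rho1; lra.
have cc0 : 0 <= c by rewrite /c divr_ge0 ?(ltW r0) // subr_ge0.
have cc1 : c <= 1 by rewrite /c ler_pdivrMr //; lra.
have p0 : 0 < f + be * s by move: fbs; lra.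
have G67 : G ^+ 6 <= G ^+ 7 by rewrite ler_weXn2l.
have hb0 : 0 <= h ^+ 2 * bb ^+ 2 by apply: mulr_ge0; apply: sqr_ge0.
have q1 : om ^+ 2 - oms ^+ 2 <= 57 * G ^+ 6 * (h ^+ 2 * bb ^+ 2).
  apply: le_trans (ler_norm _) _.
  have -> : om ^+ 2 - oms ^+ 2 = (om - oms) * (om + oms) by ring.
  apply: le_trans (normM_le domb (normD_le omb omsb)) _.
  by rewrite le_eqVlt; apply/orP; left; apply/eqP; ring.
have q2 : oms ^+ 2 - oms ^+ 2 / (f + be * s) <= 128 * G ^+ 7 * (h ^+ 2 * bb ^+ 2).
  have -> : oms ^+ 2 - oms ^+ 2 / (f + be * s)
     = oms ^+ 2 * ((f + be * s - 1) / (f + be * s)) by field; rewrite gt_eqF.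
  have -> : 128 * G ^+ 7 * (h ^+ 2 * bb ^+ 2)
     = (8 * G ^+ 3 * bb) ^+ 2 * (2 * (G * h ^+ 2)) by ring.
  apply: le_trans (_ : oms ^+ 2 * (2 * (G * h ^+ 2)) <= _).
    rewrite ler_wpM2l ?sqr_ge0 // ler_pdivrMr //.
    have := ler_wpM2l hG fbs; move: fbs1; lra.
  by apply: ler_wpM2r; [apply: mulr_ge0 | apply: sq_norm_le].
have q3 := ler_wpM2l cc0 (lerD q1 q2).
have q4 : c * (57 * G ^+ 6 * (h ^+ 2 * bb ^+ 2) + 128 * G ^+ 7 * (h ^+ 2 * bb ^+ 2))
  <= 185 * G ^+ 7 * (h ^+ 2 * bb ^+ 2).
  apply: le_trans (_ : 1 * (57 * G ^+ 6 * (h ^+ 2 * bb ^+ 2)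
       + 128 * G ^+ 7 * (h ^+ 2 * bb ^+ 2)) <= _).
    apply: ler_pM => //; first by apply: addr_ge0; apply: mulr_ge0 => //; rewrite mulr_ge0 // exprn_ge0.
  have := ler_wpM2r hb0 G67; lra.
have q5 : 0 <= G ^+ 7 * (h ^+ 2 * bb ^+ 2) by rewrite mulr_ge0 // exprn_ge0.
have -> : 200 * G ^+ 7 * h ^+ 2 * bb ^+ 2 = 200 * (G ^+ 7 * (h ^+ 2 * bb ^+ 2)) by ring.
rewrite -mulrA in q4; lra.
Qed.

Let Q1 := - (\sum_(b in B) \sum_(b' in B :\ b) Pbc b b' * t b * t b')
   - 2 * \sum_(b in B) t b * P1b b.

(** Replacing [P1] by [P1s] cancels the mixed terms [U * Z] and reverses the sign of [Z ^+ 2].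
    Together with [2 * (f * sg ^+ 2)] this produces [f * ((Z - sg) ^+ 2 + sg ^+ 2 + W)] as in
    [reduced_quadratic_le]. *)
Let Q1b : f * (Z ^+ 2 + W) + 2 * s * X - 2 * Z * (f * sg) + 2 * U * V
   - 9 * G ^+ 3 * h ^+ 2 * bb ^+ 2 <= Q1.
Proof.
pose dd b b' := Pbc b b' - (f + (x b + x b') * s).
pose d1 b := P1b b - (P1 - x b * V1).
have e1 : \sum_(b in B) \sum_(b' in B :\ b) Pbc b b' * t b * t b'
   = f * (Z ^+ 2 - W) + 2 * s * (U * Z - X)
     + \sum_(b in B) t b * \sum_(b' in B :\ b) t b' * dd b b'.
  transitivity (\sum_(b in B) (f * (t b * (Z - t b))
      + s * (x b * t b * (Z - t b)) + s * (t b * (U - x b * t b))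
      + t b * \sum_(b' in B :\ b) t b' * dd b b')).
    apply: eq_bigr => b bB.
    have -> : Z - t b = \sum_(b' in B :\ b) t b'.
      by rewrite /Z (big_setD1 b bB) /= [LHS]addrC addKr.
    have -> : U - x b * t b = \sum_(b' in B :\ b) x b' * t b'.
      by rewrite /U (big_setD1 b bB) /= [LHS]addrC addKr.
    rewrite !mulr_sumr -!big_split /=; apply: eq_bigr => b' _.
    rewrite /dd; ring.
  rewrite !big_split /= -!mulr_sumr.
  have -> : \sum_(b in B) t b * (Z - t b) = Z ^+ 2 - W.
    have -> : Z ^+ 2 = \sum_(b in B) t b * Z by rewrite -mulr_suml expr2.
    rewrite /W -sumrB; apply: eq_bigr => b _; ring.
  have -> : \sum_(b in B) x b * t b * (Z - t b) = U * Z - X.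
    have -> : U * Z = \sum_(b in B) x b * t b * Z by rewrite -mulr_suml.
    rewrite /X -sumrB; apply: eq_bigr => b _; ring.
  have -> : \sum_(b in B) t b * (U - x b * t b) = U * Z - X.
    have -> : U * Z = \sum_(b in B) t b * U by rewrite -mulr_suml mulrC.
    rewrite /X -sumrB; apply: eq_bigr => b _; ring.
  ring.
have e2 : \sum_(b in B) t b * P1b b = Z * P1 - U * V1 + \sum_(b in B) t b * d1 b.
  rewrite /Z /U !mulr_suml -sumrB -big_split; apply: eq_bigr => b _ /=.
  rewrite /d1; ring.
have hb0 : 0 <= h ^+ 2 * bb ^+ 2 by apply: mulr_ge0; apply: sqr_ge0.
have b1 : `|\sum_(b in B) t b * \sum_(b' in B :\ b) t b' * dd b b'|
   <= G ^+ 3 * (h ^+ 2 * bb ^+ 2).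
  apply: le_trans (dPs (_ : forall b, b \in B -> `|_| <= G * (bb * (G * h ^+ 2)))) _.
    move=> b bB; apply: norm_sum_le; last 1 first.
    - move=> b' b'B; apply: normM_le; last exact: hPbc.
      by apply: tb; move: b'B; rewrite inE => /andP[].
    - by apply: le_trans BG; rewrite ler_nat subset_leq_card // subsetDl.
    by rewrite mulr_ge0.
  by rewrite le_eqVlt; apply/orP; left; apply/eqP; ring.
have b2 : `|\sum_(b in B) t b * d1 b| <= G ^+ 2 * (h ^+ 2 * bb ^+ 2).
  apply: le_trans (dPs (_ : forall b, b \in B -> `|_| <= G * h ^+ 2 * bb)) _.
    by move=> b bB; apply: le_trans (hP1b bB) _; rewrite ler_wpM2l.
  by rewrite le_eqVlt; apply/orP; left; apply/eqP; ring.
have b3 : `|Z * (P1 - P1s)| <= G ^+ 3 * (h ^+ 2 * bb ^+ 2).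
  apply: le_trans (normM_le Zb dP1) _.
  by rewrite le_eqVlt; apply/orP; left; apply/eqP; ring.
have b4 : `|U * (V1 - V)| <= G ^+ 3 * (h ^+ 2 * bb ^+ 2).
  apply: le_trans (normM_le Ub hVb) _.
  by rewrite le_eqVlt; apply/orP; left; apply/eqP; ring.
have n1 := ler_norm (\sum_(b in B) t b * \sum_(b' in B :\ b) t b' * dd b b').
have n2 := ler_norm (\sum_(b in B) t b * d1 b).
have n3 := ler_norm (Z * (P1 - P1s)).
have n4 := ler_norm (- (U * (V1 - V))); rewrite normrN in n4.
have GG : G ^+ 2 * (h ^+ 2 * bb ^+ 2) <= G ^+ 3 * (h ^+ 2 * bb ^+ 2).
  by rewrite ler_wpM2r // ler_weXn2l.
have g3 : 0 <= G ^+ 3 * (h ^+ 2 * bb ^+ 2) by rewrite mulr_ge0.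
have -> : Q1 = f * (Z ^+ 2 + W) + 2 * s * X - 2 * Z * (f * sg) + 2 * U * V
  - \sum_(b in B) t b * \sum_(b' in B :\ b) t b' * dd b b'
  - 2 * \sum_(b in B) t b * d1 b - 2 * (Z * (P1 - P1s)) + 2 * (U * (V1 - V)).
  rewrite /Q1 e1 e2 /P1s; ring.
have -> : 9 * G ^+ 3 * h ^+ 2 * bb ^+ 2 = 9 * (G ^+ 3 * (h ^+ 2 * bb ^+ 2)) by ring.
lra.
Qed.

Let XW : W <= X.
Proof.
apply: ler_sum => b bB; have [->|x1] := tx bB; first by rewrite expr0n /= mulr0.
by rewrite ler_peMl // sqr_ge0.
Qed.

(** Of the diagonal term [2 * dq ^+ 2], the share 3/2 pays for [V ^+ 2 / (r1 * s)], whence the 3/2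
    in [reduced_quadratic_le]. The remaining 1/2 covers [c0 * dq ^+ 2] and completes the reserve to
    a multiple of [bb ^+ 2], which absorbs all errors, the loss [G * h * dq ^+ 2] included. *)
Lemma gap_quadratic_le : (60 * K ^+ 6 + 300 * G ^+ 7) * h <= c0 / (2 * G ^+ 2) ->
  (1 + ga) * Pb o * t o ^+ 2 <= Q1 - P2 + 2 * (f * sg ^+ 2) + (2 - G * h) * dq ^+ 2.
Proof.
move=> hC; have r0 : 0 < rho by move: rho1; lra.
have r10 : 0 < r1 by rewrite /r1; lra.
have k0 : 0 < k by rewrite /k; have := ler0n R #|B|; lra.
have N2 : 2 <= N%:R :> R by have := cardB_ge1 R oB; move: BN rho1; lra.
have NL10 : 20 <= 10 * N%:R * L.
  have : N%:R <= N%:R * L by rewrite ler_peMr.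
  move: N2; lra.
have c00 : 0 < c0 by rewrite /c0 invr_gt0; lra.
have c01 : c0 <= 1 / 2.
  rewrite /c0 div1r lef_pV2 ?posrE //; lra.
have M := reduced_quadratic_le t oB xo x0 xL L1 rho1 BN sg V f0 sp.
rewrite -/be -/Z -/U -/W -/X -/k -/c0 -/c in M.
have omsE : f * (sg - Z) - s * U - be * V = oms by rewrite /oms /P1s; ring.
rewrite omsE in M.
have cVs : (rho * be + 3 / 2) / (rho + 1) * (V ^+ 2 / s)
   = rho / r1 * be * (V ^+ 2 / s) + 3 / 2 * (V ^+ 2 / (r1 * s)).
  by rewrite /r1; field; rewrite !gt_eqF.
rewrite cVs in M.
have dV : V ^+ 2 / (r1 * s) <= dq ^+ 2.
  by rewrite ler_pdivrMr ?mulr_gt0 // mulrC.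
set bh2 := h * bb ^+ 2.
have bh20 : 0 <= bh2 by rewrite /bh2 mulr_ge0 ?sqr_ge0 // ltW.
have hb2 : h ^+ 2 * bb ^+ 2 <= bh2 by rewrite ler_wpM2r ?sqr_ge0.
have po : `|Pb o - (f + s)| <= G * h ^+ 2 by have := hPb oB; rewrite xo mul1r.
have to2 : t o ^+ 2 <= bb ^+ 2 by apply: sq_norm_le; apply: tb.
have e8 : (1 + ga) * Pb o * t o ^+ 2
   <= (1 + (10 * k)^-1) * (f + s) * t o ^+ 2 + 2 * (G * h ^+ 2 * bb ^+ 2).
  have k1 : (10 * k)^-1 <= 1.
    rewrite invf_le1 ?mulr_gt0 //; have := cardB_ge1 R oB; rewrite /k; lra.
  have q1 : (1 + (10 * k)^-1) * `|Pb o - (f + s)| * t o ^+ 2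
     <= 2 * (G * h ^+ 2) * bb ^+ 2.
    have kp : 0 <= 1 + (10 * k)^-1 by rewrite addr_ge0 // invr_ge0 mulr_ge0 // ltW.
    apply: ler_pM => //; [exact: mulr_ge0 | exact: sqr_ge0 |].
    by apply: ler_pM => //; move: k1; lra.
  have Po0 : (1 + ga) * Pb o * t o ^+ 2 <= (1 + (10 * k)^-1) * (f + s) * t o ^+ 2
     + (1 + (10 * k)^-1) * `|Pb o - (f + s)| * t o ^+ 2.
    rewrite -mulrDl ler_wpM2r ?sqr_ge0 // -mulrDr.
    have q2 := ler_norm (Pb o - (f + s)).
    apply: le_trans (_ : (1 + ga) * (f + s + `|Pb o - (f + s)|) <= _).
      by rewrite ler_wpM2l //; move: ga0; lra.
    rewrite ler_wpM2r ?lerD2l //; apply: addr_ge0 => //.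
    by apply: addr_ge0; apply: ltW.
  lra.
have G0' : 0 < G by move: G1; lra.
have e1 := P2b; have e2 := om2b; have e3 := Q1b.
have G13 : G ^+ 3 <= G ^+ 7 by rewrite ler_weXn2l.
have G17 : G <= G ^+ 7 by rewrite ler_eXnr.
have G70 : 0 <= G ^+ 7 by rewrite exprn_ge0.
have hb20 : 0 <= h ^+ 2 * bb ^+ 2 by apply: mulr_ge0; apply: sqr_ge0.
have E3 : 9 * G ^+ 3 * h ^+ 2 * bb ^+ 2 <= 9 * (G ^+ 7 * bh2).
  have -> : 9 * G ^+ 3 * h ^+ 2 * bb ^+ 2 = 9 * (G ^+ 3 * (h ^+ 2 * bb ^+ 2)) by ring.
  by rewrite ler_pM2l //; apply: ler_pM.
have E2 : 200 * G ^+ 7 * h ^+ 2 * bb ^+ 2 <= 200 * (G ^+ 7 * bh2).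
  have -> : 200 * G ^+ 7 * h ^+ 2 * bb ^+ 2 = 200 * (G ^+ 7 * (h ^+ 2 * bb ^+ 2)) by ring.
  by rewrite ler_pM2l // ler_wpM2l.
have E8 : G * h ^+ 2 * bb ^+ 2 <= G ^+ 7 * bh2 by rewrite -mulrA; apply: ler_pM.
have E9 : G * h * dq ^+ 2 <= G ^+ 7 * bh2.
  rewrite -mulrA /bh2; apply: ler_pM => //.
    by apply: mulr_ge0; [apply: ltW | apply: sqr_ge0].
  by rewrite ler_pM2l.
have E1 : 60 * K ^+ 6 * h * bb ^+ 2 = 60 * (K ^+ 6 * bh2) by rewrite /bh2; ring.
(* The weights of [W] and [X] may be small separately, but [W <= X] and [f + s] is at least
   [(f + be * s) / G ^+ 2], hence at least 1/(2 G^2). *)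
have fsW : bb ^+ 2 / (2 * G ^+ 2) <= f * sg ^+ 2 + f * W + s * X + dq ^+ 2.
  have G2p : 0 < G ^+ 2 by rewrite exprn_gt0.
  rewrite ler_pdivrMr ?mulr_gt0 // bbE.
  have sX := ler_wpM2l (ltW sp) XW.
  have w1 : W <= (f + s) * W * (2 * G ^+ 2).
    rewrite -mulrA [W * _]mulrC mulrA ler_peMl //.
    have : f + be * s <= (f + s) * G ^+ 2.
      rewrite mulrDl lerD //; first by rewrite ler_peMr // ltW.
      by rewrite mulrC ler_wpM2l // ltW.
    by move: fbs; lra.
  have w2 : f * sg ^+ 2 <= f * sg ^+ 2 * (2 * G ^+ 2).
    by rewrite ler_peMr //; move: G12; lra.
  have w3 : dq ^+ 2 <= dq ^+ 2 * (2 * G ^+ 2).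
    by rewrite ler_peMr ?sqr_ge0 //; move: G12; lra.
  have w4 := ler_wpM2r (_ : 0 <= 2 * G ^+ 2) sX.
  have {}w4 := w4 (ltW (mulr_gt0 (ltr0Sn _ 1) G2p)); lra.
have fsW' := ler_wpM2l (ltW c00) fsW.
have hCb := ler_wpM2r (sqr_ge0 bb) hC.
have hC' : 60 * (K ^+ 6 * bh2) + 300 * (G ^+ 7 * bh2)
   <= c0 * (f * sg ^+ 2 + f * W + s * X) + c0 * dq ^+ 2.
  rewrite -mulrDr; apply: le_trans fsW'.
  have -> : c0 * (bb ^+ 2 / (2 * G ^+ 2)) = c0 / (2 * G ^+ 2) * bb ^+ 2 by ring.
  by apply: le_trans hCb; rewrite /bh2 le_eqVlt; apply/orP; left; apply/eqP; ring.
have c0d : c0 * dq ^+ 2 <= 1 / 2 * dq ^+ 2 by rewrite ler_wpM2r ?sqr_ge0.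
have G7b : 0 <= G ^+ 7 * bh2 by rewrite mulr_ge0.
have K6b : 0 <= K ^+ 6 * bh2 by rewrite mulr_ge0 // exprn_ge0 // (le_trans G0).
rewrite E1 in e1; rewrite [c * (oms ^+ 2 / _)]mulrC in e2.
move: M e1 e2 e3 e8 E3 E2 E8 E9 hC' c0d dV G7b K6b.
set A1 := (1 + (10 * k)^-1) * (f + s) * t o ^+ 2.
set A2 := (1 + ga) * Pb o * t o ^+ 2.
set A3 := G ^+ 7 * bh2; set A4 := K ^+ 6 * bh2.
set A5 := rho / r1 * be * (V ^+ 2 / s); set A6 := V ^+ 2 / (r1 * s).
rewrite [c * (oms ^+ 2 / _)]mulrC; set A7 := oms ^+ 2 / _ * c.
set A8 := c * om ^+ 2; set A9 := c0 * dq ^+ 2; set A10 := c0 * (_ + _ + _).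
set A11 := G * h * dq ^+ 2; set A12 := G * h ^+ 2 * bb ^+ 2.
set A13 := 200 * _ * _ * _; set A14 := 9 * _ * _ * _.
move=> M e1 e2 e3 e8 E3 E2 E8 E9 hC' c0d dV G7b K6b.
rewrite mulrBl -/A11; lra.
Qed.

End Core.

(** * Splitting large and small entries *)

Section Pencil.
Variables (R : realFieldType) (I : finType) (v w : I -> R) (S : {set I}) (r : nat).
Hypothesis g : gard S r.+1 v.
Local Notation jet := (jet v w).
Let e := elsym S r.+1 v.
Let q := elsym S r.+2 v / e.

(** Write sigma_(r+1) + bh sigma_(r+2) as sigma_(r+1) (1 + bh q). In its second derivative, the term
    with sigma_(r+1)'' is bounded by [elsym_jet2_le], which requires 1 + bh q >= 0. The term with
    q'' is bounded by the squares of [qjet2_sum], tested against [v] with parameter [u]; these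
    squares supply the negative term in V^2 / s of [second_jet_error_le]. *)
Lemma jet2_pencil (bh u : R) : 0 <= bh -> 0 <= 1 + bh * q ->
  2 * (jet 2 S r.+1 + bh * jet 2 S r.+2) / e
  <= (1 + bh * q) * (r%:R / r.+1%:R) * (jet 1 S r.+1 / e) ^+ 2
   + 2 * bh * (jet 1 S r.+2 / e - q * (jet 1 S r.+1 / e)) * (jet 1 S r.+1 / e)
   - 2 * bh / r.+2%:R
     * (2 * u * (r.+1%:R * (jet 1 S r.+2 / e) - r.+2%:R * q * (jet 1 S r.+1 / e))
        - u ^+ 2 * (Qs S v r / e)).
Proof.
move=> bh0 psi0; have e0 : 0 < e by apply: g.
have s1 := elsym_jet2_le w g.
have s2 := qjet2_sum w g.
have s3 := qjet2_lin w g.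
rewrite -/e -/q in s1 s2 s3.
set z := fun i => w i - v i * (jet 1 S r.+1 / e
                     - jet 1 (S :\ i) r / elsym (S :\ i) r v) in s2 s3.
set A := r.+1%:R * (jet 1 S r.+2 / e) - r.+2%:R * q * (jet 1 S r.+1 / e).
have s4 : 2 * u * (A * e) - u ^+ 2 * Qs S v r
    <= - (r.+2%:R * e * qjet2 v w S r.+1).
  apply: le_trans s2; rewrite -subr_ge0.
  have Ae : A * e = - \sum_(i in S) elsym (S :\ i) r v * v i * z i.
    by rewrite s3 /A; set n := r.+2%:R; field; rewrite gt_eqF.
  rewrite Ae /Qs mulrN mulr_sumr opprD opprK mulr_sumr opprK.
  rewrite -!big_split /=; apply: sumr_ge0 => i iS.
  have d0 : 0 < elsym (S :\ i) r v by apply: (gardD1 iS g).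
  have -> : elsym (S :\ i) r v * z i ^+ 2
    + (2 * u * (elsym (S :\ i) r v * v i * z i)
       + u ^+ 2 * (v i ^+ 2 * elsym (S :\ i) r v))
    = elsym (S :\ i) r v * (z i + u * v i) ^+ 2 by ring.
  by rewrite mulr_ge0 ?sqr_ge0 // ltW.
have H2 : jet 2 S r.+2 = qjet2 v w S r.+1 * e
   + (jet 1 S r.+2 / e - q * (jet 1 S r.+1 / e)) * jet 1 S r.+1
   + q * jet 2 S r.+1.
  rewrite /qjet2 /quo2 /quo1 /quo0 !jet0E -/e /q; field; rewrite gt_eqF //.
have s1' : 2 * jet 2 S r.+1 / e <= r%:R / r.+1%:R * (jet 1 S r.+1 / e) ^+ 2.
  have r0 : 0 < r.+1%:R :> R by rewrite ltr0n.
  have -> : r%:R / r.+1%:R * (jet 1 S r.+1 / e) ^+ 2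
    = r%:R * jet 1 S r.+1 ^+ 2 / (r.+1%:R * e) / e.
    by field; rewrite nat1r !gt_eqF.
  rewrite ler_pM2r ?invr_gt0 // ler_pdivlMr ?mulr_gt0 //.
  by apply: le_trans s1; rewrite le_eqVlt; apply/orP; left; apply/eqP; ring.
have r2 : 0 < r.+2%:R :> R by rewrite ltr0n.
have s4' : 2 * u * A - u ^+ 2 * (Qs S v r / e) <= - (r.+2%:R * qjet2 v w S r.+1).
  rewrite -(ler_pM2r e0).
  have -> : (2 * u * A - u ^+ 2 * (Qs S v r / e)) * e
    = 2 * u * (A * e) - u ^+ 2 * Qs S v r by field; rewrite gt_eqF.
  by apply: le_trans s4 _; rewrite le_eqVlt; apply/orP; left; apply/eqP; ring.
have s5 := ler_wpM2l psi0 s1'.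
have b2 : 0 <= 2 * bh / r.+2%:R by rewrite divr_ge0 ?mulr_ge0.
have s6 := ler_wpM2l b2 s4'.
have -> : 2 * (jet 2 S r.+1 + bh * jet 2 S r.+2) / e
  = (1 + bh * q) * (2 * jet 2 S r.+1 / e)
    + 2 * bh * (jet 1 S r.+2 / e - q * (jet 1 S r.+1 / e)) * (jet 1 S r.+1 / e)
    - 2 * bh / r.+2%:R * - (r.+2%:R * qjet2 v w S r.+1).
  by rewrite H2; move: (r.+2%:R : R) r2 => n n0; field; rewrite !gt_eqF.
by rewrite lerB // lerD2r -[leRHS]mulrA.
Qed.

End Pencil.

(** On A, sigma of complementary degree in [y] is the full product times sigma_j of the inverses, so
    this is the product of two generating polynomials. The inverses enter through [x b * y b = 1],
    so that the identity also holds in [{poly R}], where [jet_split] applies it with constant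
    entries on A. *)
Lemma elsym_split (R : comNzRingType) (I : finType) (A T : {set I}) (x y : I -> R)
    (p M : nat) :
  [disjoint A & T] -> (forall b, b \in A -> x b * y b = 1) -> (#|A| < M)%N ->
  elsym (A :|: T) (p + #|A|) y
  = (\prod_(b in A) y b) * \sum_(j < M) elsym A j x * elsym T (p + j) y.
Proof.
elim/set_ind: A p => A IH p dAT xy AM.
have [A0|[b bA]] := set_0Vmem A.
  rewrite A0 cards0 set0U addn0 big_set0 mul1r.
  case: M AM {IH} => // M _; rewrite big_ord_recl big1 ?addr0 => [|j _].
    by rewrite elsym0 mul1r addn0.
  by rewrite elsym_set0 mul0r.
have bT : b \notin T by apply: contraTN bA => bT; rewrite (disjointFl dAT).
have cA : #|A| = #|A :\ b|.+1 by rewrite (cardsD1 b A) bA.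
have dAT' : [disjoint A :\ b & T] by apply: disjointWl dAT; apply: subsetDl.
have xy' c : c \in A :\ b -> x c * y c = 1 by rewrite inE => /andP[_]; apply: xy.
have AM' : (#|A :\ b| < M)%N by rewrite ltnW // -cA.
have bAT : b \in A :|: T by rewrite inE bA.
have E : (A :|: T) :\ b = A :\ b :|: T.
  by apply/setP => c; rewrite !inE; case: eqVneq => [->|]; rewrite ?(negPf bT).
rewrite cA addnS (elsymS _ _ bAT) E -addSn (IH b bA p) // (IH b bA p.+1) //.
rewrite (big_setD1 b bA) /= -mulrA mulrCA -mulrDr [RHS]mulrCA; congr (_ * _).
case: M AM AM' {IH} => // M AM AM'.
rewrite [X in _ + X]big_ord_recr /= (@elsym_gt _ _ (A :\ b) M) ?mul0r ?addr0; last first.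
  by move: AM; rewrite cA.
rewrite [in RHS]big_ord_recl !mulrDr elsym0 mul1r.
rewrite [in LHS]big_ord_recl mulrDr elsym0 mul1r.
rewrite -addrA; congr (_ + _).
rewrite !mulr_sumr -big_split; apply: eq_bigr => j _ /=.
rewrite (elsymS _ _ bA) addSn addnS.
have -> : bump 0 j = j.+1 by [].
have -> : y b * ((x b * elsym (A :\ b) j x + elsym (A :\ b) j.+1 x)
    * elsym T (p + j).+1 y)
  = (x b * y b) * (elsym (A :\ b) j x * elsym T (p + j).+1 y)
    + y b * (elsym (A :\ b) j.+1 x * elsym T (p + j).+1 y) by ring.
by rewrite xy // mul1r addrC.
Qed.

Lemma jet_split (R : comNzRingType) (I : finType) (A T : {set I})
    (v w x : I -> R) (p M m : nat) :
  [disjoint A & T] -> (forall b, b \in A -> x b * v b = 1) ->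
  (forall b, b \in A -> w b = 0) -> (#|A| < M)%N ->
  jet v w m (A :|: T) (p + #|A|)
  = (\prod_(b in A) v b) * \sum_(j < M) elsym A j x * jet v w m T (p + j).
Proof.
move=> dAT xv w0 AM; rewrite /jet (@elsym_split _ _ _ _ (polyC \o x) _ _ M) //.
  have -> : \prod_(b in A) line v w b = (\prod_(b in A) v b)%:P.
    rewrite rmorph_prod; apply: eq_bigr => b bA.
    by rewrite /line w0 // scale0r addr0.
  rewrite coefCM coef_sum; congr (_ * _); apply: eq_bigr => j _.
  by rewrite -raddf_elsym coefCM.
by move=> b bA; rewrite /line w0 // scale0r addr0 /= -polyCM xv.
Qed.

Section Bigs.
Variables (R : realFieldType) (I : finType).

Lemma elsym_bounds (A : {set I}) (x : I -> R) (L : R) j : 0 <= L ->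
  (forall i, i \in A -> 0 < x i <= L) ->
  0 <= elsym A j x <= (1 + L) ^+ #|A|.
Proof.
move=> L0; elim/set_ind: A j => A IH j xL.
have L1 : 1 <= 1 + L by rewrite lerDl.
have [->|[i iA]] := set_0Vmem A.
  by case: j => [|j]; rewrite ?elsym0 ?elsym_set0 cards0 expr0 ?lexx ?ler01.
case: j => [|j]; first by rewrite elsym0 ler01 exprn_ege1.
have xL' k : k \in A :\ i -> 0 < x k <= L by rewrite inE => /andP[_]; apply: xL.
have /andP[a0 a1] := IH i iA j xL'; have /andP[b0 b1] := IH i iA j.+1 xL'.
have /andP[x0 x1] := xL i iA.
rewrite (elsymS _ _ iA) (cardsD1 i A) iA add1n exprS mulrDl mul1r.
rewrite addr_ge0 //= ?mulr_ge0 ?(ltW x0) // addrC lerD //.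
by apply: ler_pM => //; apply: ltW.
Qed.

Lemma tail_le (A : {set I}) (x : I -> R) (L Xs c : R) (N : nat) (F : nat -> R) :
  0 <= L -> (forall i, i \in A -> 0 < x i <= L) -> (1 + L) ^+ #|A| <= Xs -> 0 <= c ->
  (forall p, (p <= N + 2)%N -> `|F p.+2| <= c) ->
  `|\sum_(j < N.+2) elsym A j x * F j - (F 0%N + (\sum_(i in A) x i) * F 1%N)|
  <= N%:R * (Xs * c).
Proof.
move=> L0 xL hXs c0 Fc; rewrite 2!big_ord_recl /= elsym0 mul1r.
rewrite /bump /= addn0 elsym1.
have -> : forall a b d : R, a + (b + d) - (a + b) = d by move=> *; ring.
apply: le_trans (ler_norm_sum _ _ _) _.
apply: le_trans (_ : \sum_(j < N) Xs * c <= _); last first.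
  by rewrite sumr_const card_ord mulr_natl.
apply: ler_sum => j _; rewrite normrM; apply: ler_pM => //.
  have /andP[a0 a1] := elsym_bounds (1 + (1 + j)) L0 xL.
  by rewrite ger0_norm //; apply: le_trans a1 hXs.
by apply: Fc; apply: leq_trans (ltnW (ltn_ord j)) (leq_addr _ _).
Qed.

End Bigs.

Section Gap.
Variables (R : rcfType) (I : finType) (mu xi : I -> R) (B : {set I}) (o : I).
Variables (N r k : nat) (L G h K Xs kap ga : R).
Let S := ~: B.
Let n := N%:R : R.
Let x i := (mu i)^-1.
Let t i := xi i / mu i.
Let w i := if i \in S then xi i else 0.
(** Two square roots of [eta] are needed: [h ^+ 2] is the size of the direction entries on S and the
    lower bound for [s], and [h] is what remains after dividing by a square root of [s]. *)
Let eta := h ^+ 4.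
Hypotheses (IN : (#|I| <= N)%N) (oB : o \in B) (muo : mu o = 1).
Hypothesis mu0 : forall b, b \in B -> 0 < mu b.
Hypothesis muL : forall b, b \in B -> x b <= L.
Hypothesis mu1 : forall b, b \in B -> xi b = 0 \/ mu b <= 1.
Hypothesis muS : forall i, i \notin B -> `|mu i| <= eta.
(** The degree is [k.+2]. The number r of the overview is [r.+1] here, and it is the [rho] of the
    previous part. *)
Hypotheses (kE : (#|B| + r = k.+1)%N) (kN : (k.+2 <= N)%N).
Hypothesis g : gard [set: I] k.+2 mu.
Hypotheses (L1 : 1 <= L) (G1 : 1 <= G) (LG : L <= G) (nG : n <= G).
Hypothesis Kle : forall p, (p <= N + 5)%N -> 3 * (4 * N + 2)%:R ^+ p <= K.
Hypothesis XsE : Xs = (1 + L) ^+ N.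
Let g2 := n * (Xs * K).
Let g6 := 2 * (n * L) * g2.
(** From here to [G8], in order: the lower bounds on [G] for [hf], for [hPb] and [hPbc], for [hP1]
    and [hP1b], and for [hV], [hbh], [P2le] and [diag]. *)
Hypotheses (G1' : n * L * (1 + n) + g2 <= G) (G3 : 2 * g2 + 2 * L * (1 + n) <= G).
Hypothesis G4 : 2 * (n * (Xs * (n * (K * (12 * N + 9)%:R)))) <= G.
Hypothesis G5 : n * (n + 1) <= G.
Hypothesis G6 : g6 <= G.
Hypothesis G7 : g6 * (n * (n * (K + n))) + n * (Xs * (n * (n * (2 * (K + n))))) <= G.
Hypothesis G8 : 2 * (2 + (n + 1) * (Xs * K)) <= G.
Hypotheses (h0 : 0 < h) (h1 : h <= 1) (Gh : G * h ^+ 2 <= 1 / 2).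
Hypothesis hC : (60 * (11 * G ^+ 3) ^+ 6 + 300 * G ^+ 7) * h
  <= (10 * n * L)^-1 / (2 * G ^+ 2).
Hypotheses (kap1 : 1 - 2 * eta <= kap).
Hypotheses (ga0 : 0 <= ga) (gak : ga <= (10 * k.+2%:R)^-1).

Let v := mu.
Let e := elsym S r.+1 v.
Let d i := elsym (S :\ i) r v.
Let be := \sum_(b in B) x b.
Local Notation jt := (jet v w).
Let u := h ^+ 2.
Let Q := Qs S v r.
Let r1 := r.+2%:R : R.

Let x0 b : b \in B -> 0 < x b. Proof. by move=> bB; rewrite invr_gt0 mu0. Qed.
Let xo : x o = 1. Proof. by rewrite /x muo invr1. Qed.
Let L0 : 0 <= L. Proof. by move: L1; lra. Qed.
Let eta0 : 0 <= eta. Proof. by rewrite exprn_ge0 // ltW. Qed.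
Let u0 : 0 <= u. Proof. exact: sqr_ge0. Qed.
Let u1 : u <= 1. Proof. by rewrite expr_le1 // ltW. Qed.
Let etaE : eta = u ^+ 2. Proof. by rewrite /u -exprM. Qed.
Let etau : eta <= u. Proof. by rewrite etaE expr2 ler_piMl. Qed.
Let Gu : G * u <= 1 / 2 := Gh.
Let eta12 : eta <= 1 / 2.
Proof.
apply: le_trans etau _; apply: le_trans Gu.
by rewrite ler_peMl.
Qed.
Let S_N : (#|S| <= N)%N. Proof. exact: leq_trans (max_card _) IN. Qed.
Let B_N : (#|B| <= N)%N. Proof. exact: leq_trans (max_card _) IN. Qed.
Let gS : gard S r.+1 v.
Proof.
rewrite /S -setTD; apply: gardD; first exact: subsetT.
by rewrite addnS kE.
Qed.
Let vb i : i \in S -> `|v i| <= eta. Proof. by rewrite inE; apply: muS. Qed.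
Let e0 : 0 < e. Proof. exact: gS. Qed.

Definition Ph m (A : {set I}) := \sum_(j < N.+2) elsym A j x * jt m S (r + j).+1.

Let dis (A : {set I}) : A \subset B -> [disjoint A & S].
Proof. by move=> AB; rewrite disjoints_subset /S setCK. Qed.

Let cardA (A : {set I}) : A \subset B -> (#|A| < N.+2)%N.
Proof. by move=> AB; rewrite ltnS; apply: leqW; apply: leq_trans (subset_leq_card AB) B_N. Qed.

Lemma jet_Ph m (A : {set I}) : A \subset B ->
  jt m (A :|: S) (r.+1 + #|A|) = (\prod_(b in A) mu b) * Ph m A.
Proof.
move=> AB; apply: jet_split (cardA AB); first exact: dis.
  by move=> b /(subsetP AB) bB; rewrite mulVf // gt_eqF // mu0.
by move=> b /(subsetP AB) bB; rewrite /w inE bB.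
Qed.

Let xA (A : {set I}) : A \subset B -> forall i, i \in A -> 0 < x i <= L.
Proof. by move=> AB i /(subsetP AB) iB; rewrite x0 ?muL. Qed.

Let XA (A : {set I}) : A \subset B -> (1 + L) ^+ #|A| <= Xs.
Proof.
move=> AB; rewrite XsE ler_weXn2l // ?lerDl //.
by apply: leq_trans (subset_leq_card AB) B_N.
Qed.

Let PB := \prod_(b in B) mu b.
Let PB0 : 0 < PB. Proof. by apply: prodr_gt0 => b; apply: mu0. Qed.

Let Ph0B : 0 < Ph 0 B.
Proof.
have := jet_Ph 0 (subxx B); rewrite jet0E /S setUCr addSn addnC kE.
by move=> e1; rewrite -(pmulr_rgt0 _ PB0) -e1; apply: g.
Qed.

Let Xs1 : 1 <= Xs. Proof. by rewrite XsE exprn_ege1 // lerDl. Qed.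
Let K1 : 1 <= K. Proof. by have := Kle (leq0n _); rewrite expr0; lra. Qed.
Let n0 : 0 <= n. Proof. by rewrite /n. Qed.
Let g20 : 0 <= g2.
Proof. by apply: mulr_ge0 => //; apply: mulr_ge0; move: Xs1 K1; lra. Qed.
Let be1 : 1 <= be. Proof. exact: (be_ge1 oB). Qed.
Let beNL : be <= n * L.
Proof.
apply: le_trans (_ : \sum_(b in B) L <= _); first exact: ler_sum.
by rewrite sumr_const -[_ *+ #|_|]mulr_natl ler_wpM2r // ler_nat.
Qed.

Local Notation a p := (elsym S (r + p).+1 v).

Let a0E : a 0 = e. Proof. by rewrite addn0. Qed.

(** A positive [a 1] is bounded by [elsymS_le]. For a negative one the cone condition on S is of no
    help, but F > 0 is: up to the tail, 0 < e + be a_1 with [be >= 1]. The tail is estimated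
    relative to [e + |a 1|], so that the argument is not circular. *)
Let a1le : `|a 1| <= 3 * a 0.
Proof.
rewrite a0E addn1; have [a10|a10] := leP 0 (elsym S r.+2 v).
  rewrite ger0_norm //; apply: le_trans (elsymS_le S_N vb eta0 gS) _.
  rewrite -/e ler_wpM2r ?(ltW e0) //.
  apply: le_trans (_ : G * u <= _); last by move: Gu; lra.
  by apply: ler_pM.
pose A0 := e + `|a 1|.
have A00 : a 0 <= A0 by rewrite a0E lerDl.
have A01 : `|a 1| <= A0 by rewrite lerDr ltW.
have A0p : 0 <= A0 by apply: le_trans A01.
have tl : forall p, (p <= N + 2)%N -> `|a p.+2| <= K / 3 * (eta * A0).
  move=> p pN; apply: le_trans (a_bound S_N gS eta0 eta12 vb A00 A01 p) _.
  have : (p.+2 <= N + 5)%N by move: pN; clear; lia.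
  move/Kle; set M := _ ^+ p.+2 => MK.
  have -> : eta * (M * A0) = (3 * M) / 3 * (eta * A0) by field.
  by apply: ler_wpM2r; [exact: mulr_ge0 | rewrite ler_pM2r ?invr_gt0].
have c0 : 0 <= K / 3 * (eta * A0).
  by apply: mulr_ge0; [move: K1; lra | apply: mulr_ge0].
have := @tail_le _ _ _ _ _ _ _ _ (fun p => a p) L0 (xA (subxx B)) (XA (subxx B)) c0 tl.
have -> : \sum_(j < N.+2) elsym B j x * a j = Ph 0 B.
  by apply: eq_bigr => j _; rewrite jet0E.
rewrite -/be a0E => tb.
have {tb} tb : Ph 0 B <= e + be * a 1 + 1 / 12 * A0.
  have := ler_norm (Ph 0 B - (e + be * a 1)) => n1.
  have n2 : N%:R * (Xs * (K / 3 * (eta * A0))) <= 1 / 12 * A0.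
    have -> : N%:R * (Xs * (K / 3 * (eta * A0))) = (2 * g2 * eta) / 6 * A0.
      by rewrite /g2 /n; field.
    rewrite ler_wpM2r //.
    have : 2 * g2 * eta <= G * u.
      apply: ler_pM => //; first by rewrite mulr_ge0.
      apply: le_trans G3; rewrite lerDl.
      by apply: mulr_ge0; [rewrite mulr_ge0 | rewrite addr_ge0].
    by move: Gu; lra.
  lra.
have p0 := Ph0B; rewrite /A0 addn1 ltr0_norm // in tb.
have ba : be * elsym S r.+2 v <= elsym S r.+2 v.
  by rewrite ler_neMl // ltW.
by rewrite ltr0_norm //; move: e0 tb ba p0; lra.
Qed.

Let D := \sum_(i in S) d i * w i ^+ 2.
Let d0 i : i \in S -> 0 < d i. Proof. by move=> iS; apply: (gardD1 iS gS). Qed.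
Let D0 : 0 <= D.
Proof. by apply: sumr_ge0 => i iS; rewrite mulr_ge0 ?sqr_ge0 // ltW // d0. Qed.
Let dq := Num.sqrt (D / e).
Let dq0 : 0 <= dq. Proof. exact: sqrtr_ge0. Qed.
Let dqE : D = a 0 * dq ^+ 2.
Proof. by rewrite a0E sqr_sqrtr ?divr_ge0 ?(ltW e0) // mulrC divfK // gt_eqF. Qed.

Let f := Ph 0 B / e.
Let q := elsym S r.+2 v / e.
Let s0 := - q.
(** By [QsE], [s0] is [Q / (r1 * e)] up to order [eta], and [Q >= 0]. Adding [u = h ^+ 2] allows
    division by [s] at the cost of an error of the size of the others. *)
Let s := Q / (r1 * e) + u.
(** [be] is lowered slightly because F > 0 gives only [1 + be * q >= - (g2 * eta)], whereas
    [jet2_pencil] requires a nonnegative factor, see [psi0]. *)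
Let bh := be - g6 * eta.
Let om := jt 1 S r.+1 / e.
Let V1 := jt 1 S r.+2 / e.
Let V := - (Ys S v w r / e).
Let P1 := Ph 1 B / e.
Let P2 := 2 * Ph 2 B / e.
Let Pb b := Ph 0 (B :\ b) / e.
Let P1b b := Ph 1 (B :\ b) / e.
Let Pbc b c := Ph 0 (B :\ b :\ c) / e.
Let sg := (\sum_(b in B) t b * Pb b + P1) / f.
Let W := \sum_(b in B) t b ^+ 2.
Let bb := Num.sqrt (f * sg ^+ 2 + W + dq ^+ 2).

Let f0 : 0 < f. Proof. by rewrite divr_gt0. Qed.

Let tail0 (A : {set I}) : A \subset B ->
  `|Ph 0 A / e - (1 + (\sum_(b in A) x b) * q)| <= g2 * eta.
Proof.
move=> AB; have Ke0 : 0 <= K * eta * a 0.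
  by apply: mulr_ge0; [apply: mulr_ge0 => //; move: K1; lra | rewrite a0E ltW].
have h2 := @tail_le _ _ _ _ _ _ _ _ (fun p => a p) L0 (xA AB) (XA AB) Ke0
   (a_est S_N gS eta0 eta12 vb a1le Kle).
rewrite -(ler_pM2r e0); have -> : g2 * eta * e = N%:R * (Xs * (K * eta * a 0)).
  by rewrite /g2 /n a0E; ring.
apply: le_trans h2; rewrite -{2}(gtr0_norm e0) -normrM le_eqVlt; apply/orP; left.
apply/eqP; congr (`| _ |); rewrite /q a0E addn1 -/e.
have -> : \sum_(j < N.+2) elsym A j x * a j = Ph 0 A.
  by apply: eq_bigr => j _; rewrite jet0E.
by field; rewrite gt_eqF.
Qed.

Let g2u : g2 * eta <= g2 * u. Proof. by rewrite ler_wpM2l. Qed.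

Let r10 : 0 < r1. Proof. by rewrite /r1 ltr0n. Qed.
Let r11 : 1 <= r1. Proof. by rewrite /r1 ler1n. Qed.

Let ds : `|s0 - s| <= (1 + n) * u.
Proof.
have E1 := elsym1_le S_N vb eta0.
have -> : s0 - s = - (elsym S 1 v / r1) - u.
  by rewrite /s0 /s /Q QsE a0E addn1 -/r1 /q; field; rewrite -natrD !gt_eqF ?ltr0n.
have E1' : `|- (elsym S 1 v / r1)| <= n * u.
  rewrite normrN normrM [X in _ * X]gtr0_norm ?invr_gt0 //.
  rewrite ler_pdivrMr //; apply: le_trans E1 _.
  apply: le_trans (_ : n * u <= _); first by rewrite ler_wpM2l.
  by rewrite ler_peMr // mulr_ge0.
have uu : `|u| <= u by rewrite ger0_norm.
by apply: le_trans (normB_le E1' uu) _; lra.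
Qed.

Let n1 : 0 <= 1 + n. Proof. by rewrite addr_ge0. Qed.

Let hf : `|f - (1 - be * s)| <= G * h ^+ 2.
Proof.
have -> : f - (1 - be * s) = (f - (1 + be * q)) - be * (s0 - s).
  by rewrite /s0; ring.
have beN : `|be| <= n * L by rewrite ger0_norm //; move: be1; lra.
apply: le_trans (normB_le (tail0 (subxx B)) (normM_le beN ds)) _.
apply: le_trans (_ : g2 * u + n * L * ((1 + n) * u) <= _); first by rewrite lerD2r.
by rewrite mulrA -mulrDl ler_wpM2r // addrC.
Qed.

Let xN b : b \in B -> `|x b| <= L. Proof. by move=> bB; rewrite gtr0_norm ?x0 ?muL. Qed.

Let hPb b : b \in B -> `|Pb b - (f + x b * s)| <= G * h ^+ 2.
Proof.
move=> bB; pose T1 := Pb b - (1 + (\sum_(i in B :\ b) x i) * q).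
have -> : Pb b - (f + x b * s) = T1 - (f - (1 + be * q)) + x b * (s0 - s).
  by rewrite /T1 /be (big_setD1 b bB) /= /s0; ring.
apply: le_trans (normD_le (normB_le (tail0 (subsetDl _ _)) (tail0 (subxx B)))
   (normM_le (xN bB) ds)) _.
apply: le_trans (_ : (2 * g2 + 2 * L * (1 + n)) * u <= _); last by rewrite ler_wpM2r.
have : 0 <= L * ((1 + n) * u) by rewrite mulr_ge0 // mulr_ge0.
by move: g2u; lra.
Qed.

Let hPbc b b' : b \in B -> b' \in B :\ b ->
  `|Pbc b b' - (f + (x b + x b') * s)| <= G * h ^+ 2.
Proof.
move=> bB b'B; have b'B' : b' \in B by move: b'B; rewrite inE => /andP[].
pose T1 := Pbc b b' - (1 + (\sum_(i in B :\ b :\ b') x i) * q).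
have -> : Pbc b b' - (f + (x b + x b') * s)
   = T1 - (f - (1 + be * q)) + (x b + x b') * (s0 - s).
  by rewrite /T1 /be (big_setD1 b bB) (big_setD1 b' b'B) /= /s0; ring.
have sub : B :\ b :\ b' \subset B by rewrite setDDl subsetDl.
apply: le_trans (normD_le (normB_le (tail0 sub) (tail0 (subxx B)))
   (normM_le (normD_le (xN bB) (xN b'B')) ds)) _.
apply: le_trans (_ : (2 * g2 + 2 * L * (1 + n)) * u <= _); last by rewrite ler_wpM2r.
by move: g2u; lra.
Qed.

Let c1 := n * (Xs * (n * (K * (12 * N + 9)%:R))).

Let tail1 (A : {set I}) : A \subset B ->
  `|Ph 1 A / e - (om + (\sum_(b in A) x b) * V1)| <= c1 * u * dq.
Proof.
move=> AB; have Ke0 : 0 <= N%:R * (K * ((12 * N + 9)%:R * (u * (a 0 * dq)))).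
  apply: mulr_ge0 => //; apply: mulr_ge0; first by move: K1; lra.
  by apply: mulr_ge0 => //; apply: mulr_ge0 => //; apply: mulr_ge0 => //; rewrite a0E ltW.
have hj p : (p <= N + 2)%N -> `|jt 1 S (r + p.+2).+1|
    <= N%:R * (K * ((12 * N + 9)%:R * (u * (a 0 * dq)))).
  have -> : (r + p.+2).+1 = (r + p).+3 by rewrite !addnS.
  by apply: (jet1_est S_N gS eta0 eta12 vb u0 etaE dq0 dqE a1le Kle).
have h2 := @tail_le _ _ _ _ _ _ _ _ (fun p => jt 1 S (r + p).+1) L0 (xA AB) (XA AB) Ke0 hj.
rewrite -(ler_pM2r e0).
have -> : c1 * u * dq * e = N%:R * (Xs * (N%:R * (K * ((12 * N + 9)%:R * (u * (a 0 * dq)))))).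
  by rewrite /c1 /n a0E; ring.
apply: le_trans h2; rewrite -{2}(gtr0_norm e0) -normrM le_eqVlt; apply/orP; left.
apply/eqP; congr (`| _ |); rewrite /om /V1 !addn0 !addn1 /Ph.
by field; rewrite gt_eqF.
Qed.

Let c10 : 0 <= c1.
Proof.
by rewrite /c1; do 2!apply: mulr_ge0 => //; [move: Xs1; lra |];
   do 2!apply: mulr_ge0 => //; move: K1; lra.
Qed.

Let udq : 0 <= u * dq. Proof. exact: mulr_ge0. Qed.

Let hP1 : `|P1 - (om + be * V1)| <= G * h ^+ 2 * dq.
Proof.
apply: le_trans (tail1 (subxx B)) _.
rewrite -[leLHS]mulrA -[leRHS]mulrA -/u ler_wpM2r //.
by apply: le_trans G4; rewrite -/c1 mulr_natl mulr2n lerDl.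
Qed.

Let hP1b b : b \in B -> `|P1b b - (P1 - x b * V1)| <= G * h ^+ 2 * dq.
Proof.
move=> bB; pose T1 := P1b b - (om + (\sum_(i in B :\ b) x i) * V1).
have -> : P1b b - (P1 - x b * V1) = T1 - (P1 - (om + be * V1)).
  by rewrite /T1 /be (big_setD1 b bB) /=; ring.
apply: le_trans (normB_le (tail1 (subsetDl _ _)) (tail1 (subxx B))) _.
by rewrite -2!mulrDl -[leLHS]mulrA -[leRHS]mulrA -/u ler_wpM2r // -mulr2n -mulr_natl.
Qed.

Let hV : `|V1 - V| <= G * h ^+ 2 * dq.
Proof.
have h2 := jet1_1_est S_N gS eta0 vb u0 etaE dq0 dqE.
have -> : V1 - V = (jt 1 S r.+2 + Ys S v w r) / e by rewrite /V1 /V; ring.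
rewrite normrM [X in _ * X]gtr0_norm ?invr_gt0 // ler_pdivrMr //.
apply: le_trans h2 _; rewrite a0E.
have -> : N%:R * N.+1%:R * u * (e * dq) = n * (n + 1) * (u * dq * e).
  by rewrite -natr1 /n; ring.
have -> : G * h ^+ 2 * dq * e = G * (u * dq * e) by rewrite /u; ring.
by rewrite ler_wpM2r // mulr_ge0 // ltW.
Qed.

Let Qg0 : 0 <= Q. Proof. exact: Qs_ge0 gS. Qed.
Let r1e0 : 0 < r1 * e. Proof. exact: mulr_gt0. Qed.
Let hs : h ^+ 2 <= s. Proof. by rewrite /s -/u lerDr divr_ge0 // ltW. Qed.
Let s0' : 0 < s. Proof. by apply: lt_le_trans hs; rewrite exprn_gt0. Qed.
Let Qr1 : Q / e <= r1 * s.
Proof.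
have -> : Q / e = r1 * (Q / (r1 * e)) by field; rewrite -natrD !gt_eqF ?ltr0n.
by rewrite ler_pM2l // /s lerDl.
Qed.

Let Vs : V ^+ 2 <= r1 * s * dq ^+ 2.
Proof.
have rs0 : 0 < r1 * s by apply: mulr_gt0.
(* The optimal parameter once [Q] is replaced by its upper bound [r1 * s * e]. *)
have h2 := Ys_sq gS dqE (Ys S v w r / (r1 * s * e)).
have h3 : (Ys S v w r / (r1 * s * e)) ^+ 2 * Q
   <= (Ys S v w r / (r1 * s * e)) ^+ 2 * (r1 * s * e).
  by rewrite ler_wpM2l ?sqr_ge0 // -ler_pdivrMr.
have h4 : 2 * (Ys S v w r / (r1 * s * e)) * Ys S v w r
   - (Ys S v w r / (r1 * s * e)) ^+ 2 * (r1 * s * e) <= a 0 * dq ^+ 2.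
  by apply: le_trans h2; rewrite -/Q lerD2l lerN2.
have e1 : 2 * (Ys S v w r / (r1 * s * e)) * Ys S v w r
   - (Ys S v w r / (r1 * s * e)) ^+ 2 * (r1 * s * e) = V ^+ 2 / (r1 * s) * e.
  have gen (y c : R) : 0 < c -> 2 * (y / (c * e)) * y - (y / (c * e)) ^+ 2 * (c * e)
     = (- (y / e)) ^+ 2 / c * e by move=> c0; field; rewrite !gt_eqF.
  exact: gen.
rewrite e1 a0E [leRHS]mulrC ler_pM2r // ler_pdivrMr // in h4.
by rewrite mulrC.
Qed.

Let hsg : f * sg = \sum_(b in B) t b * Pb b + P1.
Proof. by rewrite /sg mulrC divfK // gt_eqF. Qed.

Let g60 : 0 <= g6.
Proof. by rewrite /g6; apply: mulr_ge0 => //; rewrite !mulr_ge0. Qed.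

Let hbh : `|bh - be| <= G * h ^+ 2.
Proof.
have -> : bh - be = - (g6 * eta) by rewrite /bh; ring.
rewrite normrN ger0_norm; last exact: mulr_ge0.
by apply: ler_pM.
Qed.

Let bh0 : 0 <= bh.
Proof.
have := ler_norm (- (bh - be)); rewrite normrN => h2.
by move: h2 hbh be1 Gh; lra.
Qed.

(** If [- q] is at most 1/(2 n L), the factor is at least 1/2. Otherwise lowering [be] by [g6 * eta]
    gains at least [g2 * eta], which is the deficit; this explains [g6 = 2 * (n * L) * g2]. *)
Let psi0 : 0 <= 1 + bh * q.
Proof.
have := ler_norm (f - (1 + be * q)) => h2.
have h3 := tail0 (subxx B); rewrite -/be -/f in h3.
have [q0|q0] := leP 0 q; first by rewrite addr_ge0 // mulr_ge0.
have q1 : - (g2 * eta) <= 1 + be * q by move: f0; lra.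
have nL0 : 0 < 2 * (n * L) by move: be1 beNL; lra.
have [q2|q2] := leP (- q * (2 * (n * L))) 1.
  have h4 : - q * bh <= - q * (n * L).
    apply: ler_wpM2l; first by rewrite oppr_ge0 ltW.
    have : 0 <= g6 * eta by apply: mulr_ge0.
    by rewrite /bh; move: beNL; lra.
  by lra.
have h5 : g2 * eta <= - q * (g6 * eta).
  have -> : - q * (g6 * eta) = (- q * (2 * (n * L))) * (g2 * eta) by rewrite /g6; ring.
  by apply: ler_peMl; [exact: mulr_ge0 | exact: ltW].
by rewrite /bh; lra.
Qed.

Let c2 := N%:R * (N%:R * (2 * (K + N%:R))).

Let KN0 : 0 <= K + n. Proof. by rewrite addr_ge0 //; move: K1; lra. Qed.

Let tail2 :
  `|P2 - 2 * (jt 2 S r.+1 + be * jt 2 S r.+2) / e| <= n * (Xs * c2) * eta * dq ^+ 2.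
Proof.
have ed0 : 0 <= a 0 * dq ^+ 2 by rewrite a0E mulr_ge0 ?sqr_ge0 // ltW.
have hc : 0 <= N%:R * (N%:R * (2 * (K + N%:R) * eta * (a 0 * dq ^+ 2))).
  do 2!apply: mulr_ge0 => //; apply: mulr_ge0 => //; apply: mulr_ge0 => //.
  exact: mulr_ge0.
have hj p : (p <= N + 2)%N -> `|2 * jt 2 S (r + p.+2).+1|
    <= N%:R * (N%:R * (2 * (K + N%:R) * eta * (a 0 * dq ^+ 2))).
  have -> : (r + p.+2).+1 = (r + p).+3 by rewrite !addnS.
  by apply: (jet2_est S_N gS eta0 eta12 vb dq0 dqE a1le Kle).
have h2 := @tail_le _ _ _ _ _ _ _ _ (fun p => 2 * jt 2 S (r + p).+1)
   L0 (xA (subxx B)) (XA (subxx B)) hc hj.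
rewrite -(ler_pM2r e0).
have -> : n * (Xs * c2) * eta * dq ^+ 2 * e
  = N%:R * (Xs * (N%:R * (N%:R * (2 * (K + N%:R) * eta * (a 0 * dq ^+ 2))))).
  by rewrite /c2 /n a0E; ring.
apply: le_trans h2; rewrite -{2}(gtr0_norm e0) -normrM le_eqVlt; apply/orP; left.
apply/eqP; congr (`| _ |); rewrite /P2 /Ph -/be !addn0 !addn1.
have -> : \sum_(j < N.+2) elsym B j x * (2 * jt 2 S (r + j).+1)
   = 2 * \sum_(j < N.+2) elsym B j x * jt 2 S (r + j).+1.
  by rewrite mulr_sumr; apply: eq_bigr => j _; ring.
by field; rewrite gt_eqF.
Qed.

Let rr : r%:R = r.+1%:R - 1 :> R. Proof. by rewrite -natr1 addrK. Qed.
Let r1E : r1 = r.+1%:R + 1. Proof. by rewrite natr1. Qed.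

Let P2le y : P2 <= (1 - bh * s0) * ((r.+1%:R - 1) / r.+1%:R) * om ^+ 2
  + 2 * bh * (V1 + s0 * om) * om
  - 2 * bh / (r.+1%:R + 1)
    * (2 * y * (r.+1%:R * V1 + (r.+1%:R + 1) * s0 * om)
       - y ^+ 2 * ((r.+1%:R + 1) * s))
  + G * h ^+ 2 * dq ^+ 2.
Proof.
have h2 := jet2_pencil w gS y bh0 psi0.
rewrite -/om -/V1 -/q -/e -/Q -/r1 rr in h2.
have h3 := ler_norm (P2 - 2 * (jt 2 S r.+1 + be * jt 2 S r.+2) / e).
have h4 := tail2.
have dq20 := sqr_ge0 dq.
have h5 : `|(be - bh) * (2 * jt 2 S r.+2 / e)| <= g6 * eta * (n * (n * (K + n)) * dq ^+ 2).
  have -> : be - bh = g6 * eta by rewrite /bh; ring.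
  apply: normM_le; first by rewrite ger0_norm // mulr_ge0.
  have := jet2_1_est S_N gS eta0 eta12 vb dq0 dqE a1le Kle => h6.
  rewrite normrM [X in _ * X]gtr0_norm ?invr_gt0 // ler_pdivrMr //.
  by apply: le_trans h6 _; rewrite a0E le_eqVlt; apply/orP; left; apply/eqP; rewrite /n; ring.
have h6 := ler_norm ((be - bh) * (2 * jt 2 S r.+2 / e)).
have e1 : 2 * (jt 2 S r.+1 + be * jt 2 S r.+2) / e
   = 2 * (jt 2 S r.+1 + bh * jt 2 S r.+2) / e + (be - bh) * (2 * jt 2 S r.+2 / e).
  by ring.
have h7 : g6 * eta * (n * (n * (K + n)) * dq ^+ 2) + n * (Xs * c2) * eta * dq ^+ 2
   <= G * h ^+ 2 * dq ^+ 2.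
  have -> : g6 * eta * (n * (n * (K + n)) * dq ^+ 2) + n * (Xs * c2) * eta * dq ^+ 2
    = (g6 * (n * (n * (K + n))) + n * (Xs * (n * (n * (2 * (K + n)))))) * eta * dq ^+ 2.
    by rewrite /c2 /n; ring.
  rewrite ler_wpM2r //; apply: ler_pM => //.
  apply: addr_ge0; first by apply: mulr_ge0 => //; do 2!apply: mulr_ge0 => //.
  apply: mulr_ge0 => //; apply: mulr_ge0; first by move: Xs1; lra.
  by do 2!apply: mulr_ge0 => //; apply: mulr_ge0.
have h8 : 2 * bh / r1 * (y ^+ 2 * (Q / e)) <= 2 * bh / r1 * (y ^+ 2 * (r1 * s)).
  apply: ler_wpM2l; first by apply: divr_ge0; [apply: mulr_ge0 | apply: ltW].
  by apply: ler_wpM2l => //; apply: sqr_ge0.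
rewrite -r1E; rewrite e1 in h3 h4.
have e2 : V1 - q * om = V1 + s0 * om by rewrite /s0; ring.
have e3 : r.+1%:R * V1 - r1 * q * om = r.+1%:R * V1 + r1 * s0 * om.
  by rewrite /s0; ring.
have e4 : 1 + bh * q = 1 - bh * s0 by rewrite /s0; ring.
rewrite e2 e3 e4 in h2; move: h2 h3 h4 h5 h6 h7 h8.
set A1 := (1 - bh * s0) * _ * _; set A2 := 2 * bh * _ * om.
set cc := 2 * bh / r1; set A3 := 2 * y * _; set A4 := y ^+ 2 * (Q / e).
set A5 := y ^+ 2 * (r1 * s); set A6 := 2 * (_ + bh * _) / e.
set A7 := (be - bh) * _; set A8 := G * _ * _; set A9 := g6 * eta * _.
set A10 := n * _ * _ * _.
rewrite [cc * (A3 - A4)]mulrBr [cc * (A3 - A5)]mulrBr.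
set B1 := cc * A3; set B2 := cc * A4; set B3 := cc * A5.
lra.
Qed.

Local Notation TT := [set: I].
Let e_neq0 : e != 0. Proof. by rewrite gt_eqF. Qed.

Let sumT (F : I -> R) : \sum_(i in TT) F i = \sum_(i in B) F i + \sum_(i in S) F i.
Proof. by rewrite (big_setID B) /= setTI setTD. Qed.

Let sumTB (F : I -> R) b : b \in B ->
  \sum_(i in TT :\ b) F i = \sum_(i in B :\ b) F i + \sum_(i in S) F i.
Proof.
move=> bB; rewrite (big_setID B) /=; congr (_ + _); apply: eq_bigl => i; rewrite !inE.
  by rewrite andbT.
by rewrite andbT andbC; case: eqVneq => [->|//]; rewrite bB.
Qed.

Let sumTS (F : I -> R) i : i \in S ->
  \sum_(l in TT :\ i) F l = \sum_(l in B) F l + \sum_(l in S :\ i) F l.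
Proof.
move=> iS; rewrite (big_setID B) /=; congr (_ + _); apply: eq_bigl => l; rewrite !inE.
  by rewrite andbT andbC; case: eqVneq => [->|]; rewrite ?andbT // andbF; move: iS; rewrite inE => /negPf.
by rewrite andbT andbC.
Qed.

Let wB b : b \in B -> w b = 0. Proof. by move=> bB; rewrite /w inE bB. Qed.
Let wS i : i \in S -> w i = xi i. Proof. by rewrite /w => ->. Qed.

Let FE : elsym TT k.+2 mu = PB * e * f.
Proof.
have := jet_Ph 0 (subxx B); rewrite jet0E /S setUCr addSn addnC kE => ->.
by rewrite -/PB /f -mulrA [e * _]mulrC divfK.
Qed.

Let FbE m b : b \in B -> jt m (TT :\ b) k.+1 = PB / mu b * Ph m (B :\ b).
Proof.
move=> bB; have cB : (#|B| = #|B :\ b|.+1)%N by rewrite (cardsD1 b B) bB.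
have -> : TT :\ b = (B :\ b) :|: S.
  by apply/setP => i; rewrite !inE; case: eqVneq => [->|] //=; rewrite ?bB //= orbN.
have -> : k.+1 = (r.+1 + #|B :\ b|)%N by rewrite -kE cB addSn addnC addSn.
rewrite jet_Ph ?subsetDl //; congr (_ * _).
by rewrite /PB (big_setD1 b bB) /= mulrC mulKf // gt_eqF // mu0.
Qed.

Let FbcE m b c : b \in B -> c \in B :\ b ->
  jt m (TT :\ b :\ c) k = PB / (mu b * mu c) * Ph m (B :\ b :\ c).
Proof.
move=> bB cB'; have cB : c \in B by move: cB'; rewrite inE => /andP[].
have nB : (#|B| = #|B :\ b :\ c|.+2)%N.
  by rewrite (cardsD1 b B) bB (cardsD1 c (B :\ b)) cB'.
have -> : TT :\ b :\ c = (B :\ b :\ c) :|: S.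
  apply/setP => i; rewrite !inE; case: (eqVneq i c) => [->|] /=; first by rewrite cB.
  by case: (eqVneq i b) => [->|] /=; [rewrite bB | rewrite orbN].
have -> : k = (r.+1 + #|B :\ b :\ c|)%N.
  by apply/eqP; rewrite -(eqn_add2r 1) addn1 -kE nB addn1 addSn addnC addnS addSn.
rewrite jet_Ph; last by rewrite setDDl subsetDl.
congr (_ * _); rewrite /PB (big_setD1 b bB) (big_setD1 c cB') /=.
have mb := mu0 bB; have mc := mu0 cB.
by field; rewrite !gt_eqF.
Qed.

Let tE b : b \in B -> xi b = mu b * t b.
Proof. by move=> bB; rewrite /t mulrC divfK // gt_eqF // mu0. Qed.

Let w0B (F : I -> R) : \sum_(b in B) w b * F b = 0.
Proof. by rewrite big1 // => b bB; rewrite wB ?mul0r. Qed.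

Let dFE : \sum_(i in TT) elsym (TT :\ i) k.+1 mu * xi i = PB * e * (f * sg).
Proof.
rewrite hsg sumT mulrDr; congr (_ + _).
  rewrite mulr_sumr; apply: eq_bigr => b bB.
  rewrite -(jet0E mu w) FbE // tE // /Pb; have mb := mu0 bB.
  by field; rewrite e_neq0 gt_eqF.
have -> : PB * e * P1 = PB * Ph 1 B by rewrite /P1; field.
have := jet_Ph 1 (subxx B); rewrite /S setUCr addSn addnC kE -/PB => <-.
rewrite jet1E sumT w0B add0r.
by apply: eq_bigr => i iS; rewrite wS // mulrC.
Qed.

Let ddFE : \sum_(p in TT) \sum_(l in TT :\ p) elsym (TT :\ p :\ l) k mu * xi p * xi l
  = PB * e * (\sum_(b in B) \sum_(c in B :\ b) Pbc b c * t b * t c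
              + 2 * \sum_(b in B) t b * P1b b + P2).
Proof.
have X1 b : b \in B -> \sum_(i in S) elsym (TT :\ b :\ i) k mu * xi b * xi i
    = PB * e * (t b * P1b b).
  move=> bB; transitivity (xi b * jt 1 (TT :\ b) k.+1).
    rewrite jet1E sumTB //.
    have -> : \sum_(c in B :\ b) w c * elsym (TT :\ b :\ c) k mu = 0.
      by rewrite big1 // => c; rewrite inE => /andP[_ cB]; rewrite wB ?mul0r.
    rewrite add0r mulr_sumr; apply: eq_bigr => i iS; rewrite wS //; ring.
  rewrite FbE // {1}tE // /P1b; have mb := mu0 bB.
  by field; rewrite e_neq0 gt_eqF.
have X2 : \sum_(i in S) \sum_(b in B) elsym (TT :\ i :\ b) k mu * xi i * xi b
    = \sum_(b in B) \sum_(i in S) elsym (TT :\ b :\ i) k mu * xi b * xi i.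
  rewrite exchange_big /=; apply: eq_bigr => b _; apply: eq_bigr => i _.
  by rewrite setD1C; ring.
have X3 : \sum_(i in S) \sum_(l in S :\ i) elsym (TT :\ i :\ l) k mu * xi i * xi l
    = PB * e * P2.
  have -> : PB * e * P2 = 2 * (PB * Ph 2 B) by rewrite /P2; field.
  have := jet_Ph 2 (subxx B); rewrite /S setUCr addSn addnC kE -/PB => <-.
  rewrite mulr_natl jet2E sumT w0B add0r.
  apply: eq_bigr => i iS; rewrite wS // jet1E sumTS // w0B add0r.
  rewrite mulr_sumr; apply: eq_bigr => l; rewrite inE => /andP[_ lS].
  by rewrite wS //; ring.
rewrite sumT.
transitivity (\sum_(b in B) (\sum_(c in B :\ b) elsym (TT :\ b :\ c) k mu * xi b * xi c
   + \sum_(i in S) elsym (TT :\ b :\ i) k mu * xi b * xi i)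
  + \sum_(i in S) (\sum_(b in B) elsym (TT :\ i :\ b) k mu * xi i * xi b
     + \sum_(l in S :\ i) elsym (TT :\ i :\ l) k mu * xi i * xi l)).
  by congr (_ + _); apply: eq_bigr => i iS; [exact: sumTB | exact: sumTS].
rewrite !big_split /= X2 X3 (eq_bigr _ X1) -mulr_sumr.
have -> : \sum_(b in B) \sum_(c in B :\ b) elsym (TT :\ b :\ c) k mu * xi b * xi c
  = PB * e * \sum_(b in B) \sum_(c in B :\ b) Pbc b c * t b * t c.
  rewrite mulr_sumr; apply: eq_bigr => b bB; rewrite mulr_sumr.
  apply: eq_bigr => c cB'; have cB : c \in B by move: cB'; rewrite inE => /andP[].
  rewrite -(jet0E mu w) FbcE // tE // (tE cB) /Pbc.
  have mb := mu0 bB; have mc := mu0 cB.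
  by field; rewrite e_neq0 !gt_eqF.
ring.
Qed.

(** In the expansion over B the term of degree 0 is [d i], and [b_est] bounds all later terms by
    multiples of [eta * d i]. *)
Let FS i : i \in S -> PB * ((1 - (n + 1) * (Xs * K) * eta) * d i) <= elsym (TT :\ i) k.+1 mu.
Proof.
move=> iS; have di := d0 iS.
have -> : TT :\ i = B :|: (S :\ i).
  apply/setP => l; rewrite !inE; case: (eqVneq l i) => [->|] /=; last by rewrite orbN.
  by rewrite orbF; move: iS; rewrite inE => /negPf.
have dB : [disjoint B & S :\ i].
  by rewrite disjoint_sym; apply: disjointWl (subsetDl _ _) _; rewrite disjoint_sym dis.
rewrite -kE addnC (@elsym_split _ _ _ _ x _ _ N.+2) //; last 2 first.
- by move=> b bB; rewrite mulVf // gt_eqF // mu0.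
- exact: cardA.
rewrite ler_pM2l // big_ord_recl elsym0 mul1r addn0.
rewrite mulrBl mul1r -lerBlDl -/(d i) -/v.
rewrite addrC addKr lerNl.
apply: le_trans (ler_norm _) _; rewrite normrN.
apply: le_trans (ler_norm_sum _ _ _) _.
apply: le_trans (_ : \sum_(j < N.+1) Xs * (K * eta * d i) <= _); last first.
  rewrite sumr_const card_ord -[_ *+ N.+1]mulr_natl -natr1 le_eqVlt.
  by apply/orP; left; apply/eqP; rewrite /n; ring.
apply: ler_sum => j _; rewrite normrM; apply: ler_pM => //.
  have /andP[y0 y1] := elsym_bounds (bump 0 j) L0 (xA (subxx B)).
  by rewrite ger0_norm //; apply: le_trans y1 (XA (subxx B)).
have -> : (r + bump 0 j = (r + j).+1)%N by rewrite /bump addnS.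
apply: (b_est S_N gS eta0 eta12 vb a1le Kle) => //.
by apply: leq_trans (_ : (j <= N)%N) _; [rewrite -ltnS | rewrite leq_addr].
Qed.

Let eta_h : eta <= h.
Proof. by apply: le_trans etau _; rewrite /u expr2 ler_piMl // ltW. Qed.

(** The summands over B are nonnegative and are dropped. The losses in [FS] and in [kap] are
    multiples of [eta <= h], hence covered by [G * h]. *)
Let diag : PB * e * ((2 - G * h) * dq ^+ 2)
  <= 2 * kap * \sum_(i in TT :\ o) elsym (TT :\ i) k.+1 mu * xi i ^+ 2.
Proof.
have Feg i : 0 < elsym (TT :\ i) k.+1 mu by apply: (gardD1 _ g).
have eta10 : 0 <= 1 - 2 * eta by move: eta12; lra.
have kap0 : 0 <= kap by move: eta10 kap1; lra.
set c3 := (n + 1) * (Xs * K).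
have c30 : 0 <= c3 by rewrite /c3; apply: mulr_ge0; [rewrite addr_ge0 | apply: mulr_ge0; move: Xs1 K1; lra].
have Geta : 2 * (2 + c3) * eta <= G * h by apply: ler_pM => //; rewrite mulr_ge0 // addr_ge0.
have c3e : c3 * eta <= 1.
  have : c3 * eta <= G * u.
    by apply: ler_pM => //; apply: le_trans G8; rewrite -/c3; lra.
  by move: Gu; lra.
have c3e0 : 0 <= c3 * eta by apply: mulr_ge0.
have De0 : 0 <= PB * D by rewrite mulr_ge0 // ltW.
apply: le_trans (_ : 2 * kap * (PB * (1 - c3 * eta) * D) <= _).
  apply: le_trans (_ : 2 * (1 - 2 * eta) * (PB * (1 - c3 * eta) * D) <= _).
    have -> : PB * e * ((2 - G * h) * dq ^+ 2) = (2 - G * h) * (PB * D).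
      by rewrite dqE a0E; ring.
    have -> : 2 * (1 - 2 * eta) * (PB * (1 - c3 * eta) * D)
      = (2 - 2 * (2 + c3) * eta + 4 * eta * (c3 * eta)) * (PB * D) by ring.
    rewrite ler_wpM2r //.
    have : 0 <= 4 * eta * (c3 * eta) by rewrite mulr_ge0 // mulr_ge0.
    by move: Geta; lra.
  rewrite ler_wpM2r //; last by rewrite ler_pM2l.
  by rewrite mulr_ge0 // mulr_ge0 ?(ltW PB0) // subr_ge0.
rewrite ler_wpM2l //; first by rewrite mulr_ge0.
rewrite sumTB // -[leLHS]add0r lerD //.
  by apply: sumr_ge0 => b _; rewrite mulr_ge0 ?sqr_ge0 // ltW.
rewrite /D mulr_sumr; apply: ler_sum => i iS; rewrite wS // mulrA.
rewrite ler_wpM2r ?sqr_ge0 //; apply: le_trans (FS iS).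
by rewrite -/c3 -mulrA.
Qed.

Lemma gap_ineq :
  (1 + ga) * (elsym (TT :\ o) k.+1 mu * xi o ^+ 2) <=
  - (\sum_(p in TT) \sum_(l in TT :\ p) elsym (TT :\ p :\ l) k mu * xi p * xi l)
  + 2 * ((\sum_(i in TT) elsym (TT :\ i) k.+1 mu * xi i) ^+ 2 / elsym TT k.+2 mu)
  + 2 * kap * \sum_(i in TT :\ o) elsym (TT :\ i) k.+1 mu * xi i ^+ 2.
Proof.
have rho1 : 1 <= r.+1%:R :> R by rewrite ler1n.
have kk : #|B|%:R + r.+1%:R = k.+2%:R :> R by rewrite -natrD addnS kE.
have BN : #|B|%:R + r.+1%:R <= N%:R :> R by rewrite kk ler_nat.
have tx b : b \in B -> t b = 0 \/ 1 <= x b.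
  move=> bB; have [xb|mb] := mu1 bB; first by left; rewrite /t xb mul0r.
  by right; rewrite /x -invr1 lef_pV2 ?posrE ?mu0.
have bbE : bb ^+ 2 = f * sg ^+ 2 + W + dq ^+ 2.
  rewrite sqr_sqrtr //; apply: addr_ge0; last exact: sqr_ge0.
  apply: addr_ge0; first by rewrite mulr_ge0 ?sqr_ge0 // ltW.
  by apply: sumr_ge0 => b _; apply: sqr_ge0.
have Vs' : V ^+ 2 <= (r.+1%:R + 1) * s * dq ^+ 2 by rewrite natr1.
have hs0 : `|s0 - s| <= G * h ^+ 2.
  apply: le_trans ds _; rewrite ler_wpM2r //; apply: le_trans G3.
  have : 1 + n <= L * (1 + n) by rewrite ler_peMl.
  have : 0 <= L * (1 + n) by apply: mulr_ge0.
  by move: g20; lra.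
have gak' : ga <= (10 * (#|B|%:R + r.+1%:R))^-1 by rewrite kk.
have H := gap_quadratic_le oB xo x0 muL L1 rho1 BN tx nG LG G1 h0 h1 Gh f0 hs
  (sqrtr_ge0 _) dq0 bbE hf hPb hPbc hP1 hP1b hV Vs' hsg hs0 hbh P2le ga0 gak' hC.
have PBe : 0 < PB * e by apply: mulr_gt0.
have {H} H := ler_wpM2l (ltW PBe) H.
rewrite dFE ddFE FE.
have -> : (PB * e * (f * sg)) ^+ 2 / (PB * e * f) = PB * e * (f * sg ^+ 2).
  by field; rewrite !gt_eqF.
have FoE : elsym (TT :\ o) k.+1 mu * xi o ^+ 2 = PB * e * (Pb o * t o ^+ 2).
  rewrite -(jet0E mu w) FbE // {1}tE // muo /Pb; by field.
rewrite FoE; have := diag; lra.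
Qed.

End Gap.

(* The inequality of the theorem for lambda_1 = 1, multiplied by F; kap plays the
   role of 1 / (1 + 2 delta). *)
Definition sigma_ineq (R : rcfType) (I : finType) (mu xi : I -> R) (o : I)
    (k : nat) (kap ga : R) : Prop :=
  (1 + ga) * (elsym ([set: I] :\ o) k.-1 mu * xi o ^+ 2) <=
  - (\sum_(p in [set: I]) \sum_(l in [set: I] :\ p)
       elsym ([set: I] :\ p :\ l) k.-2 mu * xi p * xi l)
  + 2 * ((\sum_(i in [set: I]) elsym ([set: I] :\ i) k.-1 mu * xi i) ^+ 2
         / elsym [set: I] k mu)
  + 2 * kap * \sum_(i in [set: I] :\ o) elsym ([set: I] :\ i) k.-1 mu * xi i ^+ 2.

(** The index type, the degree, [kap] and [ga] are quantified inside, so that [eta] depends on [N]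
    and [th] only. This is the uniformity required of the constants of the theorem. *)
Definition gap_prop (R : rcfType) (N : nat) (th eta : R) : Prop :=
  forall (I : finType) (mu xi : I -> R) (B : {set I}) (o : I) (k : nat) (kap ga : R),
  (#|I| <= N)%N -> o \in B -> mu o = 1 -> (forall b, b \in B -> th <= mu b) ->
  (forall i, xi i = 0 \/ mu i <= 1) -> (forall i, i \notin B -> `|mu i| <= eta) ->
  (#|B| < k <= N)%N -> gard [set: I] k mu -> 1 - 2 * eta <= kap ->
  0 <= ga <= (10 * k%:R)^-1 -> sigma_ineq mu xi o k kap ga.

Lemma gap_exists (R : rcfType) (N : nat) (th : R) : (0 < N)%N -> 0 < th -> th <= 1 ->
  exists2 eta : R, 0 < eta & gap_prop N th eta.
Proof.
move=> N0 th0 th1; pose L := th^-1; pose n := N%:R : R.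
have L1 : 1 <= L by rewrite /L invr_ge1 ?unitf_gt0.
have n1 : 1 <= n by rewrite /n ler1n.
pose K : R := 3 * (4 * N + 2)%:R ^+ (N + 5); pose Xs := (1 + L) ^+ N.
have Kle p : (p <= N + 5)%N -> 3 * (4 * N + 2)%:R ^+ p <= K.
  move=> pN; rewrite /K ler_pM2l // ler_weXn2l //.
  by have := four_n_add_2_ge2 R N; lra.
have K1 : 1 <= K by have := Kle _ (leq0n _); rewrite expr0; lra.
have Xs1 : 1 <= Xs by rewrite /Xs exprn_ege1 // lerDl; lra.
have L0 : 0 <= L by lra.
have n0 : 0 <= n by lra.
have K0 : 0 <= K by lra.
have Xs0 : 0 <= Xs by lra.
pose g2 := n * (Xs * K); pose g6 := 2 * (n * L) * g2.
have g20 : 0 <= g2 by apply: mulr_ge0 => //; apply: mulr_ge0.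
have g60 : 0 <= g6 by apply: mulr_ge0 => //; apply: mulr_ge0 => //; apply: mulr_ge0.
pose t1 := n * L * (1 + n) + g2; pose t3 := 2 * g2 + 2 * L * (1 + n).
pose t4 := 2 * (n * (Xs * (n * (K * (12 * N + 9)%:R)))).
pose t5 := n * (n + 1).
pose t7 := g6 * (n * (n * (K + n))) + n * (Xs * (n * (n * (2 * (K + n))))).
pose t8 := 2 * (2 + (n + 1) * (Xs * K)).
have Kn0 : 0 <= K + n by apply: addr_ge0.
have n10 : 0 <= 1 + n by apply: addr_ge0.
have t10 : 0 <= t1 by apply: addr_ge0 => //; apply: mulr_ge0 => //; apply: mulr_ge0.
have t30 : 0 <= t3.
  by apply: addr_ge0; apply: mulr_ge0 => //; apply: mulr_ge0.
have t40 : 0 <= t4 by do 6?[apply: mulr_ge0 => //].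
have t50 : 0 <= t5 by apply: mulr_ge0 => //; apply: addr_ge0.
have t70 : 0 <= t7 by apply: addr_ge0; do 6?[apply: mulr_ge0 => //].
have t80 : 0 <= t8.
  apply: mulr_ge0 => //; apply: addr_ge0 => //; apply: mulr_ge0 => //.
    by apply: addr_ge0.
  exact: mulr_ge0.
pose G := 1 + n + L + t1 + t3 + t4 + t5 + g6 + t7 + t8.
have [G1 LG nG] : [/\ 1 <= G, L <= G & n <= G].
  by rewrite /G; clearbody t1 t3 t4 t5 g6 t7 t8 L n; split; lra.
have [Gt1 Gt3 Gt4 Gt5] : [/\ t1 <= G, t3 <= G, t4 <= G & t5 <= G].
  by rewrite /G; clearbody t1 t3 t4 t5 g6 t7 t8 L n; split; lra.
have [Gt6 Gt7 Gt8] : [/\ g6 <= G, t7 <= G & t8 <= G].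
  by rewrite /G; clearbody t1 t3 t4 t5 g6 t7 t8 L n; split; lra.
clearbody G.
pose A := 60 * (11 * G ^+ 3) ^+ 6 + 300 * G ^+ 7.
pose C := (10 * n * L)^-1 / (2 * G ^+ 2).
have G0 : 0 < G by lra.
have A0 : 0 <= A.
  by rewrite /A addr_ge0 // mulr_ge0 // exprn_ge0 // ?mulr_ge0 // ?exprn_ge0 // ltW.
have C0 : 0 < C.
  by rewrite /C divr_gt0 ?invr_gt0 ?mulr_gt0 ?exprn_gt0 //; lra.
have AC0 : 0 <= A / C by rewrite divr_ge0 // ltW.
(* This choice yields both [G * h <= 1 / 2] and [A * h <= C]. *)
pose h := (2 * G + A / C)^-1.
have hd0 : 0 < 2 * G + A / C by lra.
have h0 : 0 < h by rewrite invr_gt0.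
have Gh1 : G * h <= 1 / 2 by rewrite /h ler_pdivrMr //; lra.
have h1 : h <= 1.
  by apply: le_trans (_ : G * h <= _); [rewrite ler_peMl // ltW | lra].
have Gh : G * h ^+ 2 <= 1 / 2.
  by apply: le_trans Gh1; rewrite expr2 mulrA ler_piMr // mulr_ge0 // ltW.
have hC : A * h <= C.
  rewrite /h ler_pdivrMr // mulrDr [C * (A / C)]mulrC divfK ?gt_eqF //.
  by rewrite lerDr mulr_ge0 // ?ltW // mulr_gt0.
exists (h ^+ 4); first by rewrite exprn_gt0.
move=> I mu xi B o k kap ga IN oB muo muB xi0 muS /andP[Bk kN] g kap1 /andP[ga0 gak].
have B0 : (0 < #|B|)%N by apply/card_gt0P; exists o.
(* The degree is at least 2, because [o] belongs to B and B has fewer than [k] elements. *)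
case: k Bk kN g gak => [|[|k]] Bk kN g gak //.
  by move: B0 Bk; case: #|B|.
have kE : (#|B| + (k.+1 - #|B|) = k.+1)%N by rewrite subnKC.
apply: (@gap_ineq R I mu xi B o N (k.+1 - #|B|) k L G h K Xs kap ga) => //.
- by move=> b bB; apply: lt_le_trans (muB b bB).
- by move=> b bB; rewrite /L lef_pV2 ?posrE ?muB // (lt_le_trans th0) // muB.
Qed.

(** * Choice of the thresholds *)

Section BigSet.
Variables (R : rcfType) (I : finType) (mu : I -> R) (N : nat) (th : R).
Hypotheses (N0 : (0 < N)%N) (th0 : 0 < th) (th1 : th <= 1).

Lemma elsym_ge0 (B : {set I}) j : (forall b, b \in B -> th <= mu b) ->
  0 <= elsym B j mu.
Proof.
elim/set_ind: B j => B IH j muB.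
have [->|[b bB]] := set_0Vmem B.
  by case: j => [|j]; rewrite ?elsym0 ?elsym_set0.
case: j => [|j]; first by rewrite elsym0.
have muB' c : c \in B :\ b -> th <= mu c by rewrite inE => /andP[_]; apply: muB.
rewrite (elsymS _ _ bB) addr_ge0 ?IH // mulr_ge0 ?IH //.
by apply: le_trans (muB b bB); apply: ltW.
Qed.

(** Double counting: summed over the deleted element, sigma_j counts each j-subset [#|B| - j] times,
    which is at least once. Euler's identity and [th <= mu b] then compare consecutive degrees. *)
Lemma elsym_step (B : {set I}) j : (#|B| <= N)%N -> (forall b, b \in B -> th <= mu b) ->
  (j < #|B|)%N -> elsym B j mu <= N%:R / th * elsym B j.+1 mu.
Proof.
move=> BN muB jB; rewrite mulrAC ler_pdivlMr //.
have h1 : th * (#|B| - j)%:R * elsym B j mu <= j.+1%:R * elsym B j.+1 mu.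
  rewrite -elsym_euler.
  apply: le_trans (_ : \sum_(i in B) th * elsym (B :\ i) j mu <= _); last first.
    apply: ler_sum => i iB; rewrite ler_wpM2r ?muB // elsym_ge0 // => b.
    by rewrite inE => /andP[_]; apply: muB.
  rewrite -mulr_sumr -mulrA ler_pM2l //.
  have -> : \sum_(i in B) elsym (B :\ i) j mu = (#|B| - j)%:R * elsym B j mu; last by [].
  case: j jB => [|j] jB.
    rewrite subn0 elsym0 mulr1 (eq_bigr (fun=> 1)) => [|i _]; last by rewrite elsym0.
    by rewrite sumr_const.
  have -> : \sum_(i in B) elsym (B :\ i) j.+1 mu
     = \sum_(i in B) (elsym B j.+1 mu - mu i * elsym (B :\ i) j mu).
    by apply: eq_bigr => i iB; rewrite (elsymS _ _ iB); ring.
  rewrite sumrB elsym_euler sumr_const natrB ?(ltnW jB) // mulrBl.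
  by rewrite -[elsym B j.+1 mu *+ _]mulr_natl.
have h2 : 1 <= (#|B| - j)%:R :> R by rewrite ler1n subn_gt0.
have e0 := elsym_ge0 j muB; have e1 := elsym_ge0 j.+1 muB.
apply: le_trans (_ : th * (#|B| - j)%:R * elsym B j mu <= _).
  by rewrite [leLHS]mulrC ler_wpM2r // ler_peMr // ltW.
apply: le_trans h1 _; rewrite ler_wpM2r // ler_nat.
by apply: leq_trans jB BN.
Qed.

Let C : R := (N%:R / th) ^+ N.
Let q1 : 1 <= N%:R / th.
Proof. by rewrite ler_pdivlMr // mul1r (le_trans th1) // ler1n. Qed.

Lemma elsym_big_le (B : {set I}) j k : (#|B| <= N)%N -> (forall b, b \in B -> th <= mu b) ->
  (j <= k <= #|B|)%N -> elsym B j mu <= C * elsym B k mu.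
Proof.
move=> BN muB /andP[jk kB]; have e0 := elsym_ge0 k muB.
apply: le_trans (_ : (N%:R / th) ^+ (k - j) * elsym B k mu <= _); last first.
  by rewrite ler_wpM2r // ler_weXn2l // (leq_trans (leq_subr _ _)) // (leq_trans kB).
have main dk : (dk + j <= #|B|)%N ->
    elsym B j mu <= (N%:R / th) ^+ dk * elsym B (dk + j) mu.
  elim: dk => [|dk IH] dB; first by rewrite expr0 mul1r add0n.
  apply: le_trans (IH (ltnW dB)) _; rewrite exprSr -mulrA ler_wpM2l //.
    by rewrite exprn_ge0 // (le_trans ler01).
  exact: elsym_step.
by have := main (k - j)%N; rewrite subnK //; apply.
Qed.

(** On B alone sigma_k is at least [1 / C], by comparison with sigma_0 = 1. Small entries are then
    added one at a time: each changes sigma_k by at most [eta] times sigma_(k-1), while the bound on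
    the lower degrees at most doubles. Their signs do not matter. *)
Lemma elsym_large (B : {set I}) (eta : R) k : (#|I| <= N)%N ->
  (forall b, b \in B -> th <= mu b) -> (forall i, i \notin B -> `|mu i| <= eta) ->
  0 <= eta -> eta <= 1 -> N%:R * (eta * (2 ^+ N * C)) <= 1 / 2 -> (k <= #|B|)%N ->
  (2 * C)^-1 <= elsym [set: I] k mu.
Proof.
move=> IN muB muS eta0 eta1 etaC kB.
have BN : (#|B| <= N)%N := leq_trans (max_card _) IN.
have C0 : 0 < C by rewrite exprn_gt0 // (lt_le_trans ltr01).
set K := elsym B k mu.
have Kge : C^-1 <= K.
  rewrite -(ler_pM2l C0) divff ?gt_eqF //.
  by have := @elsym_big_le B 0 k BN muB; rewrite elsym0; apply.
have K0 : 0 <= K by apply: elsym_ge0.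
have main (D : {set I}) : [disjoint B & D] ->
   (forall j, (j <= k)%N -> `|elsym (B :|: D) j mu| <= 2 ^+ #|D| * (C * K))
   /\ `|elsym (B :|: D) k mu - K| <= #|D|%:R * (eta * (2 ^+ N * (C * K))).
  elim/set_ind: D => D IH dD.
  have [->|[i iD]] := set_0Vmem D.
    rewrite setU0 cards0 subrr normr0 mul0r; split=> // j jk.
    by rewrite expr0 mul1r ger0_norm ?elsym_ge0 // elsym_big_le // jk.
  have iB : i \notin B by apply: contraTN iD => iB; rewrite (disjointFr dD).
  have dD' : [disjoint B & D :\ i].
    by rewrite disjoint_sym; apply: disjointWl (subsetDl _ _) _; rewrite disjoint_sym.
  have [IH1 IH2] := IH i iD dD'.
  have E : (B :|: D) :\ i = B :|: D :\ i.
    by apply/setP => l; rewrite !inE; case: eqVneq => [->|] //=; rewrite (negPf iB).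
  have iBD : i \in B :|: D by rewrite inE iD orbT.
  have cD : #|D| = #|D :\ i|.+1 by rewrite (cardsD1 i D) iD.
  have CK : 0 <= C * K by rewrite mulr_ge0 // ltW.
  split=> [[|j] jk|].
  - by apply: le_trans (_ : 2 ^+ #|D :\ i| * (C * K) <= _);
      [have := IH1 0%N isT; rewrite !elsym0 | rewrite ler_wpM2r // cD ler_weXn2l // ler1n].
  - rewrite (elsymS _ _ iBD) E; apply: le_trans (ler_normD _ _) _.
    rewrite cD exprS -mulrA mulr_natl mulr2n lerD ?IH1 //.
    rewrite normrM; apply: le_trans (IH1 j (ltnW jk)).
    by rewrite ler_piMl // (le_trans (muS _ iB)).
  have r0 : 0 <= #|D|%:R * (eta * (2 ^+ N * (C * K))).
    apply: mulr_ge0 => //; apply: mulr_ge0 => //; apply: mulr_ge0 => //.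
    exact: exprn_ge0.
  have [k0|k0] := posnP k.
    have -> : elsym (B :|: D) k mu - K = 0 by rewrite /K k0 !elsym0 subrr.
    by rewrite normr0.
  have -> : elsym (B :|: D) k mu
     = mu i * elsym (B :|: D :\ i) k.-1 mu + elsym (B :|: D :\ i) k mu.
    by have := elsymS k.-1 mu iBD; rewrite (prednK k0) E.
  rewrite cD -natr1 mulrDl mul1r -addrA addrC.
  apply: le_trans (ler_normD _ _) _; rewrite lerD //.
  rewrite normrM; apply: ler_pM => //; first exact: muS.
  apply: le_trans (IH1 k.-1 (leq_pred _)) _.
  rewrite ler_wpM2r // ler_weXn2l // ?ler1n //.
  by apply: leq_trans (max_card _) IN.
have [] := main (~: B); first by rewrite disjoints_subset setCK.
rewrite setUCr => _ h.
have h2 : #|~: B|%:R * (eta * (2 ^+ N * (C * K))) <= 1 / 2 * K.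
  apply: le_trans (_ : N%:R * (eta * (2 ^+ N * (C * K))) <= _).
    apply: ler_wpM2r; last by rewrite ler_nat (leq_trans (max_card _)).
    apply: mulr_ge0 => //; apply: mulr_ge0; first exact: exprn_ge0.
    by apply: mulr_ge0 => //; apply: ltW.
  have -> : N%:R * (eta * (2 ^+ N * (C * K))) = N%:R * (eta * (2 ^+ N * C)) * K by ring.
  by rewrite ler_wpM2r.
have h3 := ler_norm (- (elsym [set: I] k mu - K)); rewrite normrN in h3.
rewrite invfM; have -> : 2^-1 = 1 / 2 :> R by rewrite div1r.
lra.
Qed.

End BigSet.

Definition big_prop (R : rcfType) (N : nat) (th eta c : R) : Prop :=
  forall (I : finType) (mu : I -> R) (B : {set I}) (k : nat),
  (#|I| <= N)%N -> (forall b, b \in B -> th <= mu b) ->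
  (forall i, i \notin B -> `|mu i| <= eta) -> (k <= #|B|)%N ->
  c <= elsym [set: I] k mu.

Lemma big_exists (R : rcfType) (N : nat) (th : R) : (0 < N)%N -> 0 < th -> th <= 1 ->
  exists2 eta : R, 0 < eta & exists2 c, 0 < c & big_prop N th eta c.
Proof.
move=> N0 th0 th1; pose C : R := (N%:R / th) ^+ N.
have n1 : 1 <= N%:R :> R by rewrite ler1n.
have q1 : 1 <= N%:R / th by rewrite ler_pdivlMr // mul1r (le_trans th1).
have C1 : 1 <= C by rewrite exprn_ege1.
have P1 : 1 <= 2 ^+ N :> R by rewrite exprn_ege1 // ler1n.
pose X := N%:R * (2 ^+ N * C).
have X1 : 1 <= X by rewrite /X mulr_ege1 // mulr_ege1.
exists (2 * X)^-1; first by rewrite invr_gt0 mulr_gt0 //; lra.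
exists (2 * C)^-1; first by rewrite invr_gt0 mulr_gt0 //; lra.
move=> I mu B k IN muB muS kB.
have e0 : 0 < (2 * X)^-1 by rewrite invr_gt0 mulr_gt0 //; lra.
apply: (elsym_large N0 th0 th1 IN muB muS) => //.
- exact: ltW.
- by rewrite invf_le1 ?mulr_gt0 //; lra.
have -> : N%:R * ((2 * X)^-1 * (2 ^+ N * (N%:R / th) ^+ N)) = X / (2 * X).
  by rewrite mulrCA mulrC.
rewrite invfM mulrCA divff ?gt_eqF //; lra.
Qed.

Definition step_prop (R : rcfType) (N : nat) (th eta c : R) : Prop :=
  [/\ 0 < eta, eta <= th, gap_prop N th eta, 0 < c & big_prop N th eta c].

Lemma next_threshold (R : rcfType) (N : nat) (th : R) : (0 < N)%N -> 0 < th -> th <= 1 ->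
  exists eta c : R, step_prop N th eta c.
Proof.
move=> N0 th0 th1; have [e1 e10 h1] := gap_exists N0 th0 th1.
have [e2 e20 [c c0 h2]] := big_exists N0 th0 th1.
exists (Num.min th (Num.min e1 e2)), c; split=> //.
- by rewrite !lt_min th0 e10 e20.
- by rewrite ge_min lexx.
- move=> I mu xi B o k kap ga IN oB muo muB xi0 muS kB g kap1 gaP.
  apply: (h1 I mu xi B o k kap ga) => // [i iB|].
    by apply: le_trans (muS i iB) _; rewrite !ge_min lexx orbT.
  apply: le_trans kap1; rewrite lerD2l lerN2 ler_pM2l //.
  by rewrite !ge_min lexx orbT.
- move=> I mu B k IN muB muS kB; apply: (h2 I mu B k) => // i iB.
  by apply: le_trans (muS i iB) _; rewrite !ge_min lexx !orbT.
Qed.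

Lemma threshold_chain (R : rcfType) (N m : nat) : (0 < N)%N ->
  exists T c : nat -> R, [/\ T 0 = 1, forall j, (j <= m)%N -> 0 < T j <= 1
    & forall j, (j < m)%N -> step_prop N (T j) (T j.+1) (c j)].
Proof.
move=> N0; elim: m => [|m [T [c [T0 Tp Ts]]]].
  by exists (fun=> 1), (fun=> 1); split=> // j _; rewrite ltr01 lexx.
have /andP[Tm0 Tm1] := Tp m (leqnn m).
have [eta [d st]] := next_threshold N0 Tm0 Tm1.
have [e0 eT _ _ _] := st.
exists (fun j => if j == m.+1 then eta else T j), (fun j => if j == m then d else c j).
split=> // j jm.
  case: eqP => [_|/eqP jm']; first by rewrite e0 (le_trans eT).
  by apply: Tp; rewrite -ltnS ltn_neqAle jm' jm.
rewrite eqSS (ltn_eqF jm); case: eqP => [->//|/eqP jm'].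
by apply: Ts; rewrite ltn_neqAle jm' -ltnS.
Qed.

(** The conclusion [(1 < k)%N] is part of the result: B contains [o], and [k <= #|B|] would
    contradict the smallness of sigma_k. It allows [k] to be written as [k'.+2] for the second
    derivatives. *)
Lemma sigma_ineq_of_small (R : rcfType) (N : nat) : (0 < N)%N ->
  exists dl c : R, [/\ 0 < dl, dl < 1, 0 < c & forall (I : finType) (mu xi : I -> R)
    (o : I) (k : nat) (kap ga : R),
  (#|I| <= N)%N -> mu o = 1 -> (forall i, - dl <= mu i) ->
  (forall i, xi i = 0 \/ mu i <= 1) -> (k <= N)%N -> gard [set: I] k mu ->
  elsym [set: I] k mu < c -> 1 - 2 * dl <= kap -> 0 <= ga <= (10 * k%:R)^-1 ->
  (1 < k)%N /\ sigma_ineq mu xi o k kap ga].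
Proof.
move=> N0; have [T [c [T0 Tp Ts]]] := threshold_chain R N.+1 N0.
have Tanti i j : (i <= j)%N -> (j <= N.+1)%N -> T j <= T i.
  elim: j => [|j IH]; first by rewrite leqn0 => /eqP->.
  rewrite leq_eqVlt => /orP[/eqP->//|ij] jN.
  have [_ le _ _ _] := Ts j jN.
  exact: le_trans le (IH ij (ltnW jN)).
pose cm := \big[Num.min/1]_(j < N.+1) c j.
have cm0 : 0 < cm.
  rewrite /cm; elim/big_ind: _ => // [x y x0 y0|j _]; first by rewrite lt_min x0.
  by have [] := Ts j (ltn_ord j).
have cmle j : (j < N.+1)%N -> cm <= c j.
  by move=> jN; rewrite /cm (bigD1 (Ordinal jN)) //= ge_min lexx.
have /andP[TN0 TN1] := Tp N.+1 (leqnn _).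
(* Halving gives [dl < 1] even if the last threshold equals 1. As [dl] lies below every threshold,
   negative entries are always among the small ones. *)
exists (T N.+1 / 2), cm; split=> //; [lra | lra |].
move=> I mu xi o k kap ga IN muo mul xi0 kN g small kap1 gaP.
pose B j := [set i | T j <= mu i].
have oB j : (j <= N.+1)%N -> o \in B j.
  by move=> jN; rewrite inE muo; have /andP[] := Tp j jN.
have [j jN Bj] : exists2 j, (j < N.+1)%N & B j = B j.+1.
  have [j /eqP Bj|ne] := pickP (fun j : 'I_N.+1 => B j == B j.+1).
    by exists j.
  (* Without a gap the sets [B j] would grow strictly from a nonempty one, and [B N.+1] would have
     more than [N.+1] elements. *)
  have card j : (j <= N.+1)%N -> (j < #|B j|)%N.
    elim: j => [|j IH] jN; first by apply/card_gt0P; exists o; apply: oB.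
    apply: leq_ltn_trans (IH (ltnW jN)) _; apply: proper_card.
    rewrite properEneq; have := ne (Ordinal jN); rewrite /= => ->.
    by apply/subsetP => i; rewrite !inE; apply: le_trans; apply: Tanti.
  have := leq_trans (card N.+1 (leqnn _)) (leq_trans (max_card _) IN).
  by rewrite ltnNge leqnSn.
have /andP[Tj0 Tj1] := Tp j (ltnW jN).
have [e0 eT gap cj0 big] := Ts j jN.
have muB b : b \in B j -> T j <= mu b by rewrite inE.
have TNj : T N.+1 <= T j.+1 by apply: Tanti.
have muS i : i \notin B j -> `|mu i| <= T j.+1.
  rewrite Bj inE -ltNge => lt; rewrite ler_norml (ltW lt) andbT.
  by apply: le_trans (mul i); rewrite lerN2; lra.
have [Bk|Bk] := ltnP #|B j| k; last first.
  have := lt_le_trans small (cmle j jN).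
  by rewrite ltNge (big I mu (B j) k IN muB muS Bk).
have oBj := oB j (ltnW jN).
split; first by apply: leq_ltn_trans Bk; apply/card_gt0P; exists o.
apply: (gap I mu xi (B j) o k kap ga IN) => //.
- by rewrite Bk.
- by apply: le_trans kap1; lra.
Qed.

(** * Homogeneity, concatenation and partial derivatives *)

Lemma elsym_subsets (R : comNzRingType) (I : finType) (v : I -> R) j :
  elsym [set: I] j v = \sum_(A : {set I} | #|A| == j) \prod_(i in A) v i.
Proof.
have pr (A : {set I}) : \prod_(i in A) (v i *: 'X : {poly R})
    = (\prod_(i in A) v i) *: 'X^#|A|.
  by rewrite scaler_prod prodr_const.
rewrite /elsym (eq_bigl xpredT) => [|i]; last by rewrite inE.
have -> : \prod_i (1 + v i *: 'X : {poly R})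
    = \sum_(A : {set I}) (\prod_(i in A) v i) *: 'X^#|A|.
  under eq_bigr do rewrite addrC.
  rewrite bigA_distr; apply: eq_big => [A|A _]; first by rewrite inE.
  by rewrite -pr [RHS]big_mkcond.
rewrite coef_sum [RHS]big_mkcond; apply: eq_bigr => A _.
by rewrite coefZ coefXn eq_sym; case: eqP; rewrite ?mulr1 ?mulr0.
Qed.

Lemma elsym_scale (R : comNzRingType) (I : finType) (A : {set I}) (v : I -> R) (c : R) j :
  elsym A j (fun i => c * v i) = c ^+ j * elsym A j v.
Proof.
elim/set_ind: A j => A IH j; have [->|[i iA]] := set_0Vmem A.
  by case: j => [|j]; rewrite ?elsym0 ?expr0 ?mulr1 // !elsym_set0 mulr0.
case: j => [|j]; first by rewrite !elsym0 expr0 mulr1.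
rewrite !(elsymS _ _ iA) !IH // exprS; ring.
Qed.

Lemma elsym_line (R : comNzRingType) (I : finType) (A : {set I}) (v v' : I -> R) (c : R) i j :
  i \in A -> v' i = v i + c -> (forall l, l != i -> v' l = v l) ->
  elsym A j.+1 v' = elsym A j.+1 v + c * elsym (A :\ i) j v.
Proof.
move=> iA vi vl; rewrite !(elsymS _ _ iA) vi.
have e m : elsym (A :\ i) m v' = elsym (A :\ i) m v.
  by apply: eq_elsym => l; rewrite !inE => /andP[li _]; apply: vl.
rewrite !e; ring.
Qed.

Lemma elsym_row_mx (R : comNzRingType) (n m k : nat) (x : 'rV[R]_n) (y : 'rV[R]_m) :
  elsym [set: 'I_(n + m)] k (row_mx x y 0)
  = \sum_(j < k.+1) elsym [set: 'I_n] (k - j) (x 0) * elsym [set: 'I_m] j (y 0).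
Proof.
rewrite {1}/elsym (eq_bigl xpredT) => [|i]; last by rewrite inE.
rewrite big_split_ord /= coefMr; apply: eq_bigr => j _; congr (_ * _); rewrite /elsym.
  rewrite [in RHS](eq_bigl xpredT) => [|i]; last by rewrite inE.
  by rewrite (eq_bigr (fun i => 1 + x 0 i *: 'X)) // => i _; rewrite row_mxEl.
rewrite [in RHS](eq_bigl xpredT) => [|i]; last by rewrite inE.
by rewrite (eq_bigr (fun i => 1 + y 0 i *: 'X)) // => i _; rewrite row_mxEr.
Qed.

Section Ord.
Variables (R : rcfType) (n m : nat) (x : 'rV[R]_n) (y : 'rV[R]_m).
Local Notation TT := [set: 'I_(n + m)].
Let v := row_mx x y 0.
Let G k := elsym TT k v.
Let G1 k i := elsym (TT :\ lshift m i) k v.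
Let G2 k i j := elsym (TT :\ lshift m i :\ lshift m j) k v.

Lemma sum_lshift (P : pred 'I_(n + m)) (F : 'I_(n + m) -> R) :
  (forall j, F (rshift n j) = 0) ->
  \sum_(i | P i) F i = \sum_(i | P (lshift m i)) F (lshift m i).
Proof.
move=> F0; rewrite big_mkcond big_split_ord /= [X in _ + X]big1 ?addr0.
  by rewrite -big_mkcond.
by move=> j _; rewrite F0; case: ifP.
Qed.

(** Undoes the normalisation: with entries scaled by [a = l^-1] every term carries the common factor
    [a ^+ k]. The sums over [y] vanish with the direction, and dividing by F gives the form of the
    theorem. *)
Lemma sigma_ineq_ord (xi : 'rV[R]_n) (o : 'I_n) (k : nat) (l kap ga : R) :
  nat_of_ord o = 0%N -> 0 < l -> 0 < G k.+2 ->
  sigma_ineq (fun i => l^-1 * v i) (row_mx xi 0 0) (lshift m o) k.+2 kap ga ->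
  (1 + ga) * (G1 k.+1 o * xi 0 o ^+ 2 / (l * G k.+2)) <=
  - (\sum_(p < n) \sum_(q < n | p != q) G2 k q p * xi 0 p * xi 0 q / G k.+2)
  + 2 * ((\sum_(i < n) G1 k.+1 i * xi 0 i) ^+ 2 / G k.+2 ^+ 2)
  + 2 * (\sum_(i < n | (o < i)%N) G1 k.+1 i * xi 0 i ^+ 2 * (kap / (l * G k.+2))).
Proof.
move=> o0 l0 Gp; rewrite /sigma_ineq /= !elsym_scale.
set w := row_mx xi 0 0.
have wl i : w (lshift m i) = xi 0 i by rewrite /w row_mxEl.
have wr i : w (rshift n i) = 0 by rewrite /w row_mxEr mxE.
rewrite (sum_lshift _ (F := fun p => \sum_(q in TT :\ p)
   elsym (TT :\ p :\ q) k (fun i => l^-1 * v i) * w p * w q)); last first.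
  by move=> j; rewrite big1 // => q _; rewrite wr mulr0 mul0r.
rewrite (sum_lshift _ (F := fun p => elsym (TT :\ p) k.+1 (fun i => l^-1 * v i) * w p));
  last by move=> j; rewrite wr mulr0.
rewrite (sum_lshift _ (F := fun p => elsym (TT :\ p) k.+1 (fun i => l^-1 * v i) * w p ^+ 2));
  last by move=> j; rewrite wr expr0n mulr0.
rewrite wl; set a := l^-1; have a0 : 0 < a by rewrite invr_gt0.
have -> : \sum_(i | lshift m i \in TT)
     elsym (TT :\ lshift m i) k.+1 (fun i => a * v i) * w (lshift m i)
   = a ^+ k.+1 * \sum_(i < n) G1 k.+1 i * xi 0 i.
  rewrite mulr_sumr; apply: eq_big => i; first by rewrite inE.
  by rewrite wl elsym_scale mulrA.
have -> : \sum_(i | lshift m i \in TT :\ lshift m o)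
     elsym (TT :\ lshift m i) k.+1 (fun i => a * v i) * w (lshift m i) ^+ 2
   = a ^+ k.+1 * \sum_(i < n | (o < i)%N) G1 k.+1 i * xi 0 i ^+ 2.
  rewrite mulr_sumr; apply: eq_big => i; last by move=> _; rewrite wl elsym_scale -mulrA.
  by rewrite !inE andbT (inj_eq (@lshift_inj _ _)) o0 -val_eqE /= o0 lt0n.
have -> : \sum_(p | lshift m p \in TT) \sum_(q in TT :\ lshift m p)
     elsym (TT :\ lshift m p :\ q) k (fun i => a * v i) * w (lshift m p) * w q
   = a ^+ k * \sum_(p < n) \sum_(q < n | p != q) G2 k q p * xi 0 p * xi 0 q.
  rewrite mulr_sumr; apply: eq_big => p; first by rewrite inE.
  rewrite sum_lshift => [_|j]; last by rewrite wr mulr0.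
  rewrite mulr_sumr; apply: eq_big => q.
    by rewrite !inE andbT (inj_eq (@lshift_inj _ _)) eq_sym.
  by rewrite !wl elsym_scale /G2 setD1C !mulrA.
have -> : \sum_(p < n) \sum_(q < n | p != q) G2 k q p * xi 0 p * xi 0 q / G k.+2
   = (\sum_(p < n) \sum_(q < n | p != q) G2 k q p * xi 0 p * xi 0 q) / G k.+2.
  by rewrite mulr_suml; apply: eq_bigr => p _; rewrite mulr_suml.
rewrite -(mulr_suml _ _ (fun i => G1 k.+1 i * xi 0 i ^+ 2)).
rewrite -/(G k.+2) -/(G1 k.+1 o).
set S2 := \sum_(p < n) _; set S1 := \sum_(i < n) _; set SD := \sum_(i < n | _) _.
have ak : 0 < a ^+ k by rewrite exprn_gt0.
have la : l = a^-1 by rewrite /a invrK.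
have -> : a ^+ k.+1 * G1 k.+1 o * xi 0 o ^+ 2
  = a ^+ k * (a * (G1 k.+1 o * xi 0 o ^+ 2)) by rewrite exprS; ring.
have -> : (a ^+ k.+1 * S1) ^+ 2 / (a ^+ k.+2 * G k.+2) = a ^+ k * (S1 ^+ 2 / G k.+2).
  by rewrite !exprS; field; rewrite !gt_eqF.
have -> : - (a ^+ k * S2) + 2 * (a ^+ k * (S1 ^+ 2 / G k.+2))
   + 2 * kap * (a ^+ k.+1 * SD)
  = a ^+ k * (- S2 + 2 * (S1 ^+ 2 / G k.+2) + 2 * kap * (a * SD)).
  by rewrite (exprS a); ring.
rewrite mulrCA ler_pM2l // -(ler_pM2r (_ : 0 < (G k.+2)^-1)) ?invr_gt0 // => h.
rewrite la; apply: le_trans (_ : (1 + ga) * (a * (G1 k.+1 o * xi 0 o ^+ 2)) / G k.+2 <= _).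
  by rewrite le_eqVlt; apply/orP; left; apply/eqP; field; rewrite !gt_eqF.
apply: le_trans h _.
by rewrite le_eqVlt; apply/orP; left; apply/eqP; field; rewrite !gt_eqF.
Qed.

End Ord.

(** Explains [K0 = 1 + c^-1]: the ratio [f / l] is then below c/(1 + c), hence below both 1 and c.
    Its k-th power is no larger than itself, so no root of [c] is taken. *)
Lemma powX_lt (R : realFieldType) (l f c : R) (k : nat) : (0 < k)%N -> 0 < c ->
  0 <= f -> 0 < l -> (1 + c^-1) * f < l -> (l^-1) ^+ k * f ^+ k < c.
Proof.
move=> k0 c0 f0 l0 h; rewrite -exprMn.
have c1 : 0 < c^-1 by rewrite invr_gt0.
have d0 : 0 < 1 + c^-1 by lra.
have h1 : l^-1 * f < (1 + c^-1)^-1.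
  rewrite mulrC ltr_pdivrMr // mulrC ltr_pdivlMr // mulrC; exact: h.
have h2 : 0 <= l^-1 * f by rewrite mulr_ge0 // invr_ge0 ltW.
have d1 : (1 + c^-1)^-1 <= 1 by rewrite invf_le1 //; lra.
apply: le_lt_trans (_ : _ <= l^-1 * f) _.
  by rewrite ler_iXnr // (le_trans (ltW h1)).
apply: lt_le_trans h1 _; rewrite -[leRHS]invrK lef_pV2 ?posrE //; lra.
Qed.

(* Directional derivatives, Vieta's formulas and the theorem *)
Require Import Defs.
From mathcomp Require Import all_boot all_order all_algebra.
From mathcomp Require Import all_classical all_reals all_analysis.

Import Order.TTheory GRing.Theory Num.Theory.
Import numFieldNormedType.Exports.

Local Open Scope ring_scope.
Local Open Scope classical_set_scope.

Lemma derive_affine (R : realType) (n : nat) (f : 'rV[R]_n -> R) (v x : 'rV[R]_n) (c : R) :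
  (forall h : R, f (h *: v + x) = f x + h * c) -> 'D_v f x = c.
Proof.
move=> fl; rewrite /derive; apply: (cvg_lim (@Rhausdorff R)).
apply: cvg_near_cst; near=> h.
rewrite /= fl addrC addKr /GRing.scale /= mulrA mulVf ?mul1r //.
by near: h; exact: nbhs_dnbhs_neq.
Unshelve. all: by end_near. Qed.

Lemma sigma_elsym (R : realType) (N j : nat) (x : 'rV[R]_N) :
  sigma j x = elsym [set: 'I_N]%SET j (x 0).
Proof.
rewrite elsym_subsets /sigma /mpoly.mesym.
rewrite (big_morph _ (mpoly.mevalD (x 0)) (mpoly.meval0 (x 0))).
apply: eq_bigr => h _.
rewrite (big_morph _ (mpoly.mevalM (x 0)) (mpoly.meval1 (x 0))).
by apply: eq_bigr => i _; rewrite mpoly.mevalXU.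
Qed.

(** Vieta's formulas; the sign in the definition of P cancels the sign of the elementary symmetric
    function of the roots. *)
Lemma Ppoly_coef (R : realType) (m : nat) (a y : 'rV[R]_m) (r : 'I_m) :
  Ppoly a = \prod_(i < m) ('X - (y 0 i)%:P) -> a 0 r = sigma r.+1 y.
Proof.
move=> e; pose cs : m.-tuple R := [tuple y 0 i | i < m].
have := @mpoly.mroots_coeff R m cs (lift ord0 r).
have -> : \prod_(c <- cs) ('X - c%:P) = Ppoly a.
  by rewrite e big_map big_enum.
have -> : mpoly.meval (tnth cs) (mpoly.mesym m R (lift ord0 r)) = sigma r.+1 y.
  by rewrite lift0; apply: mpoly.meval_eq => i; rewrite tnth_mktuple.
rewrite lift0 /Ppoly coefD coefXn coef_sum (bigD1 r) //= coefZ coefXn eqxx.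
have -> : (m - r.+1 == m)%N = false by apply/eqP; have := ltn_ord r; lia.
rewrite big1 => [|i ir]; last first.
  rewrite coefZ coefXn; have -> : (m - r.+1 == m - i.+1)%N = false.
    apply/negbTE; move: ir; apply: contraNN => /eqP h; apply/eqP/val_inj => /=.
    by have := ltn_ord r; have := ltn_ord i; lia.
  by rewrite mulr0.
rewrite add0r addr0 mulr1 => /(congr1 (fun z => (-1) ^+ r.+1 * z)).
by rewrite !mulrA -expr2 sqrr_sign !mul1r.
Qed.

(** F is sigma_k of the concatenation, expanded by degree in [y]. The terms of degree above [m]
    vanish, and [m < k] puts the cut inside the sum. *)
Lemma Ffun_elsym (R : realType) (n k m : nat) (a y : 'rV[R]_m) (x : 'rV[R]_n) :
  (m < k)%N -> Ppoly a = \prod_(i < m) ('X - (y 0 i)%:P) ->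
  Ffun k a x = elsym [set: 'I_(n + m)]%SET k (row_mx x y 0).
Proof.
move=> mk e; rewrite elsym_row_mx /Ffun big_ord_recl /= subn0 elsym0 mulr1 sigma_elsym.
congr (_ + _); rewrite -(subnKC (ltnW mk)) big_split_ord /= [X in _ = _ + X]big1 ?addr0.
  apply: eq_bigr => r _; rewrite (Ppoly_coef _ e) !sigma_elsym subnKC ?(ltnW mk) //.
  by rewrite mulrC.
move=> i _; rewrite [elsym [set: 'I_m] _ _]elsym_gt ?mulr0 //.
by rewrite cardsT card_ord /bump /=; lia.
Qed.

Lemma partial_elsym (R : realType) (n m k : nat) (i : 'I_n) (x : 'rV[R]_n) (y : 'rV[R]_m)
    (A : {set 'I_(n + m)}) : lshift m i \in A ->
  partial i (fun x => elsym A k.+1 (row_mx x y 0)) x = elsym (A :\ lshift m i)%SET k (row_mx x y 0).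
Proof.
move=> iA; apply: derive_affine => h; apply: elsym_line iA _ _.
  by rewrite !row_mxEl !mxE !eqxx mulr1 addrC.
move=> l; case: (split_ordP l) => j ->; rewrite ?row_mxEr ?row_mxEl //.
by rewrite (inj_eq (@lshift_inj _ _)) !mxE eqxx => /negPf ->; rewrite mulr0 add0r.
Qed.

Lemma ymin_le (R : realType) (m : nat) (y : 'rV[R]_m) i : (ymin y <= (y 0 i)%:E)%E.
Proof. by rewrite /ymin (bigD1 i) //= ge_min lexx. Qed.

Unset Implicit Arguments.

Theorem lemma3p2 (R : realType) (n k : nat) (hn : (2 < n)%N)
    (hk : (1 <= k <= n)%N) :
  exists delta0 K0 : R, [/\ 0 < delta0, delta0 < 1, 0 < K0 &
  forall delta : R, 0 < delta <= delta0 ->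
  forall (m : nat) (a y : 'rV[R]_m) (lambda : 'rV[R]_n),
  let i1 : 'I_n := Ordinal (ltnW (ltnW hn)) in
  let lambda1 : R := lambda 0 i1 in
  let K1 : \bar R := ((delta^-1)%:E * ymin y)%E in
  let F : 'rV[R]_n -> R := Ffun k a in
  let F_ (i : 'I_n) : R := partial i F lambda in
  let F__ (p q : 'I_n) : R := partial p (partial q F) lambda in
  let gamma : R := 1 / (1 + 16 * k%:R) in
  (m < k)%N ->
  Ppoly a = \prod_(i < m) ('X - (y 0 i)%:P) ->
  garding k (row_mx lambda y) ->
  (forall i j : 'I_n, (i <= j)%N -> lambda 0 j <= lambda 0 i) ->
  (forall i : 'I_n, i.+1 = n -> - delta * lambda1 <= lambda 0 i) ->
  (forall i : 'I_m, i.+1 = m -> - delta * lambda1 <= y 0 i) ->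
  (Order.max (K0 * (F lambda `^ (k%:R^-1)))%:E (- K1) < lambda1%:E)%E ->
  forall xi : 'rV[R]_n,
  - (\sum_(p < n) \sum_(q < n | p != q)
       F__ p q * xi 0 p * xi 0 q / F lambda)
  + 2 * ((\sum_(i < n) F_ i * xi 0 i) ^+ 2 / F lambda ^+ 2)
  + 2 * (\sum_(i < n | (i1 < i)%N)
       F_ i * xi 0 i ^+ 2 / ((1 + 2 * delta) * lambda1 * F lambda))
  >= (1 + gamma) * (F_ i1 * xi 0 i1 ^+ 2 / (lambda1 * F lambda))].
Proof.
have [k0 kn] := andP hk.
(* Since [m < k <= n], the concatenated vector has at most [n + n] entries. The constants are thus
   fixed before [m] is known. *)
have [dl [c [dl0 dl1 c0 norm]]] := @sigma_ineq_of_small R (n + n) (ltn_addl n (ltnW (ltnW hn))).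
exists dl, (1 + c^-1); split=> //.
  by rewrite addr_gt0 // invr_gt0.
move=> delta /andP[de0 dedl] m a y lambda i1 lambda1 K1 F F_ F__ gamma mk eP gy lmono llast ylast.
rewrite gt_max => /andP[lF lK] xi.
have FE : F = fun x => elsym [set: 'I_(n + m)]%SET k (row_mx x y 0).
  by apply/funext => x; rewrite /F (Ffun_elsym _ mk eP).
set v := row_mx lambda y 0.
have gv : gard [set: 'I_(n + m)]%SET k v.
  move=> [|j] jk; first by rewrite elsym0.
  by rewrite /v -sigma_elsym; apply: gy.
have F0 : 0 < F lambda by rewrite FE; apply: gv.
have l0 : 0 < lambda1.
  rewrite lte_fin in lF; apply: le_lt_trans lF.
  by rewrite mulr_ge0 ?powR_ge0 // addr_ge0 // invr_ge0 ltW.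
have li0 : 0 < lambda1^-1 by rewrite invr_gt0.
(* [lambda1 > - K1] says that the least entry of [y] exceeds [- delta * lambda1], which bounds all
   entries of [y] at once. *)
have vy i : - delta * lambda1 <= y 0 i.
  have h : (K1 <= (delta^-1 * y 0 i)%:E)%E.
    by rewrite EFinM /K1 lee_pmul2l ?ymin_le // lte_fin invr_gt0.
  have := le_lt_trans _ lK; rewrite -leeN2 in h => /(_ _ h).
  rewrite -EFinN lte_fin -mulrN ltr_pdivrMl // => hy.
  by rewrite mulNr lerNl ltW.
have vl i : - delta * lambda1 <= lambda 0 i.
  have n1 : (n.-1 < n)%N by rewrite prednK // (ltn_trans _ hn).
  apply: le_trans (lmono i (Ordinal n1) _); last by rewrite /= -ltnS prednK // (ltn_trans _ hn).
  by apply: llast; rewrite /= prednK // (ltn_trans _ hn).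
have vmu i : - dl <= lambda1^-1 * v i.
  rewrite ler_pdivlMl //; apply: le_trans (_ : - delta * lambda1 <= _).
    by rewrite mulrC !mulNr lerN2 ler_pM2r.
  by rewrite /v; case: (split_ordP i) => j ->; rewrite ?row_mxEr ?row_mxEl.
have vxi i : row_mx xi 0 0 i = 0 \/ lambda1^-1 * v i <= 1.
  rewrite /v; case: (split_ordP i) => j ->; rewrite ?row_mxEr ?row_mxEl.
    by right; rewrite ler_pdivrMl // mulr1; apply: lmono.
  by left; rewrite mxE.
have kap1 : 1 - 2 * dl <= (1 + 2 * delta)^-1.
  rewrite -[leRHS]mul1r ler_pdivlMr; last by lra.
  by have : 0 <= dl * delta; [rewrite mulr_ge0 // ltW | lra].
(* The margin 1/(10 k) is at least [gamma], as 10 k <= 1 + 16 k. *)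
have ga1 : 0 <= gamma <= (10 * k%:R)^-1.
  have kp : 0 < k%:R :> R by rewrite ltr0n.
  have k1 : 1 <= k%:R :> R by rewrite ler1n.
  rewrite /gamma mul1r invr_ge0 lef_pV2 ?posrE; first by apply/andP; split; lra.
    by lra.
  by lra.
have Fc : elsym [set: 'I_(n + m)]%SET k (fun i => lambda1^-1 * v i) < c.
  rewrite elsym_scale; set f := elsym _ _ _; have -> : f = F lambda by rewrite FE.
  have -> : F lambda = (F lambda `^ k%:R^-1) ^+ k.
    by rewrite -powR_mulrn ?powR_ge0 // -powRrM mulVf ?powRr1 ?ltW // pnatr_eq0 -lt0n.
  by apply: powX_lt => //; exact: powR_ge0.
have cnm : (#|'I_(n + m)| <= n + n)%N.
  by rewrite card_ord leq_add2l ltnW // (leq_trans mk).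
have v1 : lambda1^-1 * v (lshift m i1) = 1.
  by rewrite /v row_mxEl mulVf // gt_eqF.
have gmu : gard [set: 'I_(n + m)]%SET k (fun i => lambda1^-1 * v i).
  by move=> j jk; rewrite elsym_scale mulr_gt0 ?exprn_gt0 // gv.
have [k2 ineq] := norm _ _ _ _ k _ _ cnm v1 vmu vxi (leq_trans kn (leq_addr n n))
  gmu Fc kap1 ga1.
have [k' ke] : exists k', k = k'.+2 by exists k.-2; rewrite -[in LHS](subnKC k2) addnC addn2 subn2.
rewrite ke in FE ineq.
have G0 := F0; rewrite FE in G0.
have := sigma_ineq_ord (o := i1) erefl l0 G0 ineq.
have F1 i : F_ i = elsym ([set: 'I_(n + m)] :\ lshift m i)%SET k'.+1 v.
  by rewrite /F_ FE partial_elsym ?inE.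
have F2 p q : p != q ->
  F__ p q = elsym ([set: 'I_(n + m)] :\ lshift m q :\ lshift m p)%SET k' v.
  move=> pq; rewrite /F__.
  have -> : partial q F = fun x => elsym ([set: 'I_(n + m)] :\ lshift m q)%SET k'.+1 (row_mx x y 0).
    by apply/funext => x; rewrite FE partial_elsym ?inE.
  by rewrite partial_elsym // !inE andbT (inj_eq (@lshift_inj _ _)).
move=> h; apply: le_trans (le_trans _ h) _; rewrite le_eqVlt; apply/orP; left; apply/eqP.
  by rewrite F1 FE.
rewrite FE; congr (- _ + 2 * (_ ^+ 2 / _) + 2 * _).
- by apply: eq_bigr => p _; apply: eq_bigr => q pq; rewrite F2.
- by apply: eq_bigr => p _; rewrite F1.
- by apply: eq_bigr => p _; rewrite F1 -mulrA -invfM !mulrA.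
Qed.
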